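(* Let $\alpha>0$ and let $f\in\mathrm{BMO}^1$ be a slice function on $\mathbb H$. Then the following are equivalent: (a) $T_f$ is bounded on $F_\alpha^2$; (b) $B_\alpha f\in L_s^\infty(\mathbb H,dV)$; (c) $B_\beta f\in L_s^\infty(\mathbb H,dV)$ for some, equivalently for every, $\beta>0$; (d) $\widehat f_r\in L_s^\infty(\mathbb H,dV)$ for some, equivalently for every, $r>0$.
   Context: $\mathbb H$ denotes the quaternions, $\mathbb S=\{I\in\mathbb H: I^2=-1\}$, $\mathbb C_I=\{x+yI:x,y\in\mathbb R\}$ for $I\in\mathbb S$, $m_{2,I}$ is Lebesgue measure on $\mathbb C_I$, $B_I(z,r)$ is the Euclidean disk in $\mathbb C_I$ with center $z$ and radius $r$, and $f_I=f|_{\mathbb C_I}$. A (left) slice function is $f:\mathbb H\to\mathbb H$ of the form $f(x+yI)=f_0(x,y)+If_1(x,y)$ for all $x,y\in\mathbb R$, $I\in\mathbb S$, where $f_0,f_1:\mathbb R^2\to\mathbb H$ satisfy $f_0(x,-y)=f_0(x,y)$ and $f_1(x,-y)=-f_1(x,y)$. It is slice regular if moreover $f_0,f_1$ are $C^1$ and $\partial_xf_0-\partial_yf_1=0$, $\partial_yf_0+\partial_xf_1=0$. The slice product of slice functions $f,g$ is the slice function $(f\star g)(x+yI)=(f_0g_0-f_1g_1)(x,y)+I(f_0g_1+f_1g_0)(x,y)$. Slice functions used as symbols are measurable. Measure $dV$: every non-real quaternion is uniquely $x+yI$ with $I\in\mathbb S$, $y>0$, so $\mathbb H\setminus\mathbb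 R\cong\mathbb S\times\mathbb C^+$ (with $\mathbb C^+$ the open upper half plane), and $dV(x+yI)=dm_{2,I}(x+yI)\,d\sigma(I)$, where $\sigma$ is the normalized surface measure on $\mathbb S$; the real axis has $dV$-measure $0$. $L_s^\infty(\mathbb H,dV)$ is the space of measurable slice functions on $\mathbb H$ that are essentially bounded with respect to $dV$. Put $d\lambda_\alpha(z)=\frac{2\alpha}{\pi}e^{-\alpha|z|^2}dV(z)$. The global quaternionic Fock space $F_\alpha^2$ is the space of slice regular $f$ on $\mathbb H$ with $\|f\|_{2,\alpha}^2=\int_{\mathbb H}|f|^2\,d\lambda_\alpha<\infty$, a right quaternionic Hilbert space with $\langle f,g\rangle_\alpha=\int_{\mathbb H}\overline{g}\,f\,d\lambda_\alpha$. Its reproducing kernel is $K_\alpha(z,w)=\sum_{n\ge0}\frac{\alpha^n}{n!}z^n\overline w^{\,n}$. Toeplitz operator: $P_\alpha h(z)=\int_{\mathbb H}K_\alpha(z,w)h(w)\,d\lambda_\alpha(w)$ (on square-integrable slice functions with respect to $\lambda_\alpha$ this is the orthogonal projection onto $F_\alpha^2$). Let $\mathcal D$ be the dense subspace of $F_\alpha^2$ of finite sums $\sum_kK_\alpha(\cdot,a_k)c_k$, $a_k,c_k\in\mathbb H$. $T_f$ is initially defined on $\mathcal D$ by $T_fg=P_\alpha(f\star g)$; ''$T_f$ is bounded on $F_\alpha^2$'' means that it extends from $\mathcal D$ to a bounded operator on $F_\alpha^2$. $\mathrm{BMO}^1$: for $r>0$ and $f:\mathbb H\to\mathbb H$ locally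 integrable on each slice $\mathbb C_I$, put $\widehat f_{r,I}(z)=\frac1{\pi r^2}\int_{B_I(z,r)}f_I\,dm_{2,I}$ for $z\in\mathbb C_I$, and say $f\in\mathrm{BMO}^1$ if $\sup_{I\in\mathbb S}\sup_{z\in\mathbb C_I}\frac1{\pi r^2}\int_{B_I(z,r)}|f_I(w)-\widehat f_{r,I}(z)|\,dm_{2,I}(w)<\infty$; this condition does not depend on the choice of $r>0$. For a slice function $f$ the averages are compatible across slices and define a slice function $\widehat f_r$ on $\mathbb H$ by $\widehat f_r(z)=\widehat f_{r,I}(z)$ for $z\in\mathbb C_I$. Berezin transform: for $\gamma>0$, $(B_\gamma f)(z)=\frac{\gamma}{\pi}\int_{\mathbb C_I}e^{-\gamma|w-z|^2}f(w)\,dm_{2,I}(w)$ for $z\in\mathbb C_I$, $I\in\mathbb S$; this is a well-defined slice function on $\mathbb H$. *)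

(* Defs.v *)
From HB Require Import structures.
From mathcomp Require Import all_boot all_order all_algebra.
From mathcomp Require Import all_classical all_reals all_analysis.
From mathcomp Require Import measurable_realfun ring lra.

Set Implicit Arguments.
Unset Strict Implicit.
Unset Printing Implicit Defensive.

Import Order.TTheory GRing.Theory Num.Theory.
Import numFieldNormedType.Exports.

Local Open Scope classical_set_scope.
Local Open Scope ring_scope.

Record quat (R : realType) := Quat { q_re : R; q_i : R; q_j : R; q_k : R }.
Arguments q_re {R} _.
Arguments q_i {R} _.
Arguments q_j {R} _.
Arguments q_k {R} _.

Section Quaternions.
Context {R : realType}.
Local Notation H := (quat R).
Implicit Types (p q r : H) (a : R).

Definition quat_tuple q : R * R * R * R := (q_re q, q_i q, q_j q, q_k q).
Definition tuple_quat (t : R * R * R * R) : H :=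
  Quat t.1.1.1 t.1.1.2 t.1.2 t.2.

Lemma quat_tupleK : cancel quat_tuple tuple_quat.
Proof. by case. Qed.

HB.instance Definition _ := Choice.copy H (can_type quat_tupleK).

Lemma quat_ext p q : q_re p = q_re q -> q_i p = q_i q ->
  q_j p = q_j q -> q_k p = q_k q -> p = q.
Proof. by case: p q => [????] [????] /= -> -> -> ->. Qed.

Definition qadd p q :=
  Quat (q_re p + q_re q) (q_i p + q_i q) (q_j p + q_j q) (q_k p + q_k q).
Definition qopp p := Quat (- q_re p) (- q_i p) (- q_j p) (- q_k p).

Lemma qaddA : associative qadd.
Proof. by move=> p q r; apply: quat_ext => /=; rewrite addrA. Qed.
Lemma qaddC : commutative qadd.
Proof. by move=> p q; apply: quat_ext => /=; rewrite addrC. Qed.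
Lemma qadd0 : left_id (Quat 0 0 0 0) qadd.
Proof. by move=> p; apply: quat_ext => /=; rewrite add0r. Qed.
Lemma qaddN : left_inverse (Quat 0 0 0 0) qopp qadd.
Proof. by move=> p; apply: quat_ext => /=; rewrite addNr. Qed.

HB.instance Definition _ := GRing.isZmodule.Build H qaddA qaddC qadd0 qaddN.

Definition qmul p q := Quat
  (q_re p * q_re q - q_i p * q_i q - q_j p * q_j q - q_k p * q_k q)
  (q_re p * q_i q + q_i p * q_re q + q_j p * q_k q - q_k p * q_j q)
  (q_re p * q_j q - q_i p * q_k q + q_j p * q_re q + q_k p * q_i q)
  (q_re p * q_k q + q_i p * q_j q - q_j p * q_i q + q_k p * q_re q).

Lemma qmulA : associative qmul.
Proof. by move=> p q r; apply: quat_ext => /=; ring. Qed.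
Lemma qmul1l : left_id (Quat 1 0 0 0) qmul.
Proof. by move=> p; apply: quat_ext => /=; ring. Qed.
Lemma qmul1r : right_id (Quat 1 0 0 0) qmul.
Proof. by move=> p; apply: quat_ext => /=; ring. Qed.
Lemma qmulDl : left_distributive qmul +%R.
Proof. by move=> p q r; apply: quat_ext => /=; ring. Qed.
Lemma qmulDr : right_distributive qmul +%R.
Proof. by move=> p q r; apply: quat_ext => /=; ring. Qed.
Lemma q1_neq0 : Quat 1 0 0 0 != 0 :> H.
Proof. by apply/eqP => -[] /eqP; rewrite oner_eq0. Qed.

HB.instance Definition _ := GRing.Zmodule_isNzRing.Build H
  qmulA qmul1l qmul1r qmulDl qmulDr q1_neq0.

Definition qscale a p := Quat (a * q_re p) (a * q_i p) (a * q_j p) (a * q_k p).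

Lemma qscaleA a b p : qscale a (qscale b p) = qscale (a * b) p.
Proof. by apply: quat_ext => /=; rewrite mulrA. Qed.
Lemma qscale1 : left_id 1 qscale.
Proof. by move=> p; apply: quat_ext => /=; rewrite mul1r. Qed.
Lemma qscaleDr : right_distributive qscale +%R.
Proof. by move=> a p q; apply: quat_ext => /=; rewrite mulrDr. Qed.
Lemma qscaleDl p : {morph qscale^~ p : a b / a + b}.
Proof. by move=> a b; apply: quat_ext => /=; rewrite mulrDl. Qed.

HB.instance Definition _ := GRing.Zmodule_isLmodule.Build R H
  qscaleA qscale1 qscaleDr qscaleDl.

Lemma qscaleAl a p q : a *: (p * q) = (a *: p) * q.
Proof. by apply: quat_ext => /=; ring. Qed.
HB.instance Definition _ := GRing.Lmodule_isLalgebra.Build R H qscaleAl.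

Lemma qscaleAr a p q : a *: (p * q) = p * (a *: q).
Proof. by apply: quat_ext => /=; ring. Qed.
HB.instance Definition _ := GRing.Lalgebra_isAlgebra.Build R H qscaleAr.

Definition qconj p := Quat (q_re p) (- q_i p) (- q_j p) (- q_k p).
Definition qim p := Quat 0 (q_i p) (q_j p) (q_k p).

Definition qnorm p :=
  Num.sqrt (q_re p ^+ 2 + q_i p ^+ 2 + q_j p ^+ 2 + q_k p ^+ 2).

Lemma qnormD p q : qnorm (p + q) <= qnorm p + qnorm q.
Proof.
case: p q => [a b c d] [e f g h]; rewrite /qnorm /=.
set x := (X in _ <= Num.sqrt X + _); set y := (X in _ <= _ + Num.sqrt X).
have x0 : 0 <= x by rewrite !addr_ge0 ?sqr_ge0.
have y0 : 0 <= y by rewrite !addr_ge0 ?sqr_ge0.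
rewrite -[leRHS]ger0_norm ?addr_ge0 ?sqrtr_ge0// -sqrtr_sqr; apply: ler_wsqrtr.
rewrite [leRHS]sqrrD !sqr_sqrtr// -sqrtrM//.
suff CS : a * e + b * f + c * g + d * h <= Num.sqrt (x * y).
  by rewrite -mulr_natr /x /y; nra.
apply: le_trans (ler_norm _) _; rewrite -sqrtr_sqr; apply: ler_wsqrtr.
rewrite -subr_ge0 (_ : _ - _ = (a * f - b * e) ^+ 2 + (a * g - c * e) ^+ 2 +
  (a * h - d * e) ^+ 2 + (b * g - c * f) ^+ 2 + (b * h - d * f) ^+ 2 +
  (c * h - d * g) ^+ 2); last by rewrite /x /y; ring.
by rewrite !addr_ge0 ?sqr_ge0.
Qed.

Lemma qnormZ a p : qnorm (a *: p) = `|a| * qnorm p.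
Proof.
rewrite /qnorm /= -sqrtr_sqr -sqrtrM ?sqr_ge0//.
by congr Num.sqrt; ring.
Qed.

Lemma qnorm0_eq0 p : qnorm p = 0 -> p = 0.
Proof.
case: p => a b c d /eqP; rewrite sqrtr_eq0 /= => le0.
have [[[h1 h2] h3] h4] := (sqr_ge0 a, sqr_ge0 b, sqr_ge0 c, sqr_ge0 d).
by apply: quat_ext; apply/eqP; rewrite -sqrf_eq0 eq_le sqr_ge0 andbT /=; lra.
Qed.

HB.instance Definition _ := Lmodule_isNormed.Build R H
  qnormD qnormZ qnorm0_eq0.

(* The Borel sigma-algebra of R^4, transported along the coordinates. *)
Definition quat_measurable : set (set H) :=
  g_sigma_algebra_preimage quat_tuple.

Lemma quat_measurable0 : quat_measurable set0.
Proof. exact: (@measurable0 _ (g_sigma_algebra_preimageType quat_tuple)). Qed.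
Lemma quat_measurableC A : quat_measurable A -> quat_measurable (~` A).
Proof. exact: (@measurableC _ (g_sigma_algebra_preimageType quat_tuple)). Qed.
Lemma quat_measurable_bigcup (F : (set H)^nat) :
  (forall i, quat_measurable (F i)) -> quat_measurable (\bigcup_i (F i)).
Proof.
exact: (@bigcupT_measurable _ (g_sigma_algebra_preimageType quat_tuple)).
Qed.

HB.instance Definition _ := isMeasurable.Build default_measure_display H
  quat_measurable0 quat_measurableC quat_measurable_bigcup.

Lemma measurable_fun_quat d (T : measurableType d) (f : T -> H) :
  measurable_fun setT (q_re \o f) -> measurable_fun setT (q_i \o f) ->
  measurable_fun setT (q_j \o f) -> measurable_fun setT (q_k \o f) ->
  measurable_fun setT f.
Proof.
move=> m0 m1 m2 m3 _ _ [B mB <-].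
have mt : measurable_fun setT (quat_tuple \o f).
  by do 3 (apply: measurable_fun_pair => //).
by rewrite setTI; have := mt measurableT _ mB; rewrite !setTI.
Qed.

Lemma measurable_coords :
  [/\ measurable_fun setT (@q_re R), measurable_fun setT (@q_i R),
      measurable_fun setT (@q_j R) & measurable_fun setT (@q_k R)].
Proof.
have mt : measurable_fun setT quat_tuple.
  by move=> _ B mB; rewrite setTI; exists B; rewrite ?setTI.
have mt1 : measurable_fun setT (fst \o quat_tuple).
  exact: measurableT_comp measurable_fst mt.
have mt2 : measurable_fun setT (fst \o (fst \o quat_tuple)).
  exact: measurableT_comp measurable_fst mt1.
split.
- exact: measurableT_comp measurable_fst mt2.
- exact: measurableT_comp measurable_snd mt2.
- exact: measurableT_comp measurable_snd mt1.
- exact: measurableT_comp measurable_snd mt.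
Qed.

End Quaternions.

Section Slices.
Context {R : realType}.
Local Notation H := (quat R).
Local Notation mR := (measurableTypeR R).

Definition imag_unit : set H := [set I | I ^+ 2 = - 1].

Definition slice_pt (I : H) (p : R * R) : H := p.1%:A + p.2 *: I.

Definition slice (I : H) : set H := range (slice_pt I).

(* Coordinates of q = x + y I with I an imaginary unit and y >= 0.  On the
   real axis, which lies on every slice, the unit i is used. *)
Definition slice_unit (q : H) : H :=
  if qim q == 0 then Quat 0 1 0 0 else `|qim q|^-1 *: qim q.
Definition slice_coord (q : H) : R * R := (q_re q, `|qim q|).

(* Lebesgue measure on each slice, read on R^2 through [slice_pt I], which is
   an isometry for the Euclidean distances when I is an imaginary unit. *)
Definition leb2 : {measure set (mR * mR) -> \bar R} :=
  (@lebesgue_measure R \x @lebesgue_measure R)%E.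

(* Cylindrical coordinates on the unit sphere of imaginary quaternions: height
   t in [-1, 1] and longitude phi in [0, 2 pi].  The area element of this
   parametrization is exactly dt dphi, since its partial derivatives are
   orthogonal, of norms (1 - t^2)^(-1/2) and (1 - t^2)^(1/2). *)
Definition sphere_pt (u : mR * mR) : H :=
  Quat 0 (Num.sqrt (1 - u.1 ^+ 2) * cos u.2)
         (Num.sqrt (1 - u.1 ^+ 2) * sin u.2) u.1.

Lemma measurable_sphere_pt : measurable_fun setT sphere_pt.
Proof.
have m1 : measurable_fun setT (fst : mR * mR -> R) by exact: measurable_fst.
have m2 : measurable_fun setT (snd : mR * mR -> R) by exact: measurable_snd.
have ms : measurable_fun setT (fun u : mR * mR => Num.sqrt (1 - u.1 ^+ 2) : R).
  apply: (@measurableT_comp _ _ _ (mR * mR)%type R R (@Num.sqrt R) _ (fun u => 1 - u.1 ^+ 2)).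
    apply: continuous_measurable_fun; exact: sqrt_continuous.
  by apply: measurable_funB => //; exact: measurable_funX.
apply: measurable_fun_quat => /=.
- exact: measurable_cst.
- apply: measurable_funM => //.
  apply: (@measurableT_comp _ _ _ (mR * mR)%type R R (@cos R)) => //.
  by apply: continuous_measurable_fun; exact: continuous_cos.
- apply: measurable_funM => //.
  apply: (@measurableT_comp _ _ _ (mR * mR)%type R R (@sin R)) => //.
  by apply: continuous_measurable_fun; exact: continuous_sin.
- exact: m1.
Qed.

HB.instance Definition _ := isMeasurableFun.Build _ _ _ _ sphere_pt
  measurable_sphere_pt.

Lemma ltN11 : -1 < 1 :> R.
Proof. by lra. Qed.
Lemma lt0_2pi : 0 < 2 * pi :> R.
Proof. by rewrite mulr_gt0// pi_gt0. Qed.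

(* Normalized surface measure: the area 4 pi is divided out by the two uniform
   probability laws. *)
Definition sphere_measure : probability H R :=
  distribution (uniform_prob ltN11 \x uniform_prob lt0_2pi)%E sphere_pt.

Lemma measurable_upper : measurable [set p : mR * mR | 0 < p.2].
Proof.
rewrite (_ : [set _ | _] = setT `*` `]0, +oo[%classic); last first.
  by apply/seteqP; split => -[x y] /=; rewrite in_itv/= andbT => // -[].
exact: measurableX.
Qed.

Definition polar_pt (u : (mR * mR) * H) : H := slice_pt u.2 u.1.

Lemma measurable_polar_pt : measurable_fun setT polar_pt.
Proof.
have mx : measurable_fun setT (fun u : (mR * mR) * H => u.1.1 : R).
  exact: measurableT_comp measurable_fst measurable_fst.
have my : measurable_fun setT (fun u : (mR * mR) * H => u.1.2 : R).
  exact: measurableT_comp measurable_snd measurable_fst.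
have [m0 mi mj mk] := @measurable_coords R.
apply: measurable_fun_quat; rewrite /comp/=.
- apply: measurable_funD; apply: measurable_funM => //.
  by apply: (@measurableT_comp _ _ _ _ H R q_re _ snd).
- apply: measurable_funD; apply: measurable_funM => //.
  by apply: (@measurableT_comp _ _ _ _ H R q_i _ snd).
- apply: measurable_funD; apply: measurable_funM => //.
  by apply: (@measurableT_comp _ _ _ _ H R q_j _ snd).
- apply: measurable_funD; apply: measurable_funM => //.
  by apply: (@measurableT_comp _ _ _ _ H R q_k _ snd).
Qed.

(* The image under (x, y, I) |-> x + y I of the product of Lebesgue measure on
   the half plane y > 0 with the surface measure. *)
Definition dV : {measure set H -> \bar R} :=
  measure_function_pushforward__canonical__measure_function_Measure
    (mrestr leb2 measurable_upper \x sphere_measure)%E measurable_polar_pt.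

End Slices.

Section SliceFunctions.
Context {R : realType}.
Local Notation H := (quat R).
Local Notation mR := (measurableTypeR R).
Implicit Types f g : H -> H.

(* Here and below F is the pair (f_0, f_1). *)
Definition is_stem (F : (R * R -> H) * (R * R -> H)) : Prop :=
  forall x y : R, F.1 (x, - y) = F.1 (x, y) /\ F.2 (x, - y) = - F.2 (x, y).

Definition induced_by (F : (R * R -> H) * (R * R -> H)) f : Prop :=
  forall I, imag_unit I -> forall p, f (slice_pt I p) = F.1 p + I * F.2 p.

Definition slice_fun f : Prop := exists F, is_stem F /\ induced_by F f.

(* A slice function is induced by exactly one such pair. *)
Definition stem f : (R * R -> H) * (R * R -> H) :=
  xget (cst 0, cst 0) [set F | is_stem F /\ induced_by F f].

Definition slice_prod f g : H -> H := fun q =>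
  let p := slice_coord q in
  ((stem f).1 p * (stem g).1 p - (stem f).2 p * (stem g).2 p) +
  slice_unit q * ((stem f).1 p * (stem g).2 p + (stem f).2 p * (stem g).1 p).

Definition continuously_differentiable (h : R * R -> H) : Prop :=
  forall v, v = (1, 0) \/ v = (0, 1) ->
    (forall p, derivable h p v) /\ continuous ('D_v h).

Definition slice_regular f : Prop := exists F,
  [/\ is_stem F, induced_by F f,
      continuously_differentiable F.1, continuously_differentiable F.2 &
      forall p, 'D_(1, 0) F.1 p - 'D_(0, 1) F.2 p = 0 /\
                'D_(0, 1) F.1 p + 'D_(1, 0) F.2 p = 0].

Definition qintegral d (T : measurableType d) (mu : {measure set T -> \bar R})
    (D : set T) (h : T -> H) : H :=
  Quat (\int[mu]_(t in D) q_re (h t)) (\int[mu]_(t in D) q_i (h t))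
       (\int[mu]_(t in D) q_j (h t)) (\int[mu]_(t in D) q_k (h t)).

Definition Linfty_slice f : Prop :=
  [/\ measurable_fun setT f, slice_fun f &
      exists M : R, {ae dV, forall q, `|f q| <= M}].

(* The coordinates of the points of the disk B_I(z, r) of the slice of I. *)
Definition slice_disk (I z : H) (r : R) : set (R * R) :=
  [set p | `|slice_pt I p - z| < r].

Definition slice_avg (r : R) f (I z : H) : H :=
  (pi * r ^+ 2)^-1 *:
    qintegral leb2 (slice_disk I z r) (fun p => f (slice_pt I p)).

Definition slice_osc (r : R) f (I z : H) : \bar R :=
  (((pi * r ^+ 2)^-1)%:E *
    \int[leb2]_(p in slice_disk I z r)
      `|f (slice_pt I p) - slice_avg r f I z|%:E)%E.

Definition slice_locally_integrable f (I : H) : Prop :=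
  measurable_fun setT (fun p : mR * mR => f (slice_pt I p)) /\
  forall K : set (R * R), compact K ->
    (\int[leb2]_(p in K) `|f (slice_pt I p)|%:E < +oo)%E.

Definition BMO1 f : Prop :=
  (forall I, imag_unit I -> slice_locally_integrable f I) /\
  exists2 r : R, 0 < r &
    (ereal_sup [set slice_osc r f u.1 u.2 |
       u in [set u : H * H | imag_unit u.1 /\ slice u.1 u.2]] < +oo)%E.

Definition average (r : R) f : H -> H := fun z => slice_avg r f (slice_unit z) z.

Definition berezin (gamma : R) f : H -> H := fun z =>
  let I := slice_unit z in
  (gamma / pi) *: qintegral leb2 setT (fun p =>
    expR (- gamma * `|slice_pt I p - z| ^+ 2) *: f (slice_pt I p)).

(* The density of lambda_alpha with respect to dV. *)
Definition fock_weight (alpha : R) (z : H) : R :=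
  2 * alpha / pi * expR (- alpha * `|z| ^+ 2).

Definition fock_sqnorm (alpha : R) f : \bar R :=
  (\int[dV]_z (`|f z| ^+ 2 * fock_weight alpha z)%:E)%E.

Definition fock (alpha : R) f : Prop :=
  slice_regular f /\ (fock_sqnorm alpha f < +oo)%E.

Definition fock_norm (alpha : R) f : R := Num.sqrt (fine (fock_sqnorm alpha f)).

Definition fock_kernel (alpha : R) (z w : H) : H :=
  limn (series (fun n => (alpha ^+ n / n`!%:R) *: (z ^+ n * qconj w ^+ n))).

Definition fock_proj (alpha : R) f : H -> H := fun z =>
  qintegral dV setT (fun w =>
    fock_weight alpha w *: (fock_kernel alpha z w * f w)).

(* The dense subspace D. *)
Definition kernel_span (alpha : R) f : Prop :=
  exists (n : nat) (a c : 'I_n -> H),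
    f = fun z => \sum_(k < n) fock_kernel alpha z (a k) * c k.

Definition toeplitz (alpha : R) f g : H -> H :=
  fock_proj alpha (slice_prod f g).

Definition bounded_operator (alpha : R) (T : (H -> H) -> (H -> H)) : Prop :=
  [/\ forall g, fock alpha g -> fock alpha (T g),
      forall g h, fock alpha g -> fock alpha h -> T (g \+ h) = T g \+ T h,
      forall g c, fock alpha g -> T (fun z => g z * c) = (fun z => T g z * c) &
      exists C : R, forall g, fock alpha g ->
        fock_norm alpha (T g) <= C * fock_norm alpha g].

(* The operator initially defined on D extends to a bounded operator. *)
Definition toeplitz_bounded (alpha : R) f : Prop :=
  exists2 T, bounded_operator alpha T &
    forall g, kernel_span alpha g -> T g = toeplitz alpha f g.

End SliceFunctions.

(* Main.v *)
Require Import Defs.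
From HB Require Import structures.
From mathcomp Require Import all_boot all_order all_algebra.
From mathcomp Require Import all_classical all_reals all_analysis.
From mathcomp Require Import measurable_realfun ring lra.

Set Implicit Arguments.
Unset Strict Implicit.
Unset Printing Implicit Defensive.

Import Order.TTheory GRing.Theory Num.Theory.
Import numFieldNormedType.Exports.

Local Open Scope classical_set_scope.
Local Open Scope ring_scope.

(* Each of the six conditions is shown to be equivalent to the uniform local integrability of the
   stem functions f_0, f_1 of the symbol: sup_u of the integral of |f_j| over a box of fixed size
   centred at u is finite.

   Averages and Berezin transforms act on the stem functions by integration against a nonnegative
   planar kernel that is dominated by a Gaussian and has mass bounded below.  Since f is in BMO, its
   local means at u and z differ by O(1 + |u - z|), so such a transform at z is, up to O(1), the mass
   of the kernel times the local mean at z; boundedness of the transform, even only almost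
   everywhere, therefore amounts to boundedness of the local means, and, again by BMO, of the local
   means of |f_j|.

   In terms of stem functions P_alpha is a planar integral operator with kernel
   exp (alpha z w^bar).  Once the weight exp (- alpha |z|^2 / 2) is absorbed this kernel is dominated
   by a Gaussian, and the weighted stem G of an element of the Fock space satisfies
   G(z)^2 <= C * (integral of G^2 over the box around z), because a holomorphic function equals its
   mean against a radial bump.  If |f_0| + |f_1| is uniformly locally integrable, T_f is then bounded
   by the Cauchy-Schwarz inequality and Tonelli's theorem.

   Conversely, for A = x + y i, apply T_f to K(., A) c + K(., A^bar) c^bar with c = 1/2 and c = i/2,
   whose stem functions are real.  The stem functions at (x, y) of the two images recombine to
   exp (alpha |A|^2) B_alpha f, while the point evaluation bound and the norms of the two test
   functions bound them by C exp (alpha |A|^2).  Hence B_alpha f is bounded. *)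

(** * Gaussian kernels on the plane *)

(** A pair of stem functions is best read as one function f_0 + iota f_1 on the plane, where iota is
    a new imaginary unit commuting with the quaternions. The slice product is then pointwise, slice
    regularity is holomorphy, and P_alpha is the classical Bargmann projection on each real
    coordinate.

    What keeps the problem from being literally the planar one is parity: T_f accepts only functions
    whose stem has f_0 even and f_1 odd, and the classical test function exp (alpha p z^bar) has no
    such parity. It equals g - iota h for the two real stems g = (exp (alpha p z^bar) + exp (alpha p
    z)) / 2 and h = iota (exp (alpha p z^bar) - exp (alpha p z)) / 2. The planar integral is
    iota-linear, so the images of g and h, each estimated separately, can be recombined. This is the
    origin of the two constants 1/2 and i/2.

    The second obstacle is that an essential bound for dV controls no given point, only some point
    of every small box. The comparison of a transform with local means is therefore stated for a
    bound on a set that meets every box. *)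

Ltac mfun := lazymatch goal with
  | |- measurable_fun _ fst => exact: measurable_fst
  | |- measurable_fun _ snd => exact: measurable_snd
  | |- measurable_fun _ (fun x => x) => exact: measurable_id
  | |- measurable_fun _ (fun x => x.1) => exact: measurable_fst
  | |- measurable_fun _ (fun x => x.2) => exact: measurable_snd
  | |- measurable_fun _ (fun x => (_ - _)%R) => apply: measurable_funB; mfun
  | |- measurable_fun _ (fun x => (_ + _)%R) => apply: measurable_funD; mfun
  | |- measurable_fun _ (fun x => (_ * _)%R) => apply: measurable_funM; mfun
  | |- measurable_fun _ (fun x => (_ ^+ _)%R) => apply: measurable_funX; mfun
  | |- measurable_fun _ (fun x => (- _)%R) => apply: measurable_funN; mfun
  | |- measurable_fun _ (fun x => expR _) =>
      apply: (measurableT_comp (@measurable_expR _)); mfun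
  | |- measurable_fun _ (fun x => `|_|%R) =>
      apply: (measurableT_comp (@normr_measurable _ _)); mfun
  | |- measurable_fun _ (fun x => (_)%:E) =>
      apply/measurable_EFinP; mfun
  | |- measurable_fun _ (fun x => (_.1)) =>
      apply: (measurableT_comp (measurable_fst)); mfun
  | |- measurable_fun _ (fun x => (_.2)) =>
      apply: (measurableT_comp (measurable_snd)); mfun
  | |- measurable_fun _ (fun x => (_, _)) =>
      apply: measurable_fun_pair; mfun
  | _ => first [exact: measurable_cst | eassumption | idtac]
  end.

Section plane_measure.
Context {R : realType}.
Local Notation mR := (measurableTypeR R).
Local Notation P2 := (mR * mR)%type.
Implicit Types (u w z : P2) (phi : P2 -> R).

(** Squares stand in for the disks of BMO: as products of intervals they have an explicit measure,
    and [box_sub_disk] leads from disks to them. *)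
Definition box (s : R) u : set P2 :=
  `]u.1 - s, u.1 + s[%classic `*` `]u.2 - s, u.2 + s[%classic.

Lemma in_boxE s u w :
  box s u w <-> `|w.1 - u.1| < s /\ `|w.2 - u.2| < s.
Proof. by rewrite /box /= !in_itv/= -!ltr_distlC ![`|_.1 - w.1|]distrC ![`|_.2 - w.2|]distrC. Qed.

Lemma box_sym s u w : box s u w <-> box s w u.
Proof. by rewrite !in_boxE (distrC w.1) (distrC w.2). Qed.

Lemma measurable_box s u : measurable (box s u).
Proof. by apply: measurableX; exact: measurable_itv. Qed.

Lemma leb2_box s u : 0 <= s -> leb2 (box s u) = ((2 * s) ^+ 2)%:E.
Proof.
move=> s0.
pose I (x : R) : set mR := `]x - s, x + s[%classic.
have -> : leb2 (box s u) =
    (lebesgue_measure (I u.1) * lebesgue_measure (I u.2))%E.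
  by apply: product_measure1E; exact: measurable_itv.
rewrite /I !lebesgue_measure_itv/= !lte_fin.
have [->|sn0] := eqVneq s 0.
  by rewrite !subr0 !addr0 !ltxx mulr0 expr0n mule0.
have sp : 0 < s by rewrite lt_neqAle eq_sym sn0.
have lt (x : R) : x - s < x + s by lra.
by rewrite !lt -!EFinD -EFinM; congr EFin; ring.
Qed.

Lemma leb2_sigma_finite : sigma_finite setT (@leb2 R).
Proof.
exists (fun n => box n%:R (0, 0)).
  apply/esym/seteqP; split=> // -[x y] _.
  exists (Num.trunc (`|x| + `|y|)).+1 => //=.
  have [x0 y0] := (normr_ge0 x, normr_ge0 y).
  have := truncnS_gt (`|x| + `|y|).
  by rewrite in_boxE /= !subr0; split; lra.
by move=> n; rewrite leb2_box// ltry; split=> //; exact: measurable_box.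
Qed.

(** The same measure under a name that carries the sigma-finiteness instance required by Tonelli's
    theorem. *)
Definition plane_leb : set P2 -> \bar R := @leb2 R.
HB.instance Definition _ := Measure.copy plane_leb (@leb2 R).
HB.instance Definition _ :=
  Measure_isSigmaFinite.Build _ _ _ plane_leb leb2_sigma_finite.

Lemma leb2_tonelli (f : P2 * P2 -> \bar R) :
  measurable_fun setT f -> (forall x, 0 <= f x)%E ->
  (\int[leb2]_x \int[leb2]_y f (x, y) = \int[leb2]_y \int[leb2]_x f (x, y))%E.
Proof. exact: (@fubini_tonelli _ _ _ _ _ plane_leb plane_leb). Qed.

Lemma measurable_leb2_F (f : P2 * P2 -> \bar R) :
  measurable_fun setT f -> (forall x, 0 <= f x)%E ->
  measurable_fun setT (fun x => \int[leb2]_y f (x, y))%E.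
Proof. exact: (@measurable_fun_fubini_tonelli_F _ _ _ _ _ plane_leb). Qed.

Lemma leb2_iter (f : P2 -> \bar R) :
  measurable_fun setT f -> (forall x, 0 <= f x)%E ->
  (\int[leb2]_p f p =
   \int[@lebesgue_measure R]_x \int[@lebesgue_measure R]_y f (x, y))%E.
Proof. exact: fubini_tonelli1. Qed.

Definition bx s u w : R := \1_(box s u) w.

Lemma bx_sym s u w : bx s u w = bx s w u.
Proof.
rewrite /bx !indicE; congr (_%:R); congr nat_of_bool.
by apply/idP/idP; rewrite !inE => /box_sym.
Qed.

Lemma bx_ge0 s u w : 0 <= bx s u w. Proof. by rewrite /bx indicE. Qed.

Lemma measurable_bx2 s : measurable_fun setT (fun t : P2 * P2 => bx s t.1 t.2).
Proof.
pose D : set (P2 * P2) := [set t | `|t.2.1 - t.1.1| < s] `&`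
  [set t | `|t.2.2 - t.1.2| < s].
have -> : (fun t : P2 * P2 => bx s t.1 t.2) = \1_D.
  apply/funext => t; rewrite /bx !indicE; congr (_%:R); congr nat_of_bool.
  by apply/idP/idP; rewrite !inE => /in_boxE.
apply: measurable_indic; apply: measurableI.
  have -> : [set t : P2 * P2 | `|t.2.1 - t.1.1| < s] =
    (fun t : P2 * P2 => `|t.2.1 - t.1.1| < s) @^-1` [set true] by [].
  by rewrite -[X in measurable X]setTI; apply: measurable_fun_ltr => //; mfun.
have -> : [set t : P2 * P2 | `|t.2.2 - t.1.2| < s] =
  (fun t : P2 * P2 => `|t.2.2 - t.1.2| < s) @^-1` [set true] by [].
by rewrite -[X in measurable X]setTI; apply: measurable_fun_ltr => //; mfun.
Qed.

Lemma measurable_bx s u : measurable_fun setT (bx s u).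
Proof. exact: measurable_indic (measurable_box _ _). Qed.

Lemma measurable_bxl s u : measurable_fun setT (bx s ^~ u).
Proof.
by rewrite (_ : bx s ^~ u = bx s u) ?funeqE//; [exact: measurable_bx|move=> w; exact: bx_sym].
Qed.

Lemma integral_boxE s u phi :
  (\int[leb2]_(w in box s u) (phi w)%:E = \int[leb2]_w (phi w * bx s u w)%:E)%E.
Proof.
rewrite integral_mkcond; apply: eq_integral => w _.
by rewrite /bx restrict_EFin/= patchE indicE; case: ifPn; rewrite ?mulr1 ?mulr0.
Qed.

Definition gk (g : R) z w : R :=
  expR (- g * ((w.1 - z.1) ^+ 2 + (w.2 - z.2) ^+ 2)).

Lemma gkC g z w : gk g z w = gk g w z.
Proof. by rewrite /gk; congr expR; ring. Qed.

Lemma gk_ge0 g z w : 0 <= gk g z w. Proof. exact: expR_ge0. Qed.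

Lemma measurable_gk2 g : measurable_fun setT (fun t : P2 * P2 => gk g t.1 t.2).
Proof. by rewrite /gk; mfun. Qed.

Lemma measurable_gk g z : measurable_fun setT (gk g z).
Proof. by rewrite /gk; mfun. Qed.

(** Read off from the normal density of variance 1 / (2 g), whose exponent is exactly - g (x - m)^2
    and whose total mass is 1. *)
Lemma integral_gauss1 (g : R) : 0 < g -> exists2 C : R, 0 < C &
  forall m : R, (\int[@lebesgue_measure R]_x (expR (- g * (x - m) ^+ 2))%:E = C%:E)%E.
Proof.
move=> g0; pose s := Num.sqrt (g *+ 2)^-1.
have g2 : 0 < (g *+ 2)^-1 by rewrite invr_gt0 mulrn_wgt0.
have s0 : s != 0 by rewrite gt_eqF// sqrtr_gt0.
have p0 := normal_peak_gt0 s0.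
exists (normal_peak s)^-1 => [|m]; first by rewrite invr_gt0.
have := integral_normal_pdf m s.
rewrite normal_pdfE//.
under eq_integral do rewrite EFinM.
rewrite ge0_integralZl//; last 3 first.
- by apply/measurable_EFinP; exact: measurable_normal_fun.
- by move=> x _; rewrite lee_fin normal_fun_ge0.
- by rewrite lee_fin ltW.
have -> : (\int[lebesgue_measure]_x (normal_fun m s x)%:E =
    \int[lebesgue_measure]_x (expR (- g * (x - m) ^+ 2))%:E)%E.
  apply: eq_integral => x _; congr EFin; rewrite /normal_fun; congr expR.
  rewrite sqr_sqrtr; last exact: ltW.
  have -> : (g *+ 2)^-1 *+ 2 = g^-1.
    by rewrite -[LHS]mulr_natr -(mulr_natr g) invfM -mulrA mulVf ?mulr1// pnatr_eq0.
  by rewrite invrK mulNr mulNr mulrC.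
move=> /(congr1 (fun t => ((normal_peak s)^-1%:E * t)%E)).
by rewrite muleA -EFinM mulVf ?gt_eqF// mul1e mule1.
Qed.

Lemma integral_gk (g : R) : 0 < g -> exists2 C : R, 0 < C &
  forall z, (\int[leb2]_w (gk g z w)%:E = C%:E)%E.
Proof.
move=> /integral_gauss1[C C0 HC]; exists (C * C); first exact: mulr_gt0.
move=> z; rewrite leb2_iter; last 2 first.
- by apply/measurable_EFinP; exact: measurable_gk.
- by move=> x; rewrite lee_fin gk_ge0.
under eq_integral => x _.
  under eq_integral => y _ do rewrite /gk /= mulrDr expRD EFinM.
  rewrite ge0_integralZl//; last by mfun.
  by rewrite HC; over.
rewrite ge0_integralZr//; last 2 first.
- by mfun.
- by rewrite lee_fin ltW.
by rewrite HC EFinM.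
Qed.

End plane_measure.

(** * From integrals over boxes of fixed size to Gaussian integrals *)

Section averaging.
Context {R : realType}.
Local Notation mR := (measurableTypeR R).
Local Notation P2 := (mR * mR)%type.
Implicit Types (u w z : P2) (phi : P2 -> R).

(* Tonelli, applied to the function [k w * phi w] times the indicator of
   [w] and [u] being [s]-close. *)
Lemma box_average (s : R) (k phi k' N : P2 -> R) : 0 < s ->
  measurable_fun setT k -> measurable_fun setT phi ->
  measurable_fun setT k' -> measurable_fun setT N ->
  (forall w, 0 <= k w) -> (forall w, 0 <= phi w) -> (forall w, 0 <= k' w) ->
  (forall u w, box s u w -> k w <= k' u) ->
  (forall u, \int[leb2]_(w in box s u) (phi w)%:E <= (N u)%:E)%E ->
  (((2 * s) ^+ 2)%:E * \int[leb2]_w (k w * phi w)%:E <=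
    \int[leb2]_u (k' u * N u)%:E)%E.
Proof.
move=> s0 mk mp mk' mN k0 p0 k'0 kk' pN.
have mb2 := @measurable_bx2 R s.
have mF : measurable_fun setT (fun t : P2 * P2 => (k t.1 * phi t.1 * bx s t.1 t.2)%:E).
  apply/measurable_EFinP; apply: measurable_funM => //.
  by apply: measurable_funM; apply: (measurableT_comp _ measurable_fst).
have F0 (t : P2 * P2) : (0 <= (k t.1 * phi t.1 * bx s t.1 t.2)%:E)%E.
  by rewrite lee_fin !mulr_ge0// bx_ge0.
rewrite -ge0_integralZl//; last 3 first.
- by apply/measurable_EFinP; exact: measurable_funM.
- by move=> w _; rewrite lee_fin mulr_ge0.
- by rewrite lee_fin sqr_ge0.
have -> : (\int[leb2]_w (((2 * s) ^+ 2)%:E * (k w * phi w)%:E) =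
    \int[leb2]_w \int[leb2]_u (k w * phi w * bx s w u)%:E)%E.
  apply: eq_integral => w _; under [RHS]eq_integral do rewrite EFinM.
  rewrite ge0_integralZl//; last 3 first.
  - by apply/measurable_EFinP; exact: measurable_bx.
  - by move=> u _; rewrite lee_fin bx_ge0.
  - by rewrite lee_fin mulr_ge0.
  rewrite muleC; congr (_ * _)%E.
  by rewrite integral_indic ?setIT ?leb2_box// ?ltW//; exact: measurable_box.
rewrite (@leb2_tonelli _ (fun t => (k t.1 * phi t.1 * bx s t.1 t.2)%:E))//.
apply: ge0_le_integral => //.
- by move=> u _; apply: integral_ge0 => w _; exact: (F0 (w, u)).
- exact: (@measurable_fun_fubini_tonelli_G _ _ _ _ _ plane_leb _ mF F0).
- by apply/measurable_EFinP; exact: measurable_funM.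
move=> u _ /=; rewrite EFinM.
apply: (@le_trans _ _ ((k' u)%:E * \int[leb2]_(w in box s u) (phi w)%:E)%E); last first.
  by apply: lee_wpmul2l => //; rewrite lee_fin.
rewrite integral_boxE -ge0_integralZl//; last 3 first.
- by apply/measurable_EFinP; apply: measurable_funM => //; exact: measurable_bx.
- by move=> w _; rewrite lee_fin mulr_ge0// bx_ge0.
- by rewrite lee_fin.
apply: ge0_le_integral => //.
- by move=> w _; exact: (F0 (w, u)).
- apply/measurable_EFinP; apply: measurable_funM; last exact: measurable_bxl.
  exact: measurable_funM.
- by apply/measurable_EFinP; do 2 apply: measurable_funM => //; exact: measurable_bx.
move=> w _; rewrite -EFinM lee_fin (bx_sym s w u) mulrA.
rewrite /bx indicE; case: (boolP (w \in _)); rewrite ?mulr0// ?mulr1.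
by rewrite inE => /kk' h; apply: ler_wpM2r.
Qed.

(** In each coordinate (u - z)^2 <= 2 (w - z)^2 + 2 (w - u)^2. Halving the rate thus pays for moving
    the point by less than [s], at the cost of g s^2 in the exponent per coordinate. *)
Lemma gk_shift (g s : R) z u w : 0 < g -> box s u w ->
  gk g z w <= expR (2 * g * s ^+ 2) * gk (g / 2) z u.
Proof.
move=> g0 /in_boxE[h1 h2]; rewrite /gk -expRD ler_expR.
have {}h1 : (w.1 - u.1) ^+ 2 <= s ^+ 2.
  by rewrite -ler_sqrt ?sqr_ge0// !sqrtr_sqr (le_trans (ltW h1))// ler_norm.
have {}h2 : (w.2 - u.2) ^+ 2 <= s ^+ 2.
  by rewrite -ler_sqrt ?sqr_ge0// !sqrtr_sqr (le_trans (ltW h2))// ler_norm.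
have H (a b c : R) : (c - b) ^+ 2 <= s ^+ 2 ->
    g / 2 * (b - a) ^+ 2 <= g * (c - a) ^+ 2 + g * s ^+ 2.
  move=> h; rewrite -subr_ge0.
  have -> : g * (c - a) ^+ 2 + g * s ^+ 2 - g / 2 * (b - a) ^+ 2 =
    g / 2 * (2 * (c - a) - (b - a)) ^+ 2 + g * (s ^+ 2 - (c - b) ^+ 2) by field.
  by rewrite addr_ge0// mulr_ge0 ?sqr_ge0 ?divr_ge0 ?subr_ge0// ltW.
have := H _ _ _ h1 : g / 2 * (u.1 - z.1) ^+ 2 <= _.
have := H _ _ _ h2 : g / 2 * (u.2 - z.2) ^+ 2 <= _.
by lra.
Qed.

(** Lets a Gaussian swallow a factor exp |a|, with [e] a fraction of the Gaussian rate. *)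
Lemma linear_le_exp (e a : R) : 0 < e -> `|a| <= e * a ^+ 2 + e^-1.
Proof.
move=> e0; rewrite -(ler_pM2l e0).
have -> : e * (e * a ^+ 2 + e^-1) = (e * `|a|) ^+ 2 + 1.
  by rewrite exprMn real_normK ?num_real//; field; rewrite gt_eqF.
by have := sqr_ge0 (e * `|a| - 1); have := sqr_ge0 (e * `|a|); rewrite sqrrB; nra.
Qed.

(** By [box_average] the integral is controlled by the box integrals of [phi] against a Gaussian of
    half the rate, and these grow only linearly with the distance from [z]. The constant does not
    depend on [z] or [phi]. *)
Lemma gk_growth (g s K : R) : 0 < g -> 0 < s -> 0 <= K ->
  exists C : R, forall z phi, measurable_fun setT phi -> (forall w, 0 <= phi w) ->
    (forall u, \int[leb2]_(w in box s u) (phi w)%:E <=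
               (K * (1 + `|u.1 - z.1| + `|u.2 - z.2|))%:E)%E ->
    (\int[leb2]_w (gk g z w * phi w)%:E <= C%:E)%E.
Proof.
move=> g0 s0 K0.
have g4 : 0 < g / 4 by rewrite divr_gt0.
have [C C0 HC] := integral_gk g4.
(* [A] is the price of [gk_shift]. [B] comes from two uses of [linear_le_exp] at e = g / 4, each
   costing 4 / g. *)
pose A := expR (2 * g * s ^+ 2); pose B := expR (8 / g).
exists (((2 * s) ^+ 2)^-1 * (A * K * B * C)) => z phi mp p0 hphi.
have s2 : 0 < (2 * s) ^+ 2 by rewrite exprn_gt0// mulr_gt0.
have bnd : (((2 * s) ^+ 2)%:E * \int[leb2]_w (gk g z w * phi w)%:E <= (A * K * B * C)%:E)%E.
  apply: le_trans (box_average (k' := fun u => A * gk (g / 2) z u)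
    (N := fun u => K * (1 + `|u.1 - z.1| + `|u.2 - z.2|)) s0 _ _ _ _ _ _ _ _ _) _ => //.
  - exact: measurable_gk.
  - by apply: measurable_funM => //; exact: measurable_gk.
  - by mfun.
  - by move=> w; exact: gk_ge0.
  - by move=> w; rewrite mulr_ge0 ?expR_ge0.
  - by move=> u w; exact: gk_shift.
  have e : (\int[leb2]_u ((A * K * B)%:E * (gk (g / 4) z u)%:E) = (A * K * B * C)%:E)%E.
    rewrite ge0_integralZl//; last 3 first.
    - by apply/measurable_EFinP; exact: measurable_gk.
    - by move=> u _; rewrite lee_fin gk_ge0.
    - by rewrite lee_fin !mulr_ge0// expR_ge0.
    by rewrite HC EFinM.
  rewrite -e; apply: ge0_le_integral => //.
  - by move=> u _; rewrite lee_fin !mulr_ge0 ?expR_ge0// !addr_ge0.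
  - by mfun; exact: measurable_gk.
  - apply: emeasurable_funM => //; apply/measurable_EFinP; exact: measurable_gk.
  move=> u _; rewrite -EFinM lee_fin.
  (* One factor absorbs the linear growth, bounded by an exponential, and the other is
     integrated. *)
  have -> : gk (g / 2) z u = gk (g / 4) z u * gk (g / 4) z u.
    by rewrite /gk -expRD; congr expR; field.
  set X := 1 + _ + _; set G := gk _ _ _.
  have -> : A * (G * G) * (K * X) = A * K * G * (X * G) by ring.
  have -> : A * K * B * G = A * K * G * B by ring.
  rewrite ler_wpM2l ?mulr_ge0 ?expR_ge0//.
  have h : X <= expR (`|u.1 - z.1| + `|u.2 - z.2|).
    by rewrite /X -addrA; exact: expR_ge1Dx.
  apply: (le_trans (ler_wpM2r (gk_ge0 _ _ _) h)).
  rewrite /G /gk /B -expRD ler_expR.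
  have := linear_le_exp (u.1 - z.1) g4; have := linear_le_exp (u.2 - z.2) g4.
  have -> : (g / 4)^-1 = 4 / g by rewrite invf_div.
  have -> : 8 / g = 4 / g + 4 / g by rewrite -mulrDl; congr (_ / _); ring.
  by lra.
by rewrite EFinM lee_pdivlMl.
Qed.



End averaging.

(** * Bounded mean oscillation in the plane *)

Section real_integrands.
Context {R : realType} d (T : measurableType d) (mu : {measure set T -> \bar R}).
Implicit Types (D : set T) (f g : T -> R).

Lemma ge0_le_integralR D f g : measurable D ->
  measurable_fun setT f -> measurable_fun setT g -> (forall w, 0 <= f w) ->
  (forall w, D w -> f w <= g w) ->
  (\int[mu]_(w in D) (f w)%:E <= \int[mu]_(w in D) (g w)%:E)%E.
Proof.
move=> mD mf mg f0 fg; apply: ge0_le_integral => //.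
- by move=> w _; rewrite lee_fin; exact: f0.
- by apply/measurable_EFinP; exact: measurable_funS mf.
- by apply/measurable_EFinP; exact: measurable_funS mg.
Qed.

Lemma ge0_integralDR D f g : measurable D ->
  measurable_fun setT f -> measurable_fun setT g ->
  (forall w, 0 <= f w) -> (forall w, 0 <= g w) ->
  (\int[mu]_(w in D) (f w + g w)%:E =
   \int[mu]_(w in D) (f w)%:E + \int[mu]_(w in D) (g w)%:E)%E.
Proof.
move=> mD mf mg f0 g0; under eq_integral do rewrite EFinD.
rewrite ge0_integralD//.
- by move=> w _; rewrite lee_fin; exact: f0.
- by apply/measurable_EFinP; exact: measurable_funS mf.
- by move=> w _; rewrite lee_fin; exact: g0.
- by apply/measurable_EFinP; exact: measurable_funS mg.
Qed.

Lemma ge0_integralZR D (a : R) f : measurable D ->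
  measurable_fun setT f -> 0 <= a -> (forall w, 0 <= f w) ->
  (\int[mu]_(w in D) (a * f w)%:E = a%:E * \int[mu]_(w in D) (f w)%:E)%E.
Proof.
move=> mD mf a0 f0; under eq_integral do rewrite EFinM.
rewrite ge0_integralZl//; last by move=> w _; rewrite lee_fin.
by apply/measurable_EFinP; exact: measurable_funS mf.
Qed.

Lemma integrableR D f : measurable D -> measurable_fun setT f ->
  (\int[mu]_(w in D) `|f w|%:E < +oo)%E -> mu.-integrable D (EFin \o f).
Proof.
move=> mD mf fy; apply/integrableP; split => //.
by apply/measurable_EFinP; exact: measurable_funS mf.
Qed.

(** If the right side is infinite the bound is trivial; otherwise [f] is integrable and the usual
    inequality applies. *)
Lemma le_normr_RintegralE D f : measurable D -> measurable_fun setT f ->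
  (`|\int[mu]_(w in D) f w|%:E <= \int[mu]_(w in D) `|f w|%:E)%E.
Proof.
move=> mD mf.
have [fy|] := ltP (\int[mu]_(w in D) `|f w|%:E)%E +oo%E; last first.
  by rewrite leye_eq => /eqP->; rewrite leey.
rewrite EFin_normr_Rintegral//; last exact: integrableR.
apply: le_abse_integral => //.
by apply/measurable_EFinP; exact: measurable_funS mf.
Qed.

End real_integrands.

Section bmo.
Context {R : realType}.
Local Notation mR := (measurableTypeR R).
Local Notation P2 := (mR * mR)%type.
Implicit Types (u w z : P2) (phi : P2 -> R).

(** The usual equivalent form of bounded mean oscillation with arbitrary constants [c u] in place of
    the averages. It passes from [f] to the coordinates of its stem without computing any mean. *)
Definition bmo phi := exists (s M : R) (c : P2 -> R), 0 < s /\
  forall u, (\int[leb2]_(w in box s u) `|phi w - c u|%:E <= M%:E)%E.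

Definition uloc phi := exists s N : R, 0 < s /\
  forall u, (\int[leb2]_(w in box s u) `|phi w|%:E <= N%:E)%E.

Let mb := @measurable_box R.
Hint Resolve mb : core.

Lemma integral_box_cst s u (a : R) : 0 <= s ->
  (\int[leb2]_(w in box s u) a%:E = (a * (2 * s) ^+ 2)%:E)%E.
Proof. by move=> s0; rewrite integral_cst//; rewrite -[LHS]/(_ * leb2 _)%E leb2_box. Qed.

Section chain.
Variables (phi : P2 -> R) (s M : R) (c : P2 -> R).
Hypotheses (mphi : measurable_fun setT phi) (s0 : 0 < s).
Hypothesis phiM : forall u,
  (\int[leb2]_(w in box s u) `|phi w - c u|%:E <= M%:E)%E.

(** The boxes around [u] and [z] share the box of radius s / 2 around the midpoint, of area s^2.
    Integrating |c u - c z| <= |phi - c u| + |phi - c z| over it gives the constant. *)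
Lemma bmo_chain1 u z : `|u.1 - z.1| <= s -> `|u.2 - z.2| <= s ->
  `|c u - c z| <= 2 * M / s ^+ 2.
Proof.
move=> h1 h2; pose m : P2 := ((u.1 + z.1) / 2, (u.2 + z.2) / 2).
have s20 : 0 <= s / 2 by rewrite divr_ge0// ltW.
have sub v : `|v.1 - m.1| <= s / 2 -> `|v.2 - m.2| <= s / 2 ->
    box (s / 2) m `<=` box s v.
  move=> k1 k2 w /in_boxE[l1 l2]; apply/in_boxE; split.
    have := ler_normD (w.1 - m.1) (m.1 - v.1).
    by rewrite (distrC m.1) addrA subrK; lra.
  have := ler_normD (w.2 - m.2) (m.2 - v.2).
  by rewrite (distrC m.2) addrA subrK; lra.
have mid1 (a b : R) : `|a - (a + b) / 2| = `|a - b| / 2.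
  have -> : a - (a + b) / 2 = (a - b) / 2 by field.
  by rewrite normrM [ `|2^-1| ]ger0_norm// invr_ge0.
have mid2 (a b : R) : `|b - (a + b) / 2| = `|a - b| / 2.
  by rewrite (addrC a) mid1 distrC.
have su : box (s / 2) m `<=` box s u.
  by apply: sub; rewrite /m /= mid1 ler_pM2r.
have sz : box (s / 2) m `<=` box s z.
  by apply: sub; rewrite /m /= mid2 ler_pM2r.
have mv v : measurable_fun setT (fun w => `|phi w - c v|) by mfun.
have sb v : box (s / 2) m `<=` box s v ->
    (\int[leb2]_(w in box (s / 2) m) `|phi w - c v|%:E <= M%:E)%E.
  move=> h; apply: le_trans (phiM v); apply: ge0_subset_integral => //.
  by apply/measurable_EFinP; exact: measurable_funS (mv v).
rewrite ler_pdivlMr ?exprn_gt0// -lee_fin.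
have -> : s ^+ 2 = (2 * (s / 2)) ^+ 2 by congr (_ ^+ 2); field.
rewrite -(integral_box_cst m)//.
apply: (@le_trans _ _ (\int[leb2]_(w in box (s / 2) m)
    (`|phi w - c u| + `|phi w - c z|)%:E)%E).
  apply: ge0_le_integralR => //; first by apply: measurable_funD.
  move=> w _; rewrite (_ : c u - c z = (phi w - c z) - (phi w - c u)); last by ring.
  by rewrite [leRHS]addrC; exact: ler_normB.
rewrite ge0_integralDR//.
by rewrite (_ : 2 * M = M + M) ?EFinD ?leeD ?sb//; ring.
Qed.

Lemma bmo_M_ge0 : 0 <= M.
Proof. by rewrite -lee_fin; apply: le_trans (phiM (0, 0)); apply: integral_ge0. Qed.

(** The segment from [z] to [u] is cut into steps of length at most [s] in each coordinate, and
    [bmo_chain1] is summed over them. *)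
Lemma bmo_chain : exists2 K : R, 0 <= K & forall u z,
  `|c u - c z| <= K * (1 + `|u.1 - z.1| + `|u.2 - z.2|).
Proof.
have M0 := bmo_M_ge0.
pose D := 2 * M / s ^+ 2.
have D0 : 0 <= D by rewrite divr_ge0 ?mulr_ge0 ?exprn_ge0// ltW.
have step n u z : `|u.1 - z.1| <= n%:R * s -> `|u.2 - z.2| <= n%:R * s ->
    `|c u - c z| <= n%:R * D.
  elim: n u => [|n IH] u.
    rewrite !mul0r !normr_le0 !subr_eq0 => /eqP h1 /eqP h2.
    by have -> : u = z by case: u z h1 h2 => [? ?] [? ?] /= -> ->.
  move=> h1 h2.
  (* The last step is one part in n + 1 of the segment: it is at most [s] long, and what remains is
     at most n s long. *)
  pose t : R := n%:R / n.+1%:R.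
  have n0 : 0 < n.+1%:R :> R by rewrite ltr0n.
  have t0 : 0 <= t by rewrite divr_ge0// ler0n.
  have t1 : 1 - t = n.+1%:R^-1.
    by rewrite /t -[n.+1%:R]natr1; field; rewrite natr1 gt_eqF.
  pose v : P2 := (z.1 + t * (u.1 - z.1), z.2 + t * (u.2 - z.2)).
  have e1 (a b : R) : `|a - b| <= n.+1%:R * s -> `|a - (b + t * (a - b))| <= s.
    move=> h; have -> : a - (b + t * (a - b)) = (1 - t) * (a - b) by ring.
    by rewrite t1 normrM ger0_norm ?invr_ge0 ?ler0n// ler_pdivrMl.
  have e2 (a b : R) : `|a - b| <= n.+1%:R * s -> `|(b + t * (a - b)) - b| <= n%:R * s.
    move=> h; have -> : b + t * (a - b) - b = t * (a - b) by ring.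
    rewrite normrM (ger0_norm t0) /t mulrAC ler_pdivrMr//.
    by rewrite -mulrA ler_wpM2l ?ler0n// mulrC.
  have := IH v (e2 _ _ h1) (e2 _ _ h2).
  have := bmo_chain1 (z := v) (e1 _ _ h1) (e1 _ _ h2).
  have := ler_normD (c u - c v) (c v - c z).
  by rewrite addrA subrK -/D -natr1 mulrDl mul1r; lra.
exists (D * (1 + s^-1)); first by rewrite mulr_ge0// addr_ge0// invr_ge0 ltW.
move=> u z; set a := `|u.1 - z.1|; set b := `|u.2 - z.2|.
have [a0 b0] : 0 <= a /\ 0 <= b by rewrite !normr_ge0.
(* Enough steps, yet at most (a + b) / s + 1 of them; this produces the factor 1 + 1 / s in the
   constant. *)
pose n := (Num.trunc ((a + b) / s)).+1.
have ab0 : 0 <= (a + b) / s by rewrite divr_ge0 ?addr_ge0// ltW.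
have nl : (a + b) / s <= n%:R by exact: ltW (truncnS_gt _).
have nu : n%:R <= (a + b) / s + 1.
  by rewrite /n -natr1 lerD2r truncn_le.
have nl' : a + b <= n%:R * s by rewrite -ler_pdivrMr.
apply: (le_trans (@step n u z _ _)); rewrite -/a -/b; [lra|lra|].
rewrite mulrC -mulrA ler_wpM2l//; apply: (le_trans nu).
have s'0 : 0 <= s^-1 by rewrite invr_ge0 ltW.
by nra.
Qed.

(** On the box around [u] one has |phi - c z| <= |phi - c u| + |c u - c z|, so the box integrals
    grow at most linearly in the distance from [u] to [z] by [bmo_chain], as [gk_growth]
    requires. *)
Lemma bmo_gk (g : R) : 0 < g -> exists C : R, forall z,
  (\int[leb2]_w (gk g z w * `|phi w - c z|)%:E <= C%:E)%E.
Proof.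
move=> g0; have M0 := bmo_M_ge0; have [K K0 HK] := bmo_chain.
pose K' := M + K * (2 * s) ^+ 2.
have K'0 : 0 <= K' by rewrite /K' addr_ge0 ?(mulr_ge0 K0) ?sqr_ge0.
have [C HC] := gk_growth g0 s0 K'0.
exists C => z; apply: HC; [by mfun|by []|move=> u].
have mv v : measurable_fun setT (fun w => `|phi w - c v|) by mfun.
set X := 1 + _ + _; have X1 : 1 <= X by rewrite /X -addrA lerDl addr_ge0.
apply: (@le_trans _ _ (\int[leb2]_(w in box s u)
    (`|phi w - c u| + `|c u - c z|)%:E)%E).
  apply: ge0_le_integralR => //; first by mfun.
  move=> w _; rewrite (_ : phi w - c z = (phi w - c u) + (c u - c z)); last by ring.
  exact: ler_normD.
rewrite ge0_integralDR// integral_box_cst ?(ltW s0)//.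
apply: (le_trans (leeD2r _ (phiM u))); rewrite -EFinD lee_fin /K' (mulrDl M).
apply: lerD; first by rewrite ler_peMr.
by rewrite mulrAC ler_wpM2r ?sqr_ge0.
Qed.

End chain.

Lemma uloc_gk phi (g : R) : measurable_fun setT phi -> uloc phi -> 0 < g ->
  exists C : R, forall z, (\int[leb2]_w (gk g z w * `|phi w|)%:E <= C%:E)%E.
Proof.
move=> mp [s [N [s0 HN]]] g0.
have N0 : 0 <= N.
  by rewrite -lee_fin; apply: le_trans (HN (0, 0)); apply: integral_ge0.
have [C HC] := gk_growth g0 s0 N0.
exists C => z; apply: HC; [by mfun|by []|move=> u].
apply: (le_trans (HN u)); rewrite lee_fin ler_peMr//.
by rewrite -addrA lerDl addr_ge0.
Qed.

Lemma bmo_gk_lty phi (g : R) z : measurable_fun setT phi -> bmo phi -> 0 < g ->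
  (\int[leb2]_w (gk g z w * `|phi w|)%:E < +oo)%E.
Proof.
move=> mp [s [M [c [s0 HM]]]] g0.
have [C HC] := bmo_gk mp s0 HM g0.
have [G G0 HG] := integral_gk g0.
have mg := @measurable_gk R g z.
apply: (@le_lt_trans _ _ (\int[leb2]_w
    (gk g z w * `|phi w - c z| + `|c z| * gk g z w)%:E)%E).
  apply: ge0_le_integralR => //.
  - by mfun.
  - by apply: measurable_funD; apply: measurable_funM => //; mfun.
  - by move=> w; rewrite mulr_ge0 ?gk_ge0.
  - move=> w _; rewrite (mulrC `|c z|) -mulrDr ler_wpM2l ?gk_ge0//.
    by have := ler_normD (phi w - c z) (c z); rewrite subrK.
rewrite ge0_integralDR//; last 4 first.
- by mfun.
- by mfun.
- by move=> w; rewrite mulr_ge0 ?gk_ge0.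
- by move=> w; rewrite mulr_ge0 ?gk_ge0.
rewrite ge0_integralZR//; last by move=> w; exact: gk_ge0.
rewrite HG -EFinM lte_add_pinfty ?ltry//.
by apply: le_lt_trans (HC z) _; rewrite ltry.
Qed.

End bmo.

Section bmo_kernel.
Context {R : realType}.
Local Notation mR := (measurableTypeR R).
Local Notation P2 := (mR * mR)%type.
Implicit Types (u w z : P2) (phi : P2 -> R).

Lemma gk_integrable phi (k : P2 -> R) (g A : R) z : 0 <= A ->
  measurable_fun setT phi -> measurable_fun setT k ->
  (forall w, `|k w| <= A * gk g z w) ->
  (\int[leb2]_w (gk g z w * `|phi w|)%:E < +oo)%E ->
  leb2.-integrable setT (EFin \o (fun w => k w * phi w)).
Proof.
move=> A0 mp mk kA gy; have mg := @measurable_gk R g z.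
apply: integrableR => //; first exact: measurable_funM.
apply: (@le_lt_trans _ _ (\int[leb2]_w (A * (gk g z w * `|phi w|))%:E)%E).
  apply: ge0_le_integralR => //.
  - by mfun; exact: measurable_funM.
  - by mfun.
  - by move=> w _; rewrite normrM mulrA ler_wpM2r.
rewrite ge0_integralZR//; first by rewrite lte_mul_pinfty ?lee_fin.
- by mfun.
- by move=> w; rewrite mulr_ge0 ?gk_ge0.
Qed.

(** For [z] in [D], the constant [c z] times the mass of [k z] is the transform minus the integral
    of k z (phi - c z). The first term is at most [B], the second at most A C by [bmo_gk], so |c z|
    <= (B + A C) / m. Every box of radius s / 2 lies in a box of radius [s] centred in [D], so the
    bound at points of [D] reaches all boxes. *)
Lemma bmo_kernel_uloc phi (k : P2 -> P2 -> R) (g A m B : R) (D : set P2) :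
  measurable_fun setT phi -> bmo phi -> 0 < g -> 0 < m ->
  (forall z, measurable_fun setT (k z)) ->
  (forall z w, 0 <= k z w <= A * gk g z w) ->
  (forall z, m%:E <= \int[leb2]_w (k z w)%:E)%E ->
  (forall u (e : R), 0 < e -> exists2 z, D z & box e u z) ->
  (forall z, D z -> `|\int[leb2]_w (k z w * phi w)| <= B) -> uloc phi.
Proof.
move=> mp bp g0 m0 mk kA mK dD kB.
have A0 : 0 <= A.
  have /andP[h1 h2] := kA (0, 0) (0, 0).
  by have := le_trans h1 h2; rewrite pmulr_lge0// expR_gt0.
have [s [M [c [s0 HM]]]] := bp.
have [C HC] := bmo_gk mp s0 HM g0.
have [G G0 HG] := integral_gk g0.
have kA' z w : `|k z w| <= A * gk g z w.
  by have /andP[h1 h2] := kA z w; rewrite ger0_norm.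
have ikp z : leb2.-integrable setT (EFin \o (fun w => k z w * phi w)).
  by apply: (@gk_integrable _ _ g A z) => //; exact: bmo_gk_lty.
have ik z : leb2.-integrable setT (EFin \o k z).
  have : leb2.-integrable setT (EFin \o (fun w => k z w * cst 1 w)).
    apply: (@gk_integrable _ _ g A z) => //.
    under eq_integral do rewrite /= normr1 mulr1.
    by rewrite HG ltry.
  by apply: eq_integrable => // w _ /=; rewrite mulr1.
have cz z : D z -> `|c z| <= (B + A * C) / m.
  move=> Dz; rewrite ler_pdivlMr//.
  have mI : m <= \int[leb2]_w k z w.
    rewrite -lee_fin /Rintegral fineK; first exact: mK.
    exact: integrable_fin_num (ik z).
  have I0 : 0 <= \int[leb2]_w k z w by exact: le_trans (ltW m0) mI.
  apply: (@le_trans _ _ (`|c z| * \int[leb2]_w k z w)); first by rewrite ler_wpM2l.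
  rewrite -[X in _ * X]ger0_norm// -normrM -RintegralZl//.
  have ick : leb2.-integrable setT (EFin \o (fun w => c z * k z w)).
    by apply: eq_integrable (integrableZl measurableT (c z) (ik z)) => //.
  have -> : \int[leb2]_w (c z * k z w) = \int[leb2]_w (k z w * phi w) -
      \int[leb2]_w (k z w * phi w - c z * k z w).
    by rewrite RintegralB// opprB addrC subrK.
  apply: le_trans (ler_normB _ _) _; apply: lerD; first exact: kB.
  have -> : \int[leb2]_w (k z w * phi w - c z * k z w) =
      \int[leb2]_w (k z w * (phi w - c z)).
    by apply: eq_Rintegral => w _; ring.
  have mkp : measurable_fun setT (fun w => k z w * (phi w - c z)).
    by apply: measurable_funM => //; mfun.
  rewrite -lee_fin; apply: le_trans (le_normr_RintegralE _ _ _) _ => //.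
  apply: (@le_trans _ _ (\int[leb2]_w (A * (gk g z w * `|phi w - c z|))%:E)%E).
    apply: ge0_le_integralR => //.
    - by mfun.
    - by mfun; exact: measurable_gk.
    - by move=> w _; rewrite normrM mulrA ler_wpM2r.
  rewrite ge0_integralZR//; last 2 first.
  - by mfun; exact: measurable_gk.
  - by move=> w; rewrite mulr_ge0 ?gk_ge0.
  by rewrite EFinM lee_wpmul2l ?lee_fin.
pose N := M + (B + A * C) / m * (2 * s) ^+ 2.
exists (s / 2), N; split; first by rewrite divr_gt0.
move=> u; have s20 : 0 < s / 2 by rewrite divr_gt0.
have [z Dz /in_boxE[uz1 uz2]] := dD u _ s20.
have sub : box (s / 2) u `<=` box s z.
  move=> w /in_boxE[l1 l2]; apply/in_boxE; split.
    have := ler_normB (w.1 - u.1) (z.1 - u.1).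
    by rewrite opprB addrA subrK; lra.
  have := ler_normB (w.2 - u.2) (z.2 - u.2).
  by rewrite opprB addrA subrK; lra.
have mb := @measurable_box R.
apply: (@le_trans _ _ (\int[leb2]_(w in box s z) `|phi w|%:E)%E).
  apply: ge0_subset_integral => //.
  by apply/measurable_EFinP; apply: measurable_funTS; mfun.
apply: (@le_trans _ _ (\int[leb2]_(w in box s z) (`|phi w - c z| + `|c z|)%:E)%E).
  apply: ge0_le_integralR => //; [by mfun|by mfun|].
  by move=> w _; have := ler_normD (phi w - c z) (c z); rewrite subrK.
rewrite ge0_integralDR//; [|by mfun].
rewrite integral_box_cst ?(ltW s0)// /N EFinD leeD// lee_fin.
by rewrite ler_wpM2r ?sqr_ge0// cz.
Qed.

Lemma uloc_kernel phi (k : P2 -> P2 -> R) (g A : R) : 0 <= A ->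
  measurable_fun setT phi -> uloc phi -> 0 < g ->
  (forall z, measurable_fun setT (k z)) ->
  (forall z w, `|k z w| <= A * gk g z w) ->
  exists B : R, forall z, `|\int[leb2]_w (k z w * phi w)| <= B.
Proof.
move=> A0 mp up g0 mk kA; have [C HC] := uloc_gk mp up g0.
exists (A * C) => z; rewrite -lee_fin.
have mg := @measurable_gk R g z.
have mkp : measurable_fun setT (fun w => k z w * phi w) by exact: measurable_funM.
apply: le_trans (le_normr_RintegralE _ _ _) _ => //.
apply: (@le_trans _ _ (\int[leb2]_w (A * (gk g z w * `|phi w|))%:E)%E).
  apply: ge0_le_integralR => //.
  - by mfun.
  - by mfun.
  - by move=> w _; rewrite normrM mulrA ler_wpM2r.
rewrite ge0_integralZR//; last 2 first.
- by mfun.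
- by move=> w; rewrite mulr_ge0 ?gk_ge0.
by rewrite EFinM lee_wpmul2l ?lee_fin.
Qed.

(** Tonelli's theorem treats the positive and the negative part; [fine] then sends infinite values
    to 0 measurably. *)
Lemma measurable_Rintegral_leb2 (F : P2 * P2 -> R) : measurable_fun setT F ->
  measurable_fun setT (fun z => \int[leb2]_w F (z, w)).
Proof.
move=> mF; apply: (measurableT_comp (fine_measurable measurableT)).
have mE : measurable_fun setT (EFin \o F) by exact/measurable_EFinP.
have -> : (fun z => \int[leb2]_w (F (z, w))%:E)%E = (fun z =>
    \int[leb2]_w (EFin \o F)^\+ (z, w) - \int[leb2]_w (EFin \o F)^\- (z, w))%E.
  apply/funext => z; rewrite integralE; congr (_ - _)%E; apply: eq_integral => w _; by rewrite ?funeposE ?funenegE.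
apply: emeasurable_funB; apply: measurable_leb2_F => //.
- exact: measurable_funepos.
- exact: measurable_funeneg.
Qed.

End bmo_kernel.

(** * Reflection in the real axis, and integrals over the upper half plane *)

Section reflection.
Context {R : realType}.
Local Notation mR := (measurableTypeR R).
Local Notation P2 := (mR * mR)%type.
Implicit Types (u w z : P2).

Definition refl (p : P2) : P2 := (p.1, - p.2).

Lemma measurable_refl : measurable_fun setT refl.
Proof. by rewrite /refl; mfun. Qed.

(** Both measures agree on rectangles, by the symmetry of Lebesgue measure on the line, hence
    everywhere by uniqueness of the product measure. *)
Lemma leb2_reflE (A : set P2) : measurable A -> leb2 (refl @^-1` A) = leb2 A.
Proof.
move=> mA.
pose m' := measure_function_pushforward__canonical__measure_function_Measure
   (@leb2 R) measurable_refl.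
suff : (@leb2 R) A = m' A by move=> ->.
apply: (product_measure_unique (m1 := lebesgue_measure) (m2 := lebesgue_measure)) => //.
move=> X Y mX mY.
have -> : m' (X `*` Y) = leb2 (X `*` (-%R @^-1` Y)) by [].
transitivity (lebesgue_measure X * lebesgue_measure ((-%R : mR -> mR) @^-1` Y))%E.
  apply: product_measure1E => //.
  rewrite -[Z in measurable Z]setTI; exact: (@oppr_measurable R).
by congr (_ * _)%E; exact: lebesgue_measureN.
Qed.

Lemma ge0_leb2_refl (f : P2 -> \bar R) : measurable_fun setT f ->
  (forall p, 0 <= f p)%E -> (\int[leb2]_p f (refl p) = \int[leb2]_p f p)%E.
Proof.
move=> mf f0.
have := ge0_integral_pushforward measurable_refl (@leb2 R) measurableT mf (fun p _ => f0 p).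
rewrite preimage_setT => <-.
apply: eq_measure_integral; first exact: measurable_refl.
by move=> ? A mA _; exact: leb2_reflE.
Qed.

Lemma leb2_refl (f : P2 -> \bar R) : measurable_fun setT f ->
  (\int[leb2]_p f (refl p) = \int[leb2]_p f p)%E.
Proof.
move=> mf; rewrite integralE [RHS]integralE; congr (_ - _)%E.
- rewrite -(ge0_leb2_refl (f := f^\+)%E)//; last exact: measurable_funepos.
  by apply: eq_integral => p _; rewrite !funeposE.
- rewrite -(ge0_leb2_refl (f := f^\-)%E)//; last exact: measurable_funeneg.
  by apply: eq_integral => p _; rewrite !funenegE.
Qed.

Definition upper : set P2 := [set p | 0 < p.2].

Let mU : measurable upper := measurable_upper.

Lemma ge0_integral_mrestr_upper (f : P2 -> \bar R) : measurable_fun setT f ->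
  (forall p, 0 <= f p)%E ->
  (\int[mrestr leb2 measurable_upper]_p f p = \int[leb2]_(p in upper) f p)%E.
Proof.
move=> mf f0.
transitivity (\int[mrestr leb2 measurable_upper]_(p in setT `\` ~` upper) f p)%E.
  apply: ge0_negligible_integral => //; first exact: measurableC.
  by rewrite -[LHS]/(leb2 _) setICl measure0.
rewrite setTD setCK; apply: eq_measure_integral => A mA AU.
by rewrite -[LHS]/(leb2 _); congr (leb2 _); apply/setIidl.
Qed.

Lemma integral_mrestr_upper (f : P2 -> \bar R) : measurable_fun setT f ->
  (\int[mrestr leb2 measurable_upper]_p f p = \int[leb2]_(p in upper) f p)%E.
Proof.
move=> mf; apply: etrans; first exact: integralE.
apply: etrans; last by symmetry; exact: integralE.
have hp := @ge0_integral_mrestr_upper _ (measurable_funepos mf) (funepos_ge0 f).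
have hn := @ge0_integral_mrestr_upper _ (measurable_funeneg mf) (funeneg_ge0 f).
exact: (f_equal2 (fun a b : \bar R => (a - b)%E) hp hn).
Qed.

Definition lower : set P2 := [set p | p.2 < 0].
Definition axis : set P2 := setT `*` [set 0].

Lemma measurable_lower : measurable lower.
Proof.
have -> : lower = refl @^-1` upper.
  by apply/seteqP; split=> p; rewrite /lower /upper /refl /= oppr_gt0.
by rewrite -[X in measurable X]setTI; exact: measurable_refl.
Qed.

Let mL := measurable_lower.

Let mZ : measurable axis.
Proof. by apply: measurableX => //; exact: measurable_set1. Qed.

Let leb2_axis : leb2 axis = 0%E.
Proof.
have -> : leb2 axis = (lebesgue_measure ([set: mR]) * lebesgue_measure [set 0%R])%E.
  by apply: product_measure1E => //; exact: measurable_set1.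
by rewrite lebesgue_measure_set1 mule0.
Qed.

Let UCD : ~` upper `\` axis = lower.
Proof.
apply/seteqP; split=> p; rewrite /upper /lower /axis /=.
  move=> [/negP]; rewrite -leNgt le_eqVlt => /orP[/eqP h|//] [].
  by split.
by move=> h; split; [apply/negP; rewrite -leNgt ltW|move=> [_ e]; move: h; rewrite e ltxx].
Qed.

Let disjU : [disjoint upper & ~` upper].
Proof. by apply/disj_setPS => p []. Qed.

Lemma integral_lower (f : P2 -> \bar R) : measurable_fun setT f ->
  (\int[leb2]_(p in lower) f p = \int[leb2]_(p in upper) f (refl p))%E.
Proof.
move=> mf; rewrite integral_mkcond [RHS]integral_mkcond -leb2_refl; last first.
  by apply/measurable_restrict => //; rewrite setTI; exact: measurable_funS mf.
apply: eq_integral => p _; rewrite !patchE.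
have -> // : (refl p \in lower) = (p \in upper).
by apply/idP/idP; rewrite !inE /lower /upper /= oppr_lt0.
Qed.

Lemma ge0_integral_upper (f : P2 -> \bar R) : measurable_fun setT f ->
  (forall p, 0 <= f p)%E ->
  (\int[leb2]_p f p = \int[leb2]_(p in upper) f p + \int[leb2]_(p in upper) f (refl p))%E.
Proof.
move=> mf f0; rewrite -[X in integral _ X](setUv upper) ge0_integral_setU//; last 2 first.
- exact: measurableC.
- by rewrite setUv.
congr (_ + _)%E; rewrite -integral_lower// -UCD.
apply: ge0_negligible_integral => //; first exact: measurableC.
exact: measurable_funTS.
Qed.

Lemma Rintegral_upper (f : P2 -> R) : leb2.-integrable setT (EFin \o f) ->
  \int[leb2]_p f p = \int[leb2]_(p in upper) f p + \int[leb2]_(p in upper) f (refl p).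
Proof.
move=> intf; have mf : measurable_fun setT (EFin \o f) by case/integrableP: intf.
rewrite -[X in Rintegral _ X](setUv upper) Rintegral_setU//; last 2 first.
- exact: measurableC.
- by rewrite setUv.
congr (_ + _); rewrite /Rintegral -(integral_lower mf) -UCD; congr fine.
apply: negligible_integral => //; first exact: measurableC.
by apply: integrableS intf => //; exact: measurableC.
Qed.

End reflection.

(** * Continuously differentiable functions and the mean value property *)

Section derivative_estimates.
Context {R : realType}.

(** A criterion by increments, without quotients or filters: the form in which the mean value
    estimates below arrive. *)
Lemma is_derive_eps (V W : normedModType R) (f : V -> W) (x v : V) (d : W) :
  (forall e : R, 0 < e -> exists2 dl : R, 0 < dl & forall h : R, `|h| < dl ->
    `|f (x + h *: v) - f x - h *: d| <= e * `|h|) ->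
  is_derive x v f d.
Proof.
move=> H.
suff cv : h^-1 *: (f (h *: v + x) - f x) @[h --> 0^'] --> d.
  by apply: DeriveDef; [apply/cvg_ex; exists d|apply: cvg_lim].
apply/cvgrPdist_le => e e0; have [dl dl0 Hd] := H _ e0.
near=> h.
have h0 : h != 0 by near: h; exact: nbhs_dnbhs_neq.
have hd : `|h| < dl by near: h; exact: dnbhs0_lt.
rewrite distrC.
have -> : h^-1 *: (f (h *: v + x) - f x) - d =
    h^-1 *: (f (x + h *: v) - f x - h *: d).
  by rewrite [RHS]scalerBr scalerA mulVf// scale1r (addrC x).
rewrite normrZ normfV mulrC ler_pdivrMr ?normr_gt0//.
exact: Hd.
Unshelve. all: by end_near. Qed.

Lemma MVT_abs (f df : R -> R) (x y : R) :
  (forall x : R, is_derive x 1 f (df x)) ->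
  exists2 c, `|c - x| <= `|y - x| & f y - f x = df c * (y - x).
Proof.
move=> hf.
have cf a b : {within `[a, b], continuous f}.
  apply: derivable_within_continuous => z _; exact: (@ex_derive _ _ _ _ _ _ _ (hf z)).
have [xy|yx] := leP x y.
  have [c] := MVT_segment xy (fun x _ => hf x) (cf x y).
  rewrite in_itv /= => /andP[xc cy] e; exists c => //.
  by rewrite !ger0_norm ?subr_ge0// lerD2r.
have [c] := MVT_segment (ltW yx) (fun x _ => hf x) (cf y x).
rewrite in_itv /= => /andP[yc cx] e; exists c.
  by rewrite distrC (distrC y) !ger0_norm ?subr_ge0 ?(ltW yx)// lerB.
by rewrite -opprB e -mulrN opprB.
Qed.

Lemma continuous2P (u : R * R -> R) : continuous u <->
  forall p (e : R), 0 < e -> exists2 d : R, 0 < d & forall q : R * R,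
    `|q.1 - p.1| < d -> `|q.2 - p.2| < d -> `|u q - u p| < e.
Proof.
split=> [cu p e e0|H p].
  have /cvgrPdist_lt/(_ _ e0)/nbhs_ballP[d d0 Hd] := cu p.
  exists d => // q h1 h2; rewrite distrC; apply: Hd; split.
    by rewrite /ball /= distrC.
  by rewrite /ball /= distrC.
apply/cvgrPdist_lt => e e0; have [d d0 Hd] := H p e e0.
apply: filterS (nbhsx_ballx p d d0) => q [h1 h2]; rewrite /= distrC; apply: Hd.
  by rewrite distrC.
by rewrite distrC.
Qed.


(** The plane carries the product sigma-algebra, so an open preimage has to be written as a
    countable union of rectangles; boxes with rational centre and radius 1 / (n + 1) serve. *)
Lemma continuous2_measurable (u : R * R -> R) : continuous u ->
  measurable_fun setT (u : measurableTypeR R * measurableTypeR R -> R).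
Proof.
move=> /continuous2P cu.
apply: (measurability _ (RGenOInfty.measurableE R)) => _ [_ [a ->]] <-.
rewrite setTI; set A := _ @^-1` _.
pose B (q r : rat) (n : nat) : set (measurableTypeR R * measurableTypeR R) :=
  if `[< box n.+1%:R^-1 (ratr q, ratr r) `<=` A >] then
    box n.+1%:R^-1 (ratr q, ratr r) else set0.
have -> : A = \bigcup_q \bigcup_r \bigcup_n B q r n.
  apply/seteqP; split => [p Ap|p [q _ [r _ [n _]]]]; last first.
    by rewrite /B; case: ifPn => [/asboolP h /h|].
  have ea : 0 < u p - a by move: Ap; rewrite /A /= in_itv /= andbT subr_gt0.
  have [d d0 Hd] := cu p _ ea.
  (* With 1 / (n + 1) < d / 2, a box of this radius whose centre is this close to [p] contains [p]
     and stays within [d] of it. *)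
  pose n := Num.trunc (d / 2)^-1.
  have nd : n.+1%:R^-1 < d / 2.
    rewrite -[ltRHS]invrK ltf_pV2 ?posrE ?ltr0n ?invr_gt0 ?divr_gt0//.
    exact: truncnS_gt.
  have n0 : 0 < n.+1%:R^-1 :> R by rewrite invr_gt0 ltr0n.
  have rat_near (x : R) : exists q : rat, `|x - ratr q| < n.+1%:R^-1.
    have : x - n.+1%:R^-1 < x + n.+1%:R^-1 by move: n0; set y := n.+1%:R^-1; lra.
    by case/rat_in_itvoo => q; rewrite in_itv /= -ltr_distlC; exists q.
  have [q Hq] := rat_near p.1; have [r Hr] := rat_near p.2.
  exists q => //; exists r => //; exists n => //.
  rewrite /B; case: asboolP => [_|]; first by apply/in_boxE.
  case=> w /in_boxE[/= h1 h2].
  suff : `|u w - u p| < u p - a.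
    by rewrite /A /= in_itv /= andbT; have := ler_norm (u p - u w); rewrite distrC; lra.
  apply: Hd.
    have := ler_normB (w.1 - ratr q) (p.1 - ratr q); rewrite opprB addrA subrK.
    by move: h1 Hq nd; set y := n.+1%:R^-1; lra.
  have := ler_normB (w.2 - ratr r) (p.2 - ratr r); rewrite opprB addrA subrK.
  by move: h2 Hr nd; set y := n.+1%:R^-1; lra.
apply: bigcupT_measurable_rat => q; apply: bigcupT_measurable_rat => r.
apply: bigcupT_measurable => n; rewrite /B; case: ifP => _.
  exact: measurable_box.
exact: measurable0.
Qed.

Lemma continuous2_bounded (u : R * R -> R) (p : R * R) (r : R) : continuous u ->
  exists M : R, forall q : R * R,
    `|q.1 - p.1| <= r -> `|q.2 - p.2| <= r -> `|u q| <= M.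
Proof.
move=> cu; pose K := `[p.1 - r, p.1 + r]%classic `*` `[p.2 - r, p.2 + r]%classic.
have cK : compact K by apply: compact_setX; exact: segment_compact.
have : compact [set u x | x in K].
  by apply: continuous_compact cK; exact: continuous_subspaceT.
move=> /compact_bounded[M0 [_ /(_ (M0 + 1))]].
rewrite ltrDl ltr01 => /(_ isT) HM; exists (M0 + 1) => q h1 h2.
apply: HM; exists q => //; rewrite /K /= !in_itv /= -!ler_distlC.
by rewrite distrC (distrC p.2).
Qed.

(** The partial derivatives are those of one-variable functions and are named explicitly, so that
    one-variable calculus applies. [C1_coords] and [is_derive_coords] translate from and to
    directional derivatives. *)
Definition has_C1 (u ux uy : R * R -> R) : Prop :=
  [/\ forall x y : R, is_derive x 1 (fun t => u (t, y)) (ux (x, y)),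
      forall x y : R, is_derive y 1 (fun t => u (x, t)) (uy (x, y)),
      continuous ux & continuous uy].

(** The mean value theorem is applied along a horizontal and then a vertical segment, with
    continuity of [ux] and [uy] comparing their values with those at [p]. *)
Lemma C1_estimate u ux uy (p : R * R) (e : R) : has_C1 u ux uy -> 0 < e ->
  exists2 d : R, 0 < d & forall a b : R, `|a| < d -> `|b| < d ->
  `|u (p.1 + a, p.2 + b) - u p - (a * ux p + b * uy p)| <= e * (`|a| + `|b|).
Proof.
move=> [dx dy /continuous2P cx /continuous2P cy] e0.
have [d1 d10 H1] := cx p _ e0; have [d2 d20 H2] := cy p _ e0.
exists (Num.min d1 d2) => [|a b]; first by rewrite lt_min d10.
rewrite !lt_min => /andP[a1 a2] /andP[b1 b2].
have [c1] := MVT_abs p.1 (p.1 + a) (fun x => dx x (p.2 + b)).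
rewrite addrAC subrr add0r => hc1 e1.
have [c2] := MVT_abs p.2 (p.2 + b) (fun y => dy p.1 y).
rewrite addrAC subrr add0r => hc2 e2.
have -> : u (p.1 + a, p.2 + b) - u p - (a * ux p + b * uy p) =
  (ux (c1, p.2 + b) - ux p) * a + (uy (p.1, c2) - uy p) * b.
  by rewrite mulrBl -e1 mulrBl -e2 -surjective_pairing; ring.
apply: le_trans (ler_normD _ _) _; rewrite mulrDr !normrM; apply: lerD.
  rewrite ler_wpM2r// ltW// H1//=; first exact: le_lt_trans a1.
  by rewrite addrAC subrr add0r.
rewrite ler_wpM2r// ltW// H2//=; first by rewrite subrr normr0.
exact: le_lt_trans b2.
Qed.

Lemma C1_continuous u ux uy : has_C1 u ux uy -> continuous u.
Proof.
move=> hu; apply/continuous2P => p e e0.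
have [d d0 Hd] := C1_estimate p hu ltr01.
pose L := 1 + 1 + `|ux p| + `|uy p|.
have L0 : 0 < L by rewrite ltr_pwDl// !addr_ge0.
exists (Num.min d (e / L / 2)) => [|q]; first by rewrite lt_min d0 !divr_gt0.
rewrite !lt_min => /andP[q1 q1'] /andP[q2 q2'].
have := Hd _ _ q1 q2; rewrite ![_ + (_ - _)]addrC !subrK -surjective_pairing mul1r.
set a := q.1 - p.1; set b := q.2 - p.2 => h.
have h1 : `|u q - u p| <= (`|a| + `|b|) + (`|a| * `|ux p| + `|b| * `|uy p|).
  have := ler_normD (u q - u p - (a * ux p + b * uy p)) (a * ux p + b * uy p).
  have := ler_normD (a * ux p) (b * uy p).
  by rewrite subrK !normrM; lra.
apply: (le_lt_trans h1).
have ab : `|a| + `|b| < e / L by have := ltrD q1' q2'; rewrite -splitr.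
apply: (@le_lt_trans _ _ ((`|a| + `|b|) * L)); last by rewrite -ltr_pdivlMr.
rewrite /L; have [A0 B0] : 0 <= `|a| /\ 0 <= `|b| by [].
have [X0 Y0] : 0 <= `|ux p| /\ 0 <= `|uy p| by [].
by nra.
Qed.

Lemma C1_line u ux uy (p : R * R) (a b s : R) : has_C1 u ux uy ->
  is_derive s 1 (fun t => u (p.1 + t * a, p.2 + t * b))
    (a * ux (p.1 + s * a, p.2 + s * b) + b * uy (p.1 + s * a, p.2 + s * b)).
Proof.
move=> hu; apply: is_derive_eps => e e0.
set q := (p.1 + s * a, p.2 + s * b).
pose L := 1 + `|a| + `|b|; have L0 : 0 < L by rewrite /L -addrA ltr_pwDl// addr_ge0.
have eL : 0 < e / L by rewrite divr_gt0.
have [d d0 Hd] := C1_estimate q hu eL.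
exists (d / L) => [|h]; first by rewrite divr_gt0.
rewrite ltr_pdivlMr// => hd.
have small (c : R) : `|c| <= L -> `|h * c| < d.
  by move=> cL; rewrite normrM; apply: le_lt_trans hd; rewrite ler_wpM2l.
have aL : `|a| <= L by rewrite /L; have : 0 <= `|b| by []; lra.
have bL : `|b| <= L by rewrite /L; have : 0 <= `|a| by []; lra.
have := Hd _ _ (small _ aL) (small _ bL).
rewrite /q /= -!addrA -!mulrDl scaler1 /GRing.scale /=.
rewrite [h * (_ + _)]mulrDr !(mulrA h) => /le_trans; apply.
rewrite !normrM -mulrDr.
have -> : e / L * (`|h| * (`|a| + `|b|)) = e * `|h| * ((`|a| + `|b|) / L) by ring.
rewrite ler_piMr ?mulr_ge0 ?(ltW e0)// ler_pdivrMr// mul1r /L.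
by lra.
Qed.

End derivative_estimates.

Section continuity.
Context {R : realType} {T : topologicalType}.
Implicit Types f g : T -> R.

Lemma contD f g : continuous f -> continuous g -> continuous (fun x => f x + g x).
Proof. by move=> cf cg x; exact: cvgD (cf x) (cg x). Qed.

Lemma contB f g : continuous f -> continuous g -> continuous (fun x => f x - g x).
Proof. by move=> cf cg x; exact: cvgB (cf x) (cg x). Qed.

Lemma contN f : continuous f -> continuous (fun x => - f x).
Proof. by move=> cf x; exact: cvgN (cf x). Qed.

Lemma contM f g : continuous f -> continuous g -> continuous (fun x => f x * g x).
Proof. by move=> cf cg x; exact: cvgM (cf x) (cg x). Qed.

Lemma contX f n : continuous f -> continuous (fun x => f x ^+ n).
Proof.
move=> cf; elim: n => [|n IH].
  by under eq_fun do rewrite expr0; exact: cst_continuous.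
by under eq_fun do rewrite exprS; exact: contM.
Qed.

Lemma cont_comp (h : R -> R) f :
  continuous h -> continuous f -> continuous (fun x => h (f x)).
Proof. by move=> ch cf x; apply: continuous_comp; [exact: cf|exact: ch]. Qed.

Lemma cont_comp2 (h : R * R -> R) f g :
  continuous h -> continuous f -> continuous g -> continuous (fun x => h (f x, g x)).
Proof.
move=> ch cf cg x; apply: (continuous_comp (f := fun x => (f x, g x))).
  exact: cvg_pair (cf x) (cg x).
exact: ch.
Qed.

End continuity.

Lemma cont_fst {R : realType} : continuous (fun p : R * R => p.1).
Proof. by move=> p; exact: cvg_fst. Qed.

Lemma cont_snd {R : realType} : continuous (fun p : R * R => p.2).
Proof. by move=> p; exact: cvg_snd. Qed.

Ltac cont := lazymatch goal with
  | |- continuous (fun x => (_ - _)%R) => apply: contB; cont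
  | |- continuous (fun x => (_ + _)%R) => apply: contD; cont
  | |- continuous (fun x => (_ * _)%R) => apply: contM; cont
  | |- continuous (fun x => (_ ^+ _)%R) => apply: contX; cont
  | |- continuous (fun x => (- _)%R) => apply: contN; cont
  | |- continuous (fun x => expR _) => apply: cont_comp; [exact: continuous_expR|cont]
  | |- continuous (fun x => cos _) => apply: cont_comp; [exact: continuous_cos|cont]
  | |- continuous (fun x => sin _) => apply: cont_comp; [exact: continuous_sin|cont]
  | |- continuous (fun x => ?f (_, _)) => apply: (cont_comp2 (h := f)); cont
  | |- _ => first [exact: cst_continuous | exact: cont_fst | exact: cont_snd
      | assumption | move=> ?; exact: cvg_id | idtac]
  end.

(** * The mean value property against a radial bump *)

Section mean_value.
Context {R : realType}.
Local Notation mR := (measurableTypeR R).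

Lemma integral_derivative_0 (F f : R -> R) (c : R) :
  (forall t : R, is_derive t 1 F (f t)) -> continuous f ->
  (forall t, 1 <= `|t - c| -> f t = 0) -> F (c - 1) = 0 -> F (c + 1) = 0 ->
  (\int[@lebesgue_measure R]_t (f t)%:E = 0)%E.
Proof.
move=> dF cf f0 F1 F2.
have -> : (\int[@lebesgue_measure R]_t (f t)%:E =
    \int[@lebesgue_measure R]_(t in `[(c - 1)%R, (c + 1)%R]) (f t)%:E)%E.
  rewrite [RHS]integral_mkcond; apply: eq_integral => t _; rewrite patchE.
  case: ifPn => //; rewrite notin_setE /= in_itv /= -ler_distlC distrC.
  by move=> /negP; rewrite -ltNge => h; rewrite f0// ltW.
have cF x : {for x, continuous F}.
  by apply: differentiable_continuous; apply/derivable1_diffP; exact: (@ex_derive _ _ _ _ _ _ _ (dF x)).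
rewrite (@continuous_FTC2 _ f F).
- by rewrite F1 F2 subee.
- by rewrite ltrD2l; lra.
- exact: continuous_subspaceT.
- split.
  + by move=> x _; exact: (@ex_derive _ _ _ _ _ _ _ (dF x)).
  + exact: cvg_at_right_filter (cF _).
  + exact: cvg_at_left_filter (cF _).
- by move=> x _; rewrite derive1E; exact: (@derive_val _ _ _ _ _ _ _ (dF x)).
Qed.

Lemma continuous_box_integrable (u : R * R -> R) (z : R * R) : continuous u ->
  (forall p, ~ box 1 z p -> u p = 0) -> leb2.-integrable setT (EFin \o u).
Proof.
move=> cu u0; have mu := continuous2_measurable cu.
have [M HM] := continuous2_bounded z 1 cu.
have M0 : 0 <= M by apply: le_trans (HM z _ _) => //; rewrite subrr normr0.
apply: integrableR => //.
apply: (@le_lt_trans _ _ (\int[leb2]_p (M * bx 1 z p)%:E)%E).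
  apply: ge0_le_integralR => //.
  - by mfun.
  - by apply: measurable_funM => //; exact: measurable_bx.
  - move=> p _; rewrite /bx indicE; case: (boolP (p \in _)).
      by rewrite inE => /in_boxE[h1 h2]; rewrite mulr1 HM// ltW.
    by rewrite notin_setE => /u0 ->; rewrite normr0 mulr0.
rewrite -(integral_boxE 1 z (cst M)) integral_box_cst// ltry//.
Qed.

(** A cutoff of class [C^1]: composed with 1 - |p - z|^2 it gives a radial, compactly supported
    function that can be integrated by parts. *)
Definition pospart2 (t : R) : R := Num.max 0 t ^+ 2.

Lemma is_derive_pospart2 (t : R) : is_derive t 1 pospart2 (2 * Num.max 0 t).
Proof.
apply: is_derive_eps => e e0; exists e => // h he.
rewrite scaler1 /GRing.scale /= /pospart2.
apply: (@le_trans _ _ (`|h| * `|h|)); last by rewrite ler_wpM2r// ltW.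
rewrite -expr2 real_normK ?num_real// ler_norml.
by case: (leP 0 t) => t0; case: (leP 0 (t + h)) => th; apply/andP; split; nra.
Qed.

Lemma continuous_max0 : continuous (fun t : R => Num.max 0 t).
Proof.
move=> t; apply/cvgrPdist_lt => e e0; near=> h.
have : `|t - h| < e by near: h; exact: cvgr_dist_lt.
rewrite !ltr_norml => /andP[h1 h2].
by case: (leP 0 t) => t0; case: (leP 0 h) => th; apply/andP; split; lra.
Unshelve. all: by end_near. Qed.

Section cauchy_riemann.
Variables (z : R * R) (a ax ay b bx' by' : R * R -> R).
Hypotheses (ha : has_C1 a ax ay) (hb : has_C1 b bx' by').
Hypotheses (cr1 : forall p, ax p = by' p) (cr2 : forall p, ay p = - bx' p).

Let W (p : R * R) := 1 - (p.1 - z.1) ^+ 2 - (p.2 - z.2) ^+ 2.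
Definition bump (p : R * R) : R :=
  pospart2 (1 - (p.1 - z.1) ^+ 2 - (p.2 - z.2) ^+ 2).
Let scl (u : R * R -> R) (s : R) (p : R * R) :=
  u (z.1 + s * (p.1 - z.1), z.2 + s * (p.2 - z.2)).

Let cW : continuous W.
Proof. by rewrite /W; cont. Qed.

Lemma continuous_bump : continuous bump.
Proof. by rewrite /bump /pospart2; apply: contX; apply: cont_comp continuous_max0 cW. Qed.

Let W_le0 p : ~ box 1 z p -> W p <= 0.
Proof.
move=> nb; have [h|h] := ltP `|p.1 - z.1| 1; last first.
  have : 1 <= (p.1 - z.1) ^+ 2 by rewrite -[leRHS]real_normK ?num_real// exprn_ege1.
  by rewrite /W; have := sqr_ge0 (p.2 - z.2); lra.
have [h'|h'] := ltP `|p.2 - z.2| 1; first by case: nb; apply/in_boxE.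
have : 1 <= (p.2 - z.2) ^+ 2 by rewrite -[leRHS]real_normK ?num_real// exprn_ege1.
by rewrite /W; have := sqr_ge0 (p.1 - z.1); lra.
Qed.

Lemma bump_out p : ~ box 1 z p -> bump p = 0.
Proof. by move=> /W_le0 h; rewrite /bump /pospart2 -/(W p) max_l// expr0n. Qed.

Let cscl u s : continuous u -> continuous (scl u s).
Proof. by move=> cu; rewrite /scl; cont. Qed.

Let ca := C1_continuous ha.
Let cb := C1_continuous hb.
Let cax : continuous ax. Proof. by case: ha. Qed.
Let cay : continuous ay. Proof. by case: ha. Qed.
Let cbx : continuous bx'. Proof. by case: hb. Qed.
Let cby : continuous by'. Proof. by case: hb. Qed.

(** [D1] and [D2] are the partial derivatives of the product of [bump] with [b] dilated about [z] by
    the factor [s]. *)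
Let D1 s p := (2 * Num.max 0 (W p) * (- 2 * (p.1 - z.1))) * scl b s p +
  bump p * (s * scl bx' s p).
Let D2 s p := (2 * Num.max 0 (W p) * (- 2 * (p.2 - z.2))) * scl b s p +
  bump p * (s * scl by' s p).

Let dD1 s (x y : R) : is_derive x 1 (fun t => bump (t, y) * scl b s (t, y)) (D1 s (x, y)).
Proof.
have h1 : is_derive x 1 (fun t => bump (t, y)) (2 * Num.max 0 (W (x, y)) * (- 2 * (x - z.1))).
  apply: (is_derive1_comp (f := pospart2) (g := fun t => 1 - (t - z.1) ^+ 2 - (y - z.2) ^+ 2)).
    exact: is_derive_pospart2.
  by apply: is_derive_eq; rewrite /GRing.scale /=; ring.
have h2 : is_derive x 1 (fun t => scl b s (t, y)) (scl bx' s (x, y) * s).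
  apply: (is_derive1_comp (f := fun t => b (t, z.2 + s * (y - z.2))) (g := fun t => z.1 + s * (t - z.1))).
    by case: hb.
  by apply: is_derive_eq; rewrite /GRing.scale /=; ring.
by apply: is_derive_eq; rewrite /GRing.scale /D1 /=; ring.
Qed.

Let dD2 s (x y : R) : is_derive y 1 (fun t => bump (x, t) * scl b s (x, t)) (D2 s (x, y)).
Proof.
have h1 : is_derive y 1 (fun t => bump (x, t)) (2 * Num.max 0 (W (x, y)) * (- 2 * (y - z.2))).
  apply: (is_derive1_comp (f := pospart2) (g := fun t => 1 - (x - z.1) ^+ 2 - (t - z.2) ^+ 2)).
    exact: is_derive_pospart2.
  by apply: is_derive_eq; rewrite /GRing.scale /=; ring.
have h2 : is_derive y 1 (fun t => scl b s (x, t)) (scl by' s (x, y) * s).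
  apply: (is_derive1_comp (f := fun t => b (z.1 + s * (x - z.1), t)) (g := fun t => z.2 + s * (t - z.2))).
    by case: hb.
  by apply: is_derive_eq; rewrite /GRing.scale /=; ring.
by apply: is_derive_eq; rewrite /GRing.scale /D2 /=; ring.
Qed.

Let cmaxW : continuous (fun p => Num.max 0 (W p)).
Proof. exact: cont_comp continuous_max0 cW. Qed.

Let cD1 s : continuous (D1 s).
Proof.
rewrite /D1; apply: contD; apply: contM.
- by apply: contM; [apply: contM => //; cont|cont].
- exact: cscl.
- exact: continuous_bump.
- by apply: contM; [cont|exact: cscl].
Qed.

Let cD2 s : continuous (D2 s).
Proof.
rewrite /D2; apply: contD; apply: contM.
- by apply: contM; [apply: contM => //; cont|cont].
- exact: cscl.
- exact: continuous_bump.
- by apply: contM; [cont|exact: cscl].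
Qed.

Let D1_out s p : ~ box 1 z p -> D1 s p = 0.
Proof. by move=> h; rewrite /D1 bump_out// max_l ?W_le0// mulr0 !mul0r addr0. Qed.

Let D2_out s p : ~ box 1 z p -> D2 s p = 0.
Proof. by move=> h; rewrite /D2 bump_out// max_l ?W_le0// mulr0 !mul0r addr0. Qed.

Let iT1 s : leb2.-integrable setT (EFin \o (fun p => (p.2 - z.2) * D1 s p)).
Proof.
apply: (@continuous_box_integrable _ z); first by apply: contM; [cont|exact: cD1].
by move=> p /D1_out ->; rewrite mulr0.
Qed.

Let iT2 s : leb2.-integrable setT (EFin \o (fun p => (p.1 - z.1) * D2 s p)).
Proof.
apply: (@continuous_box_integrable _ z); first by apply: contM; [cont|exact: cD2].
by move=> p /D2_out ->; rewrite mulr0.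
Qed.

Let T1_0 s : \int[leb2]_p ((p.2 - z.2) * D1 s p) = 0.
Proof.
rewrite /Rintegral -(integral21_prod_meas1 (m1 := lebesgue_measure) (m2 := lebesgue_measure) (iT1 s)).
rewrite integral0_eq// => y _; rewrite /fubini_G /=.
apply: (@integral_derivative_0 (fun x => (y - z.2) * (bump (x, y) * scl b s (x, y)))
  (fun x => (y - z.2) * D1 s (x, y)) z.1).
- move=> t; have := dD1 s t y => h.
  by apply: is_derive_eq; rewrite /GRing.scale /=; ring.
- by apply: contM; [cont|apply: (cont_comp2 (h := D1 s)); [exact: cD1|cont|cont]].
- move=> t h; rewrite D1_out ?mulr0// => /in_boxE[/= h1 _].
  by move: h; rewrite leNgt h1.
- rewrite bump_out ?mul0r ?mulr0// => /in_boxE[/= h1 _].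
  by move: h1; rewrite addrAC subrr add0r normrN normr1 ltxx.
- rewrite bump_out ?mul0r ?mulr0// => /in_boxE[/= h1 _].
  by move: h1; rewrite addrAC subrr add0r normr1 ltxx.
Qed.

Let T2_0 s : \int[leb2]_p ((p.1 - z.1) * D2 s p) = 0.
Proof.
rewrite /Rintegral -(integral12_prod_meas1 (m1 := lebesgue_measure) (m2 := lebesgue_measure) (iT2 s)).
rewrite integral0_eq// => x _; rewrite /fubini_F /=.
apply: (@integral_derivative_0 (fun y => (x - z.1) * (bump (x, y) * scl b s (x, y)))
  (fun y => (x - z.1) * D2 s (x, y)) z.2).
- move=> t; have := dD2 s x t => h.
  by apply: is_derive_eq; rewrite /GRing.scale /=; ring.
- by apply: contM; [cont|apply: (cont_comp2 (h := D2 s)); [exact: cD2|cont|cont]].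
- move=> t h; rewrite D2_out ?mulr0// => /in_boxE[/= _ h1].
  by move: h; rewrite leNgt h1.
- rewrite bump_out ?mul0r ?mulr0// => /in_boxE[/= _ h1].
  by move: h1; rewrite addrAC subrr add0r normrN normr1 ltxx.
- rewrite bump_out ?mul0r ?mulr0// => /in_boxE[/= _ h1].
  by move: h1; rewrite addrAC subrr add0r normr1 ltxx.
Qed.

Let dN s p := bump p * ((p.1 - z.1) * scl ax s p + (p.2 - z.2) * scl ay s p).

Let cdN s : continuous (dN s).
Proof.
apply: contM; first exact: continuous_bump.
by apply: contD; apply: contM; [cont|exact: cscl|cont|exact: cscl].
Qed.

(** Let x, y be the coordinates relative to [z]. By the Cauchy-Riemann equations [s] times the
    integrand is the rotation field x d_y - y d_x applied to bump times the dilated [b], because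
    this field annihilates the radial bump. Both resulting terms are integrals of derivatives of
    compactly supported functions. The factor [s] comes from differentiating the dilation. *)
Let dN_0 s : s != 0 -> \int[leb2]_p dN s p = 0.
Proof.
move=> s0; apply: (mulfI s0); rewrite mulr0 -RintegralZl//; last first.
  apply: (@continuous_box_integrable _ z) => // p h.
  by rewrite /dN bump_out// mul0r.
transitivity (\int[leb2]_p ((p.1 - z.1) * D2 s p - (p.2 - z.2) * D1 s p)).
  apply: eq_Rintegral => p _.
  rewrite /dN /D1 /D2 /scl cr1 cr2; ring.
by rewrite RintegralB// T1_0 T2_0 subrr.
Qed.

Let N s := \int[leb2]_p (bump p * scl a s p).

Lemma bump_ge0 p : 0 <= bump p.
Proof. by rewrite /bump /pospart2 sqr_ge0. Qed.

Lemma bump_le1 p : bump p <= 1.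
Proof.
rewrite /bump /pospart2 expr_le1// ?le_max ?lexx//.
rewrite ge_max ler01 /=.
by have := sqr_ge0 (p.1 - z.1); have := sqr_ge0 (p.2 - z.2); lra.
Qed.

Let partial (s : R) p : is_derive s 1 (fun t => bump p * scl a t p) (dN s p).
Proof.
have h := @C1_line R a ax ay z (p.1 - z.1) (p.2 - z.2) s ha.
have h' : is_derive s 1 (fun t => scl a t p)
  ((p.1 - z.1) * scl ax s p + (p.2 - z.2) * scl ay s p) by exact: h.
by apply: is_derive_eq; rewrite /GRing.scale /= /dN; ring.
Qed.

Let iN s : leb2.-integrable setT (EFin \o (fun p => bump p * scl a s p)).
Proof.
apply: (@continuous_box_integrable _ z) => [|p h]; last by rewrite bump_out// mul0r.
by apply: contM; [exact: continuous_bump|exact: cscl].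
Qed.

Let derN (s : R) : -1 < s < 2 -> is_derive s 1 N (\int[leb2]_p dN s p).
Proof.
move=> s12.
(* For |s| <= 2 and [p] in the unit box, the dilated point differs from [z] by at most 2 in each
   coordinate, so one bound dominates the derivative for all such [s]. *)
have [M1 HM1] := continuous2_bounded z 2 cax.
have [M2 HM2] := continuous2_bounded z 2 cay.
have M10 : 0 <= M1 by apply: le_trans (HM1 z _ _) => //; rewrite subrr normr0.
have M20 : 0 <= M2 by apply: le_trans (HM2 z _ _) => //; rewrite subrr normr0.
pose f s p := bump p * scl a s p.
pose G p := (M1 + M2) * bx 1 z p.
have Is : `]-1, 2[%classic s by rewrite /= in_itv.
have der1 x y : `]-1, 2[%classic x -> setT y -> derivable (f ^~ y) x 1.
  by move=> _ _; exact: (@ex_derive _ _ _ _ _ _ _ (partial x y)).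
have pE x y : partial1of2 f x y = dN x y.
  by rewrite partial1of2E; exact: (@derive_val _ _ _ _ _ _ _ (partial x y)).
have G0 p : 0 <= G p by rewrite mulr_ge0 ?bx_ge0// addr_ge0.
have iG : leb2.-integrable setT (EFin \o G).
  apply: integrableR => //; first by apply: measurable_funM => //; exact: measurable_bx.
  under eq_integral do rewrite ger0_norm//.
  by rewrite -(integral_boxE 1 z (cst (M1 + M2))) integral_box_cst// ltry.
have Gub x y : `]-1, 2[%classic x -> setT y -> `|partial1of2 f x y| <= G y.
  rewrite /= in_itv /= => /andP[x1 x2] _; rewrite pE /G /bx indicE.
  have x2' : `|x| <= 2 by rewrite ler_norml; apply/andP; split; lra.
  case: (boolP (y \in _)); last first.
    by rewrite notin_setE => /bump_out h; rewrite /dN h mul0r normr0 mulr0.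
  rewrite inE => /in_boxE[y1 y2]; rewrite mulr1 /dN normrM ger0_norm ?bump_ge0//.
  rewrite -[leRHS]mul1r; apply: ler_pM; rewrite ?bump_ge0 ?bump_le1//.
  apply: le_trans (ler_normD _ _) _; rewrite !normrM.
  have e (u v : R) : `|u + x * v - u| = `|x| * `|v| by rewrite addrAC subrr add0r normrM.
  have le2 (u v : R) : `|v| < 1 -> `|u + x * v - u| <= 2.
    move=> v1; rewrite e -[2]mulr1; apply: ler_pM => //; exact: ltW.
  have B1 : `|scl ax x y| <= M1 by apply: HM1 => /=; exact: le2.
  have B2 : `|scl ay x y| <= M2 by apply: HM2 => /=; exact: le2.
  rewrite -[M1]mul1r -[M2]mul1r; apply: lerD; apply: ler_pM => //; exact: ltW.
have iF x : `]-1, 2[%classic x -> leb2.-integrable setT (EFin \o f x) by move=> _; exact: iN.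
apply: DeriveDef.
  exact: (derivable_under_integral measurableT Is iF der1 G0 iG Gub).
rewrite -derive1E.
rewrite [LHS](differentiation_under_integral measurableT Is iF der1 G0 iG Gub).
by apply: eq_Rintegral => p _; exact: pE.
Qed.

(** Dilate [a] about [z]: the integral [N s] is the left side at s = 1 and the right side at s = 0,
    and its derivative vanishes in between. *)
Lemma mean_value : \int[leb2]_p (bump p * a p) = a z * \int[leb2]_p bump p.
Proof.
have ib : leb2.-integrable setT (EFin \o bump).
  by apply: (@continuous_box_integrable _ z) => [|p]; [exact: continuous_bump|exact: bump_out].
have N1 : N 1 = \int[leb2]_p (bump p * a p).
  apply: eq_Rintegral => p _; rewrite /scl !mul1r !(addrC _ (_ - _)) !subrK.
  by rewrite -surjective_pairing.
have N0 : N 0 = a z * \int[leb2]_p bump p.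
  rewrite -RintegralZl//; apply: eq_Rintegral => p _.
  by rewrite /scl !mul0r !addr0 -surjective_pairing mulrC.
rewrite -N1 -N0; apply/eqP; rewrite -subr_eq0; apply/eqP.
(* The intermediate point is positive, as [dN_0] requires, while continuity at the endpoints comes
   from differentiability on ]-1, 2[. *)
have [||c] := @MVT _ N (fun s => \int[leb2]_p dN s p) 0 1 ltr01.
- move=> s; rewrite in_itv /= => /andP[s0 s1]; apply: derN; apply/andP; split; lra.
- apply: derivable_within_continuous => s; rewrite in_itv /= => /andP[s0 s1].
  have h : -1 < s < 2 by apply/andP; split; lra.
  exact: (@ex_derive _ _ _ _ _ _ _ (derN h)).
- by rewrite in_itv /= => /andP[c0 _] ->; rewrite dN_0 ?mul0r// gt_eqF.
Qed.

Lemma bump_le_bx p : bump p <= bx 1 z p.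
Proof.
rewrite /bx indicE; case: (boolP (p \in _)) => [_|]; first exact: bump_le1.
by rewrite notin_setE => h; rewrite bump_out.
Qed.

(** On the box of radius 1/2, which has area 1, the argument of the cutoff is at least 1/2 and its
    square at least 1/4. *)
Lemma bump_int_ge : 4^-1 <= \int[leb2]_p bump p.
Proof.
have ib : leb2.-integrable setT (EFin \o bump).
  by apply: (@continuous_box_integrable _ z) => [|p]; [exact: continuous_bump|exact: bump_out].
have mb := continuous2_measurable continuous_bump.
rewrite -lee_fin /Rintegral fineK; last exact: integrable_fin_num.
apply: (@le_trans _ _ (\int[leb2]_p (4^-1 * bx 2^-1 z p)%:E)%E).
  rewrite -(integral_boxE 2^-1 z (cst 4^-1)) integral_box_cst ?invr_ge0//.
  by rewrite divff// expr1n mulr1.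
apply: ge0_le_integralR => //.
- by apply: measurable_funM => //; exact: measurable_bx.
- by move=> p; rewrite mulr_ge0 ?bx_ge0// invr_ge0.
- move=> p _; rewrite /bx indicE; case: (boolP (p \in _)); last by rewrite mulr0 bump_ge0.
  rewrite inE mulr1 => /in_boxE[h1 h2].
  have s1 (t : R) : `|t| < 2^-1 -> t ^+ 2 <= 4^-1.
    move=> h; rewrite -real_normK ?num_real//.
    by have : 0 <= `|t| by []; nra.
  have W12 : 2^-1 <= W p by rewrite /W; have := s1 _ h1; have := s1 _ h2; lra.
  rewrite /bump /pospart2 -/(W p) max_r; last by lra.
  by nra.
Qed.

(** The mean value property with [bump] below the indicator of the box; 4 inverts the lower bound
    for the mass of [bump]. *)
Lemma CR_point_bound :
  (`|a z|%:E <= 4%:E * \int[leb2]_p (bx 1 z p * `|a p|)%:E)%E.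
Proof.
have ma := continuous2_measurable ca.
have mb := continuous2_measurable continuous_bump.
apply: (@le_trans _ _ (4%:E * `|\int[leb2]_p (bump p * a p)|%:E)%E).
  rewrite mean_value -EFinM lee_fin normrM mulrCA.
  rewrite ler_peMr// -ler_pdivrMl// mulr1.
  exact: le_trans bump_int_ge (ler_norm _).
apply: lee_wpmul2l; first by rewrite lee_fin.
apply: le_trans (le_normr_RintegralE _ _ _) _ => //; first exact: measurable_funM.
apply: ge0_le_integralR => //.
- by mfun.
- by apply: measurable_funM; [exact: measurable_bx|mfun].
- move=> p _; rewrite normrM ler_wpM2r// ger0_norm ?bump_ge0//.
  exact: bump_le_bx.
Qed.

End cauchy_riemann.
End mean_value.

(** * Quaternion-valued integrals and slices *)

Variant qcoord := Cre | Ci | Cj | Ck.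

Section quaternion_coordinates.
Context {R : realType}.
Local Notation H := (quat R).
Implicit Types (p q : H) (c : qcoord) (a : R).

Definition qc c q : R := match c with
  Cre => q_re q | Ci => q_i q | Cj => q_j q | Ck => q_k q end.

Definition qe c : H := match c with
  Cre => 1 | Ci => Quat 0 1 0 0 | Cj => Quat 0 0 1 0 | Ck => Quat 0 0 0 1 end.

Lemma qcP p q : (forall c, qc c p = qc c q) -> p = q.
Proof.
by move=> h; apply: quat_ext; [exact: (h Cre)|exact: (h Ci)|exact: (h Cj)|exact: (h Ck)].
Qed.

Lemma qcD c p q : qc c (p + q) = qc c p + qc c q. Proof. by case: c. Qed.
Lemma qcN c p : qc c (- p) = - qc c p. Proof. by case: c. Qed.
Lemma qcB c p q : qc c (p - q) = qc c p - qc c q. Proof. by case: c. Qed.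
Lemma qcZ c a p : qc c (a *: p) = a * qc c p. Proof. by case: c. Qed.
Lemma qc0 c : qc c (0 : H) = 0. Proof. by case: c. Qed.

Lemma qdecomp q : q = qc Cre q *: qe Cre + qc Ci q *: qe Ci +
  qc Cj q *: qe Cj + qc Ck q *: qe Ck.
Proof.
by apply: quat_ext; rewrite /= ?(mulr0, mulr1, addr0, add0r).
Qed.

Lemma sqr_qnorm q :
  `|q| ^+ 2 = q_re q ^+ 2 + q_i q ^+ 2 + q_j q ^+ 2 + q_k q ^+ 2.
Proof. by rewrite /Num.norm /= /qnorm sqr_sqrtr// !addr_ge0// sqr_ge0. Qed.

Lemma qc_le_norm c q : `|qc c q| <= `|q|.
Proof.
rewrite -(@ler_pXn2r _ 2)// ?nnegrE// real_normK ?num_real// sqr_qnorm.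
have [[h1 h2] [h3 h4]] := ((sqr_ge0 (q_re q), sqr_ge0 (q_i q)),
  (sqr_ge0 (q_j q), sqr_ge0 (q_k q))).
by case: c => /=; lra.
Qed.

Lemma qnorm_le_sum q : `|q| <= `|qc Cre q| + `|qc Ci q| + `|qc Cj q| + `|qc Ck q|.
Proof.
rewrite -(@ler_pXn2r _ 2)// ?nnegrE ?addr_ge0// sqr_qnorm.
rewrite -[q_re q ^+ 2]real_normK ?num_real// -[q_i q ^+ 2]real_normK ?num_real//.
rewrite -[q_j q ^+ 2]real_normK ?num_real// -[q_k q ^+ 2]real_normK ?num_real// /=.
have := normr_ge0 (q_re q); have := normr_ge0 (q_i q).
have := normr_ge0 (q_j q); have := normr_ge0 (q_k q).
set x := `|q_re q|; set y := `|q_i q|; set z := `|q_j q|; set t := `|q_k q|.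
by nra.
Qed.

Lemma qnormM p q : `|p * q| = `|p| * `|q|.
Proof.
apply/eqP; rewrite -(@eqrXn2 _ 2)// ?mulr_ge0// exprMn !sqr_qnorm /=.
by apply/eqP; ring.
Qed.

Lemma measurable_qc c : measurable_fun setT (@qc c).
Proof. by have [m0 mi mj mk] := @measurable_coords R; case: c. Qed.

Lemma measurable_qcP d (T : measurableType d) (f : T -> H) :
  measurable_fun setT f <-> forall c, measurable_fun setT (fun x => qc c (f x)).
Proof.
split=> [mf c|h]; first exact: measurableT_comp (@measurable_qc c) mf.
by apply: measurable_fun_quat; [exact: (h Cre)|exact: (h Ci)|exact: (h Cj)|exact: (h Ck)].
Qed.

Section closure.
Context d (T : measurableType d).
Implicit Types f g : T -> H.

Lemma measurable_qD f g : measurable_fun setT f -> measurable_fun setT g ->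
  measurable_fun setT (fun x => f x + g x).
Proof.
move=> /measurable_qcP mf /measurable_qcP mg; apply/measurable_qcP => c.
by under eq_fun do rewrite qcD; exact: measurable_funD.
Qed.

Lemma measurable_qB f g : measurable_fun setT f -> measurable_fun setT g ->
  measurable_fun setT (fun x => f x - g x).
Proof.
move=> /measurable_qcP mf /measurable_qcP mg; apply/measurable_qcP => c.
by under eq_fun do rewrite qcB; exact: measurable_funB.
Qed.

Lemma measurable_qM f g : measurable_fun setT f -> measurable_fun setT g ->
  measurable_fun setT (fun x => f x * g x).
Proof.
move=> /measurable_qcP mf /measurable_qcP mg; apply/measurable_qcP.
have [[[f0 f1] f2] f3] := (mf Cre, mf Ci, mf Cj, mf Ck).
have [[[g0 g1] g2] g3] := (mg Cre, mg Ci, mg Cj, mg Ck).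
by case=> /=; repeat first [apply: measurable_funB | apply: measurable_funD];
  apply: measurable_funM.
Qed.

Lemma measurable_qZ (a : T -> R) f : measurable_fun setT a -> measurable_fun setT f ->
  measurable_fun setT (fun x => a x *: f x).
Proof.
move=> ma /measurable_qcP mf; apply/measurable_qcP => c.
by under eq_fun do rewrite qcZ; exact: measurable_funM.
Qed.

Lemma measurable_qnorm f : measurable_fun setT f ->
  measurable_fun setT (fun x => `|f x|).
Proof.
move=> /measurable_qcP mf.
rewrite /Num.norm /= /qnorm; apply: (@measurableT_comp _ _ _ _ _ _ (@Num.sqrt R)).
  by apply: continuous_measurable_fun; exact: sqrt_continuous.
have [[[f0 f1] f2] f3] := (mf Cre, mf Ci, mf Cj, mf Ck).
by repeat apply: measurable_funD; apply: measurable_funX.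
Qed.

End closure.

Section qintegral.
Context d (T : measurableType d) (mu : {measure set T -> \bar R}) (D : set T).
Hypothesis mD : measurable D.
Implicit Types f g : T -> H.

Definition qintegrable f := forall c, mu.-integrable D (EFin \o (fun x => qc c (f x))).

Lemma qc_qintegral c f : qc c (qintegral mu D f) = \int[mu]_(x in D) qc c (f x).
Proof. by case: c. Qed.

Lemma qintegralD f g : qintegrable f -> qintegrable g ->
  qintegral mu D (fun x => f x + g x) = qintegral mu D f + qintegral mu D g.
Proof.
move=> fi gi; apply: qcP => c; rewrite qcD !qc_qintegral.
under eq_Rintegral do rewrite qcD.
exact: RintegralD.
Qed.

Lemma qintegrableD f g : qintegrable f -> qintegrable g ->
  qintegrable (fun x => f x + g x).
Proof.
move=> fi gi c; have := integrableD mD (fi c) (gi c).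
by apply: eq_integrable => // x _; rewrite /= qcD.
Qed.

Lemma RintegralD4 (f0 f1 f2 f3 : T -> R) :
  mu.-integrable D (EFin \o f0) -> mu.-integrable D (EFin \o f1) ->
  mu.-integrable D (EFin \o f2) -> mu.-integrable D (EFin \o f3) ->
  \int[mu]_(x in D) (f0 x + f1 x + f2 x + f3 x) =
  \int[mu]_(x in D) f0 x + \int[mu]_(x in D) f1 x +
  \int[mu]_(x in D) f2 x + \int[mu]_(x in D) f3 x.
Proof.
move=> i0 i1 i2 i3.
have i01 : mu.-integrable D (EFin \o (fun x => f0 x + f1 x)).
  by apply: eq_integrable (integrableD mD i0 i1).
have i012 : mu.-integrable D (EFin \o (fun x => f0 x + f1 x + f2 x)).
  by apply: eq_integrable (integrableD mD i01 i2).
by rewrite RintegralD// RintegralD// RintegralD.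
Qed.

Lemma integrableZR (a : R) (f : T -> R) : mu.-integrable D (EFin \o f) ->
  mu.-integrable D (EFin \o (fun x => f x * a)).
Proof.
move=> fi; have := integrableZl mD a fi.
by apply: eq_integrable => // x _; rewrite /= mulrC EFinM.
Qed.

Lemma qc_linear (L : H -> H) c q : (forall x y, L (x + y) = L x + L y) ->
  (forall a x, L (a *: x) = a *: L x) ->
  qc c (L q) = qc Cre q * qc c (L (qe Cre)) + qc Ci q * qc c (L (qe Ci)) +
    qc Cj q * qc c (L (qe Cj)) + qc Ck q * qc c (L (qe Ck)).
Proof.
by move=> LD LZ; rewrite {1}(qdecomp q) !LD !LZ !qcD !qcZ.
Qed.

(** Stated for real-linear maps so that left and right multiplication by a quaternion, which differ,
    are both instances. *)
Lemma qintegral_linear (L : H -> H) f : (forall x y, L (x + y) = L x + L y) ->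
  (forall a x, L (a *: x) = a *: L x) -> qintegrable f ->
  qintegral mu D (fun x => L (f x)) = L (qintegral mu D f).
Proof.
move=> LD LZ fi; apply: qcP => c; rewrite qc_qintegral qc_linear// !qc_qintegral.
under eq_Rintegral do rewrite qc_linear//.
rewrite RintegralD4; try exact: integrableZR.
by rewrite !RintegralZr.
Qed.

Lemma qintegrable_linear (L : H -> H) f : (forall x y, L (x + y) = L x + L y) ->
  (forall a x, L (a *: x) = a *: L x) -> qintegrable f ->
  qintegrable (fun x => L (f x)).
Proof.
move=> LD LZ fi c.
have i0 := integrableZR (qc c (L (qe Cre))) (fi Cre).
have i1 := integrableZR (qc c (L (qe Ci))) (fi Ci).
have i2 := integrableZR (qc c (L (qe Cj))) (fi Cj).
have i3 := integrableZR (qc c (L (qe Ck))) (fi Ck).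
have := integrableD mD (integrableD mD (integrableD mD i0 i1) i2) i3.
by apply: eq_integrable => // x _; rewrite /= (qc_linear c (f x) LD LZ) !EFinD.
Qed.

Lemma qintegralMl p f : qintegrable f ->
  qintegral mu D (fun x => p * f x) = p * qintegral mu D f.
Proof.
by apply: (@qintegral_linear (fun q => p * q)) => [x y|a x]; rewrite ?mulrDr ?scalerAr.
Qed.

Lemma qintegralMr p f : qintegrable f ->
  qintegral mu D (fun x => f x * p) = qintegral mu D f * p.
Proof.
by apply: (@qintegral_linear (fun q => q * p)) => [x y|a x]; rewrite ?mulrDl ?scalerAl.
Qed.

Lemma qintegrableMl p f : qintegrable f -> qintegrable (fun x => p * f x).
Proof.
by apply: (@qintegrable_linear (fun q => p * q)) => [x y|a x]; rewrite ?mulrDr ?scalerAr.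
Qed.

Lemma eq_qintegral f g : {in D, f =1 g} -> qintegral mu D f = qintegral mu D g.
Proof.
by move=> fg; apply: qcP => c; rewrite !qc_qintegral; apply: eq_Rintegral => x xD; rewrite fg.
Qed.

End qintegral.

End quaternion_coordinates.

Section slices.
Context {R : realType}.
Local Notation H := (quat R).
Local Notation mR := (measurableTypeR R).
Local Notation P2 := (mR * mR)%type.
Implicit Types (I J q : H) (p : R * R).

(** If the real part a were nonzero, the equations 2ab = 2ac = 2ad = 0 would leave a^2 = -1. *)
Lemma imag_unitP I : imag_unit I <-> q_re I = 0 /\ q_i I ^+ 2 + q_j I ^+ 2 + q_k I ^+ 2 = 1.
Proof.
case: I => a b c d; rewrite /imag_unit /= expr2; split.
  move=> [e0 e1 e2 e3].
  have a0 : a = 0.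
    have [//|a0] := eqVneq a 0; exfalso.
    have a2 : a * 2 != 0 by rewrite mulf_neq0// pnatr_eq0.
    have eb : b = 0 by apply: (mulfI a2); rewrite mulr0; lra.
    have ec : c = 0 by apply: (mulfI a2); rewrite mulr0; lra.
    have ed : d = 0 by apply: (mulfI a2); rewrite mulr0; lra.
    by move: e0; rewrite eb ec ed; have := sqr_ge0 a; nra.
  by split=> //; move: e0; rewrite a0; lra.
move=> [-> e]; apply: quat_ext => /=; rewrite ?oppr0; [|ring|ring|ring].
by rewrite -e; ring.
Qed.

Lemma imag_unit_norm I : imag_unit I -> `|I| = 1.
Proof.
move=> /imag_unitP[h0 h1]; apply/eqP; rewrite -(@eqrXn2 _ 2)// expr1n sqr_qnorm h0.
by rewrite expr0n add0r; apply/eqP.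
Qed.

Lemma imag_unitM I : imag_unit I -> I * I = -1.
Proof. by rewrite /imag_unit /= expr2. Qed.

Lemma imag_unitN I : imag_unit I -> imag_unit (- I).
Proof. by rewrite /imag_unit /= sqrrN. Qed.

Lemma imag_unit_qi : imag_unit (Quat 0 1 0 0 : H).
Proof. by apply/imag_unitP; split => //=; ring. Qed.

Lemma slice_ptE I p : imag_unit I ->
  slice_pt I p = Quat p.1 (p.2 * q_i I) (p.2 * q_j I) (p.2 * q_k I).
Proof.
move=> /imag_unitP[h0 _]; apply: quat_ext => /=; rewrite ?h0; ring.
Qed.

Lemma slice_ptN I p : slice_pt (- I) p = slice_pt I (p.1, - p.2).
Proof. by rewrite /slice_pt /= scalerN scaleNr. Qed.

Lemma sqr_norm_slice_pt I p : imag_unit I ->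
  `|slice_pt I p| ^+ 2 = p.1 ^+ 2 + p.2 ^+ 2.
Proof.
move=> hI; rewrite slice_ptE// sqr_qnorm /=; case/imag_unitP: hI => _ e.
have -> : p.2 ^+ 2 = p.2 ^+ 2 * (q_i I ^+ 2 + q_j I ^+ 2 + q_k I ^+ 2) by rewrite e mulr1.
ring.
Qed.

Lemma slice_ptB I p p' : slice_pt I p - slice_pt I p' = slice_pt I (p.1 - p'.1, p.2 - p'.2).
Proof. by rewrite /slice_pt /= !scalerBl opprD addrACA. Qed.

Lemma qim_norm_slice_pt I p : imag_unit I -> `|qim (slice_pt I p)| = `|p.2|.
Proof.
move=> hI; apply/eqP; rewrite -(@eqrXn2 _ 2)// sqr_qnorm /qim slice_ptE//=.
case/imag_unitP: hI => _ e; rewrite real_normK ?num_real//.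
have -> : p.2 ^+ 2 = p.2 ^+ 2 * (q_i I ^+ 2 + q_j I ^+ 2 + q_k I ^+ 2) by rewrite e mulr1.
by apply/eqP; ring.
Qed.

Lemma slice_coord_pt I p : imag_unit I -> slice_coord (slice_pt I p) = (p.1, `|p.2|).
Proof. by move=> hI; rewrite /slice_coord qim_norm_slice_pt// slice_ptE. Qed.

Lemma slice_unit_pt I p : imag_unit I -> 0 < p.2 -> slice_unit (slice_pt I p) = I.
Proof.
move=> hI p0; rewrite /slice_unit ifF; last first.
  by apply/negbTE; rewrite -normr_eq0 qim_norm_slice_pt// normr_eq0 gt_eqF.
rewrite qim_norm_slice_pt// gtr0_norm// slice_ptE//; case/imag_unitP: hI => h0 _.
have p0' : p.2 != 0 by rewrite gt_eqF.
by apply: quat_ext => /=; rewrite ?h0 ?mulr0// mulKf.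
Qed.

Lemma slice_unit_imag q : imag_unit (slice_unit q).
Proof.
rewrite /slice_unit; case: eqVneq => [_|h]; first exact: imag_unit_qi.
have n0 : `|qim q| != 0 by rewrite normr_eq0.
apply/imag_unitP; rewrite /= mulr0; split => //.
have := sqr_qnorm (qim q); rewrite /= expr0n add0r => e.
by rewrite !exprMn -!mulrDr -e exprVn mulVf// expf_neq0.
Qed.

Lemma slice_coordK q : slice_pt (slice_unit q) (slice_coord q) = q.
Proof.
rewrite slice_ptE; last exact: slice_unit_imag.
rewrite /slice_coord /slice_unit /=; case: eqVneq => [h|h] /=.
  have /= := congr1 (@q_i R) h; have /= := congr1 (@q_j R) h.
  have /= := congr1 (@q_k R) h; rewrite h normr0 !mul0r => e1 e2 e3.
  by apply: quat_ext.
have n0 : `|qim q| != 0 by rewrite normr_eq0.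
by apply: quat_ext => //=; rewrite mulVKf.
Qed.

Lemma stem0 F (x : R) : is_stem F -> F.2 (x, 0) = 0 :> H.
Proof.
move=> /(_ x 0)[_]; rewrite oppr0 => /eqP; rewrite -addr_eq0 -mulr2n => /eqP h.
apply: qcP => c; have := congr1 (qc c) h; rewrite mulr2n qcD qc0; lra.
Qed.

(** A point x + y I with y < 0 has coordinates (x, - y) and unit - I, and parity makes both
    descriptions agree. On the real axis the odd component vanishes, so the conventional choice of
    unit there does not matter. *)
Lemma induced_byP (F : (R * R -> H) * (R * R -> H)) f : is_stem F -> induced_by F f <->
  forall q, f q = F.1 (slice_coord q) + slice_unit q * F.2 (slice_coord q).
Proof.
move=> sF; split=> [h q|h I hI [x y]].
  by rewrite -{1}(slice_coordK q) h//; exact: slice_unit_imag.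
rewrite h slice_coord_pt//=.
have [y0|y0|y0] := ltgtP 0 y.
- by rewrite slice_unit_pt// gtr0_norm.
- rewrite ltr0_norm//; have [-> ->] := sF x y.
  have -> : slice_unit (slice_pt I (x, y)) = - I.
    rewrite -{1}[I]opprK slice_ptN slice_unit_pt//=; first exact: imag_unitN.
    by rewrite oppr_gt0.
  by rewrite mulrN mulNr opprK.
- by rewrite -y0 normr0 stem0// !mulr0.
Qed.

(** The representation formula: the values at [I] and [- I] determine the stem. Uniqueness,
    measurability and oscillation bounds for stems all come from it. *)
Lemma induced_by_avg F f I p : induced_by F f -> imag_unit I ->
  F.1 p = 2^-1 *: (f (slice_pt I p) + f (slice_pt (- I) p)) /\
  F.2 p = 2^-1 *: (- I * (f (slice_pt I p) - f (slice_pt (- I) p))).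
Proof.
move=> hF hI; have hIN := imag_unitN hI.
rewrite (hF _ hI) (hF _ hIN) mulNr; set a := F.1 p; set b := F.2 p.
have -> : a + I * b + (a - I * b) = 2 *: a.
  by rewrite addrACA subrr addr0 -mulr2n scaler_nat.
have -> : a + I * b - (a - I * b) = I * (2 *: b).
  by rewrite opprD opprK addrACA subrr add0r -mulr2n -scaler_nat scalerAr.
by rewrite mulNr mulrA imag_unitM// mulN1r opprK !scalerA mulVf ?pnatr_eq0// !scale1r.
Qed.

Lemma induced_by_uniq F G (f : H -> H) : induced_by F f -> induced_by G f -> F = G.
Proof.
move=> hF hG; case: F G hF hG => [F0 F1] [G0 G1] hF hG.
congr (_, _); apply/funext => p.
- have [/= -> _] := induced_by_avg p hF imag_unit_qi.
  by have [/= -> _] := induced_by_avg p hG imag_unit_qi.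
- have [/= _ ->] := induced_by_avg p hF imag_unit_qi.
  by have [/= _ ->] := induced_by_avg p hG imag_unit_qi.
Qed.

Lemma stemP (f : H -> H) : slice_fun f -> is_stem (stem f) /\ induced_by (stem f) f.
Proof. by move=> [F hF]; rewrite /stem; case: xgetP => [G _ //|/(_ F)]. Qed.

Lemma stem_eq F (f : H -> H) : is_stem F -> induced_by F f -> stem f = F.
Proof.
move=> sF iF; apply: (induced_by_uniq _ iF).
by have [] := stemP (ex_intro _ F (conj sF iF)).
Qed.

Lemma measurable_slice_coord : measurable_fun setT (slice_coord : H -> P2).
Proof.
have [m0 mi mj mk] := @measurable_coords R.
apply: measurable_fun_pair => //; apply: measurable_qnorm.
by apply: measurable_fun_quat => //; exact: measurable_cst.
Qed.

Lemma measurable_qim : measurable_fun setT (@qim R).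
Proof.
have [m0 mi mj mk] := @measurable_coords R.
by apply: measurable_fun_quat => //; exact: measurable_cst.
Qed.

Lemma measurable_slice_unit : measurable_fun setT (slice_unit : H -> H).
Proof.
have mn := measurable_qnorm measurable_qim.
apply: measurable_fun_ifT.
- have -> : (fun q : H => qim q == 0) = (fun q => `|qim q| == (cst 0 q)).
    by apply/funext => q; rewrite normr_eq0.
  by apply: measurable_fun_eqr => //.
- exact: measurable_cst.
- apply: measurable_qZ; last exact: measurable_qim.
  under eq_fun do rewrite -powR_inv1//.
  exact: (measurableT_comp (measurable_powR (-1)) mn).
Qed.

Lemma measurable_slice_pt I : measurable_fun setT (slice_pt I : P2 -> H).
Proof.
apply: measurable_qD; apply: measurable_qZ; try exact: measurable_cst.
  exact: measurable_fst.
exact: measurable_snd.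
Qed.

End slices.

(** * Integration with respect to dV *)

Section upper_measure.
Context {R : realType}.
Local Notation H := (quat R).
Local Notation mR := (measurableTypeR R).
Local Notation P2 := (mR * mR)%type.
Implicit Types (I J q : H) (p : P2).

Definition upper_leb : set P2 -> \bar R := mrestr (@leb2 R) measurable_upper.
HB.instance Definition _ := Measure.copy upper_leb (mrestr (@leb2 R) measurable_upper).

Let upper_leb_sigma_finite : sigma_finite setT upper_leb.
Proof.
have [F FT Ff] := @leb2_sigma_finite R.
exists F; first exact: FT.
move=> i; have [mF Fi] := Ff i; split; first exact: mF.
exact: (le_lt_trans (measureIl (@leb2 R) mF measurable_upper) Fi).
Qed.

HB.instance Definition _ :=
  Measure_isSigmaFinite.Build _ _ _ upper_leb upper_leb_sigma_finite.

Lemma ge0_integral_upper_leb (f : P2 -> \bar R) : measurable_fun setT f ->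
  (forall p, 0 <= f p)%E -> (\int[upper_leb]_p f p = \int[leb2]_(p in upper) f p)%E.
Proof. exact: ge0_integral_mrestr_upper. Qed.

Lemma integral_upper_leb (f : P2 -> \bar R) : measurable_fun setT f ->
  (\int[upper_leb]_p f p = \int[leb2]_(p in upper) f p)%E.
Proof. exact: integral_mrestr_upper. Qed.

Lemma ge0_integral_dV (f : H -> \bar R) : measurable_fun setT f ->
  (forall q, 0 <= f q)%E ->
  (\int[dV]_q f q =
   \int[leb2]_(p in upper) \int[@sphere_measure R]_J f (slice_pt J p))%E.
Proof.
move=> mf f0.
have mfp : measurable_fun setT (f \o polar_pt).
  exact: measurableT_comp mf measurable_polar_pt.
apply: etrans; first exact: (ge0_integral_pushforward measurable_polar_pt
   (upper_leb \x sphere_measure)%E measurableT mf (fun q _ => f0 q)).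
rewrite preimage_setT.
apply: etrans; first exact: (@fubini_tonelli1 _ _ _ _ _ upper_leb sphere_measure (f \o polar_pt) mfp (fun x => f0 _)).
rewrite ge0_integral_upper_leb//.
- exact: (@measurable_fun_fubini_tonelli_F _ _ _ _ _ sphere_measure _ mfp (fun x => f0 _)).
- by move=> p; apply: integral_ge0 => J _; exact: f0.
Qed.

Lemma Rintegral_dV (f : H -> R) : dV.-integrable setT (EFin \o f) ->
  measurable_fun setT f ->
  \int[dV]_q f q = fine (\int[leb2]_(p in upper) \int[@sphere_measure R]_J (f (slice_pt J p))%:E)%E.
Proof.
move=> fi mf; rewrite /Rintegral; congr fine.
have mE : measurable_fun setT (EFin \o f) by exact/measurable_EFinP.
have mfp : measurable_fun setT (EFin \o f \o polar_pt).
  exact: measurableT_comp mE measurable_polar_pt.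
have ip : (upper_leb \x sphere_measure)%E.-integrable setT (EFin \o f \o polar_pt).
  case/integrableP: fi => _ fy; apply/integrableP; split => //.
  have mA : measurable_fun setT (abse \o (EFin \o f)) by exact: measurableT_comp.
  have := ge0_integral_pushforward measurable_polar_pt
   (upper_leb \x sphere_measure)%E measurableT mA (fun q _ => abse_ge0 _).
  rewrite preimage_setT => h.
  exact: (eq_rect _ (fun x => (x < +oo)%E) fy _ h).
apply: etrans; first exact: (integral_pushforward measurable_polar_pt mE ip measurableT).
rewrite preimage_setT.
apply: etrans; first by symmetry; exact: (integral12_prod_meas1 (m1 := upper_leb) (m2 := sphere_measure) ip).
rewrite integral_upper_leb//.
exact: (measurable_fubini_F (m1 := upper_leb) (m2 := sphere_measure) ip).
Qed.

End upper_measure.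

(** * Moments of the unit sphere of imaginary quaternions *)

Section sphere.
Context {R : realType}.
Local Notation H := (quat R).
Local Notation mR := (measurableTypeR R).
Local Notation P2 := (mR * mR)%type.

Lemma integral_uniform_integrable (a b : R) (ab : a < b) (f : mR -> R) :
  measurable_fun setT f ->
  lebesgue_measure.-integrable `[a, b] (EFin \o f) ->
  (\int[uniform_prob ab]_x (f x)%:E =
    (b - a)^-1%:E * \int[lebesgue_measure]_(x in `[a, b]) (f x)%:E)%E.
Proof.
move=> mf fi; have mE : measurable_fun setT (EFin \o f) by exact/measurable_EFinP.
have hp := integral_uniform ab (measurable_funepos mE) (funepos_ge0 _).
have hn := integral_uniform ab (measurable_funeneg mE) (funeneg_ge0 _).
apply: etrans; first exact: integralE.
apply: etrans; first exact: (f_equal2 (fun a b : \bar R => (a - b)%E) hp hn).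
apply: etrans; first (symmetry; apply: muleBr => //).
  rewrite fin_num_adde_defl// fin_numN; apply: integrable_fin_num => //.
  exact: integrable_funeneg.
by congr (_ * _)%E; symmetry; exact: integralE.
Qed.

Lemma integrable_continuous_itv (a b : R) (f : mR -> R) : continuous (f : R -> R) ->
  lebesgue_measure.-integrable `[a, b] (EFin \o f).
Proof.
move=> cf; apply: continuous_compact_integrable; first exact: segment_compact.
exact: continuous_subspaceT.
Qed.

Lemma uniform_integrable (a b : R) (ab : a < b) (f : mR -> R) : continuous (f : R -> R) ->
  (uniform_prob ab).-integrable setT (EFin \o f).
Proof.
move=> cf; have mf : measurable_fun setT f by exact: continuous_measurable_fun.
apply: integrableR => //; rewrite integral_uniform//; last by mfun.
rewrite lte_mul_pinfty ?lee_fin ?invr_ge0 ?subr_ge0 ?(ltW ab)//.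
by have /integrableP[_] := @integrable_continuous_itv a b f cf.
Qed.

Lemma uniform_integral_0 (a b : R) (ab : a < b) (f F : R -> R) :
  continuous f -> (forall x : R, is_derive x 1 F (f x)) -> F a = F b ->
  (\int[uniform_prob ab]_x (f x)%:E = 0)%E.
Proof.
move=> cf dF Fab.
rewrite integral_uniform_integrable//; last 2 first.
- exact: continuous_measurable_fun.
- exact: integrable_continuous_itv.
have cF x : {for x, continuous F}.
  by apply: differentiable_continuous; apply/derivable1_diffP; exact: (@ex_derive _ _ _ _ _ _ _ (dF x)).
rewrite (@continuous_FTC2 _ f F).
- by rewrite Fab subee// mule0.
- exact: ab.
- exact: continuous_subspaceT.
- split.
  + by move=> x _; exact: (@ex_derive _ _ _ _ _ _ _ (dF x)).
  + exact: cvg_at_right_filter (cF _).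
  + exact: cvg_at_left_filter (cF _).
- by move=> x _; rewrite derive1E; exact: (@derive_val _ _ _ _ _ _ _ (dF x)).
Qed.

Let U1 := uniform_prob (@ltN11 R).
Let U2 := uniform_prob (@lt0_2pi R).

Let prod_integrable (f g : mR -> R) : continuous (f : R -> R) -> continuous (g : R -> R) ->
  (U1 \x U2)%E.-integrable setT (EFin \o (fun u : P2 => f u.1 * g u.2)).
Proof.
move=> cf cg.
have mf : measurable_fun setT f by exact: continuous_measurable_fun.
have mg : measurable_fun setT g by exact: continuous_measurable_fun.
have mfg : measurable_fun setT (fun u : P2 => f u.1 * g u.2).
  apply: measurable_funM.
    exact: (measurableT_comp mf measurable_fst).
  exact: (measurableT_comp mg measurable_snd).
apply/integrable12ltyP; first exact/measurable_EFinP.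
have g0 : (0 <= \int[U2]_y `|g y|%:E)%E by apply: integral_ge0 => y _; rewrite lee_fin.
have -> : (\int[U1]_x \int[U2]_y `|(f x * g y)%:E| =
    \int[U1]_x (`|f x|%:E * \int[U2]_y `|g y|%:E))%E.
  apply: eq_integral => x _; rewrite -ge0_integralZl//; last by mfun.
  by apply: eq_integral => y _; rewrite /= normrM EFinM.
rewrite ge0_integralZr//; last by mfun.
have /integrableP[_ fy] := uniform_integrable (@ltN11 R) cf.
have /integrableP[_ gy] := uniform_integrable (@lt0_2pi R) cg.
have f0 : (0 <= \int[U1]_x `|f x|%:E)%E by apply: integral_ge0 => x _; rewrite lee_fin.
apply: lte_mul_pinfty; [exact: f0| |exact: gy].
by rewrite (ge0_fin_numE f0); exact: fy.
Qed.

Let prod_integral (f g : mR -> R) : continuous (f : R -> R) -> continuous (g : R -> R) ->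
  ((\int[U1]_x (f x)%:E = 0 \/ \int[U2]_x (g x)%:E = 0) ->
  \int[U1 \x U2]_u (f u.1 * g u.2)%:E = 0)%E.
Proof.
move=> cf cg h.
rewrite -(integral12_prod_meas1 (prod_integrable cf cg)) /fubini_F.
have -> : (\int[U1]_x \int[U2]_y (EFin \o (fun u : P2 => (f u.1 * g u.2)%R)) (x, y) =
    \int[U1]_x ((f x)%:E * \int[U2]_y (g y)%:E))%E.
  apply: eq_integral => x _; rewrite -integralZl//; exact: uniform_integrable.
case: h => h; last by rewrite h; apply: integral0_eq => x _; rewrite mule0.
have /fineK <- := integrable_fin_num measurableT (uniform_integrable (@lt0_2pi R) cg).
by rewrite integralZr ?h ?mul0e//; exact: uniform_integrable.
Qed.

Let csqrt : continuous (fun t : R => Num.sqrt (1 - t ^+ 2)).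
Proof.
move=> t; apply: continuous_comp; last exact: sqrt_continuous.
by apply: cvgB; [exact: cvg_cst|apply: exprn_continuous].
Qed.

Let is_derive_sq2 (x : R) : is_derive x 1 (fun t : R => t ^+ 2 / 2) x.
Proof. by apply: is_derive_eq; rewrite /GRing.scale /=; field. Qed.

(** In cylindrical coordinates these are integrals of cos and sin over a full period and of the
    height over [-1, 1]. *)
Lemma sphere_moment c : (@sphere_measure R).-integrable setT (EFin \o @qc R c) /\
  (\int[@sphere_measure R]_J (qc c J)%:E = 0)%E.
Proof.
have mE : measurable_fun setT (EFin \o @qc R c).
  by apply/measurable_EFinP; exact: measurable_qc.
suff [ip i0] : (U1 \x U2)%E.-integrable setT (EFin \o @qc R c \o sphere_pt) /\
   (\int[U1 \x U2]_u (qc c (sphere_pt u : H))%:E = 0)%E.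
  split.
    exact: (integrable_pushforward measurable_sphere_pt mE ip measurableT).
  apply: etrans; last exact: i0.
  by apply: etrans; first exact: (integral_pushforward measurable_sphere_pt mE ip measurableT).
have c1 : continuous (fun _ : R => 1 : R) by exact: cst_continuous.
have cid : continuous (fun t : R => t) by move=> t; exact: cvg_id.
case: c mE => _.
- split; last by rewrite integral0_eq.
  by apply: (eq_integrable measurableT (cst 0%E)) => //; exact: integrable0.
- split; first exact: (prod_integrable csqrt (@continuous_cos R)).
  apply: (prod_integral csqrt (@continuous_cos R)); right.
  apply: (uniform_integral_0 _ (@continuous_cos R) (F := sin)) => //.
  by rewrite sin0 mulr_natl sin2pi.
- split; first exact: (prod_integrable csqrt (@continuous_sin R)).
  apply: (prod_integral csqrt (@continuous_sin R)); right.
  apply: (uniform_integral_0 _ (@continuous_sin R) (F := fun x => - cos x)) => //.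
  + by move=> x; apply: is_derive_eq; rewrite opprK.
  + by rewrite cos0 mulr_natl cos2pi.
- have e u : qc Ck (sphere_pt u) = u.1 * 1 :> R by rewrite mulr1.
  split.
    have := prod_integrable cid c1.
    by apply: eq_integrable => // u _ /=; rewrite mulr1.
  under eq_integral do rewrite e.
  apply: (prod_integral cid c1); left.
  apply: (uniform_integral_0 _ cid is_derive_sq2).
  by rewrite sqrrN.
Qed.

End sphere.

Section slice_integrals.
Context {R : realType}.
Local Notation H := (quat R).
Local Notation mR := (measurableTypeR R).
Local Notation P2 := (mR * mR)%type.
Implicit Types (I J q : H) (p u : P2).

Lemma qnorm1 : `|1 : H| = 1.
Proof.
apply/eqP; rewrite -(@eqrXn2 _ 2)// sqr_qnorm /=; apply/eqP; ring.
Qed.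

Lemma measurable_imag_unit : measurable (@imag_unit R).
Proof.
have [m0 mi mj mk] := @measurable_coords R.
have -> : @imag_unit R = (@q_re R @^-1` [set 0]) `&`
   ((fun q : H => q_i q ^+ 2 + q_j q ^+ 2 + q_k q ^+ 2) @^-1` [set 1]).
  by apply/seteqP; split=> q /imag_unitP.
apply: measurableI.
  by rewrite -[X in measurable X]setTI; apply: m0 => //; exact: measurable_set1.
have ms : measurable_fun setT (fun q : H => q_i q ^+ 2 + q_j q ^+ 2 + q_k q ^+ 2).
  by do 2 (apply: measurable_funD; last exact: measurable_funX); exact: measurable_funX.
by rewrite -[X in measurable X]setTI; apply: ms => //; exact: measurable_set1.
Qed.

Let U1 := uniform_prob (@ltN11 R).
Let U2 := uniform_prob (@lt0_2pi R).

(** The measure lives on all quaternions, as the law of [sphere_pt]. A value off the sphere needs a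
    height outside [-1, 1], where [Num.sqrt] of a negative number is 0; the uniform law gives such
    heights no mass. *)
Lemma sphere_measure_imag : sphere_measure (~` @imag_unit R) = 0%E.
Proof.
have mA := measurableC measurable_imag_unit.
pose N : set mR := ~` `[-1, 1]%classic.
have mN : measurable N by apply: measurableC; exact: measurable_itv.
have U1N : U1 N = 0%E.
  have -> : (U1 N = \int[U1]_x (\1_N x)%:E)%E by rewrite integral_indic// setIT.
  rewrite integral_uniform; last 2 first.
  - by apply/measurable_EFinP; exact: measurable_indic.
  - by move=> x; rewrite lee_fin indicE.
  rewrite integral0_eq ?mule0// => x x11; rewrite indicE memNset//.
apply/eqP; rewrite eq_le measure_ge0 andbT.
have e : sphere_measure (~` @imag_unit R) = (U1 \x U2)%E (sphere_pt @^-1` (~` @imag_unit R)).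
  by [].
rewrite e; apply: (@le_trans _ _ ((U1 \x U2)%E (N `*` setT))); last first.
  have -> : (U1 \x U2)%E (N `*` setT) = (U1 N * U2 setT)%E.
    exact: product_measure1E.
  by rewrite U1N mul0e.
apply: le_measure.
- rewrite inE -[X in measurable X]setTI; exact: measurable_sphere_pt.
- by rewrite inE; exact: measurableX.
move=> u hu; split => //; rewrite /N /= in_itv /= => /andP[h1 h2]; apply: hu.
apply/imag_unitP; split => //=.
have h : 0 <= 1 - u.1 ^+ 2 by nra.
rewrite !exprMn sqr_sqrtr// -mulrDr cos2Dsin2 mulr1 subrK//.
Qed.

Lemma ae_sphere (P : H -> Prop) : (forall J, imag_unit J -> P J) ->
  {ae (@sphere_measure R), forall J, P J}.
Proof.
move=> h; exists (~` @imag_unit R); split.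
- exact: measurableC measurable_imag_unit.
- exact: sphere_measure_imag.
- by move=> J nJ uJ; apply: nJ; exact: h.
Qed.

(** The terms linear in [J] have zero mean by [sphere_moment]. This is the mechanism that turns
    integrals against dV into planar ones. *)
Lemma sphere_integral (f : H -> R) (c0 ci cj ck : R) : measurable_fun setT f ->
  (forall J, imag_unit J -> f J = c0 + (ci * q_i J + cj * q_j J + ck * q_k J)) ->
  (\int[@sphere_measure R]_J (f J)%:E = c0%:E)%E.
Proof.
move=> mf fE.
have [m0 mi mj mk] := @measurable_coords R.
have [ii ei] := @sphere_moment R Ci.
have [ij ej] := @sphere_moment R Cj.
have [ik ek] := @sphere_moment R Ck.
have mg : measurable_fun setT (fun J : H => c0 + (ci * q_i J + cj * q_j J + ck * q_k J)).
  by mfun; assumption.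
transitivity (\int[@sphere_measure R]_J (c0 + (ci * q_i J + cj * q_j J + ck * q_k J))%:E)%E.
  apply: ae_eq_integral => //.
  - exact/measurable_EFinP.
  - exact/measurable_EFinP.
  - by apply: ae_sphere => J hJ _; rewrite fE.
have jc (c : R) k : (@sphere_measure R).-integrable setT (EFin \o (fun J => c * qc k J)).
  have [ik' _] := @sphere_moment R k.
  by apply: eq_integrable (integrableZl measurableT c ik').
have i0 : (@sphere_measure R).-integrable setT (EFin \o cst c0).
  exact: finite_measure_integrable_cst.
have i1 : (@sphere_measure R).-integrable setT (EFin \o (fun J => ci * q_i J + cj * q_j J)).
  by apply: eq_integrable (integrableD measurableT (jc ci Ci) (jc cj Cj)).
have i2 : (@sphere_measure R).-integrable setT (EFin \o (fun J => ci * q_i J + cj * q_j J + ck * q_k J)).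
  by apply: eq_integrable (integrableD measurableT i1 (jc ck Ck)).
under eq_integral do rewrite EFinD.
rewrite integralD//; under [X in (_ + X)%E]eq_integral do rewrite EFinD.
rewrite integralD//; last exact: (jc ck Ck).
under [X in (_ + (X + _))%E]eq_integral do rewrite EFinD.
rewrite integralD//; [|exact: (jc ci Ci)|exact: (jc cj Cj)].
have z (c : R) k : (\int[@sphere_measure R]_J (c * qc k J)%:E = 0)%E.
  have [ik' ek'] := @sphere_moment R k.
  under eq_integral do rewrite EFinM.
  by rewrite integralZl// ek' mule0.
rewrite (z ci Ci) (z cj Cj) (z ck Ck) !adde0 integral_cst//.
by rewrite -[X in (_ * X)%E]/(sphere_measure setT) probability_setT mule1.
Qed.

Definition from_stem (F : (R * R -> H) * (R * R -> H)) : H -> H :=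
  fun q => F.1 (slice_coord q) + slice_unit q * F.2 (slice_coord q).

Lemma from_stem_pt F p J : imag_unit J -> upper p ->
  from_stem F (slice_pt J p) = F.1 p + J * F.2 p.
Proof.
move=> hJ p0; rewrite /from_stem slice_unit_pt// slice_coord_pt//.
by rewrite gtr0_norm// -surjective_pairing.
Qed.

Lemma measurable_from_stem F : measurable_fun setT (F.1 : P2 -> H) ->
  measurable_fun setT (F.2 : P2 -> H) -> measurable_fun setT (from_stem F).
Proof.
move=> m1 m2; apply: measurable_qD.
  exact: measurableT_comp m1 measurable_slice_coord.
apply: measurable_qM; first exact: measurable_slice_unit.
exact: measurableT_comp m2 measurable_slice_coord.
Qed.

(** The cross term, twice the inner product of [a] and J b, is linear in [J]; its coefficients are
    written out so that [sphere_integral] applies. *)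
Lemma sqr_norm_slice (a b J : H) : imag_unit J ->
  `|a + J * b| ^+ 2 = (`|a| ^+ 2 + `|b| ^+ 2) +
   (2 * (q_i a * q_re b - q_re a * q_i b + q_k a * q_j b - q_j a * q_k b) * q_i J +
    2 * (q_j a * q_re b - q_re a * q_j b + q_i a * q_k b - q_k a * q_i b) * q_j J +
    2 * (q_k a * q_re b - q_re a * q_k b + q_j a * q_i b - q_i a * q_j b) * q_k J).
Proof.
move=> hJ.
have e : `|a + J * b| ^+ 2 = `|a| ^+ 2 + `|J * b| ^+ 2 +
    2 * (q_re a * q_re (J * b) + q_i a * q_i (J * b) + q_j a * q_j (J * b) + q_k a * q_k (J * b)).
  by rewrite !sqr_qnorm /=; ring.
rewrite e qnormM (imag_unit_norm hJ) mul1r; case/imag_unitP: hJ => h0 _ /=.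
by rewrite h0; ring.
Qed.

Lemma dV_sqnorm F (om : P2 -> R) : measurable_fun setT (F.1 : P2 -> H) ->
  measurable_fun setT (F.2 : P2 -> H) -> measurable_fun setT om -> (forall p, 0 <= om p) ->
  (\int[dV]_q (`|from_stem F q| ^+ 2 * om (slice_coord q))%:E =
   \int[leb2]_(p in upper) ((`|F.1 p| ^+ 2 + `|F.2 p| ^+ 2) * om p)%:E)%E.
Proof.
move=> m1 m2 mo o0.
have mF := measurable_from_stem m1 m2.
have mi : measurable_fun setT (fun q : H => `|from_stem F q| ^+ 2 * om (slice_coord q)).
  apply: measurable_funM.
    by apply: measurable_funX; exact: measurable_qnorm.
  exact: measurableT_comp mo measurable_slice_coord.
rewrite ge0_integral_dV//; last 2 first.
- exact/measurable_EFinP.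
- by move=> q; rewrite lee_fin mulr_ge0// sqr_ge0.
apply: eq_integral => p; rewrite inE => up.
pose ci := 2 * (q_i (F.1 p) * q_re (F.2 p) - q_re (F.1 p) * q_i (F.2 p) + q_k (F.1 p) * q_j (F.2 p) - q_j (F.1 p) * q_k (F.2 p)).
pose cj := 2 * (q_j (F.1 p) * q_re (F.2 p) - q_re (F.1 p) * q_j (F.2 p) + q_i (F.1 p) * q_k (F.2 p) - q_k (F.1 p) * q_i (F.2 p)).
pose ck := 2 * (q_k (F.1 p) * q_re (F.2 p) - q_re (F.1 p) * q_k (F.2 p) + q_j (F.1 p) * q_i (F.2 p) - q_i (F.1 p) * q_j (F.2 p)).
apply: (@sphere_integral _ _ (ci * om p) (cj * om p) (ck * om p)).
  apply: (measurableT_comp mi).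
  apply: measurable_qD; first exact: measurable_cst.
  by apply: measurable_qZ; [exact: measurable_cst|exact: measurable_id].
move=> J hJ; rewrite from_stem_pt// sqr_norm_slice// slice_coord_pt//.
rewrite gtr0_norm// -surjective_pairing /ci /cj /ck; ring.
Qed.

(** On each sphere the integrand is affine in [J], so averaging leaves [A]. The bound [b] supplies
    the integrability for Fubini's theorem. *)
Lemma qintegral_dV (Phi : H -> H) (A : P2 -> H) (L : P2 -> H -> H) (b : P2 -> R) :
  measurable_fun setT Phi -> measurable_fun setT A -> measurable_fun setT b ->
  (forall p, 0 <= b p) ->
  (forall p x y, L p (x + y) = L p x + L p y) ->
  (forall p a x, L p (a *: x) = a *: L p x) ->
  (forall p J, upper p -> imag_unit J -> Phi (slice_pt J p) = A p + L p J) ->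
  (forall p J, upper p -> imag_unit J -> `|Phi (slice_pt J p)| <= b p) ->
  (\int[leb2]_(p in upper) (b p)%:E < +oo)%E ->
  qintegral dV setT Phi = qintegral leb2 upper A.
Proof.
move=> mP mA mb b0 LD LZ PE Pb by_; apply: qcP => c; rewrite !qc_qintegral.
have mc := (measurable_qcP Phi).1 mP c.
have mpt p : measurable_fun setT (fun J : H => slice_pt J p).
  apply: measurable_qD; first exact: measurable_cst.
  by apply: measurable_qZ; [exact: measurable_cst|exact: measurable_id].
rewrite Rintegral_dV//; last first.
  apply: integrableR => //; apply: le_lt_trans by_.
  rewrite ge0_integral_dV//; last by mfun.
  apply: ge0_le_integral.
  - exact: measurable_upper.
  - by move=> p _; apply: integral_ge0.
  - apply: measurable_funTS.
    have mE : measurable_fun setT (fun q : H => (`|qc c (Phi q)|)%:E) by mfun.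
    have nn x : (0 <= ((fun q : H => (`|qc c (Phi q)|)%:E) \o polar_pt) x)%E.
      by rewrite lee_fin.
    exact: (@measurable_fun_fubini_tonelli_F _ _ _ _ _ sphere_measure _
      (measurableT_comp mE measurable_polar_pt) nn).
  - by apply/measurable_EFinP; exact: measurable_funTS.
  - move=> p up.
    apply: (@le_trans _ _ (\int[@sphere_measure R]_J (b p)%:E)%E).
      apply: ae_ge0_le_integral => //.
      + by apply/measurable_EFinP; mfun; exact: (measurableT_comp mc (mpt p)).
      + by move=> J _; rewrite lee_fin.
      + apply: ae_sphere => J hJ _; rewrite lee_fin.
        by apply: le_trans (qc_le_norm _ _) _; exact: Pb.
    rewrite integral_cst//.
    by rewrite -[X in (_ * X)%E]/(sphere_measure setT) probability_setT mule1.
congr fine; apply: eq_integral => p; rewrite inE => up.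
apply: (@sphere_integral _ _ (qc c (L p (qe Ci))) (qc c (L p (qe Cj))) (qc c (L p (qe Ck)))).
  exact: (measurableT_comp mc (mpt p)).
move=> J hJ; rewrite PE// qcD (qc_linear c J (LD p) (LZ p)).
have [j0 _] := (imag_unitP J).1 hJ.
by rewrite /= j0 mul0r add0r !(mulrC (q_i J)) !(mulrC (q_j J)) !(mulrC (q_k J)).
Qed.

(** A null set for dV can meet every sphere, so a bound on the stem is extracted from integrals:
    otherwise the integral of the squared norm over all spheres with coordinates in the box would
    exceed that of the constant M^2. The added 1 makes the contradiction strict. *)
Lemma ae_bounded_box F (M e : R) u : measurable_fun setT (F.1 : P2 -> H) ->
  measurable_fun setT (F.2 : P2 -> H) ->
  {ae dV, forall q, `|from_stem F q| <= M} -> 0 < e -> box e u `<=` upper ->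
  exists2 p, box e u p & `|F.1 p| ^+ 2 + `|F.2 p| ^+ 2 <= M ^+ 2 + 1.
Proof.
move=> m1 m2 aeM e0 bu; apply: contrapT => nex.
have big p : box e u p -> M ^+ 2 + 1 <= `|F.1 p| ^+ 2 + `|F.2 p| ^+ 2.
  by move=> bp; rewrite leNgt; apply/negP => h; apply: nex; exists p => //; exact: ltW.
have mF := measurable_from_stem m1 m2.
have mb := @measurable_bx R e u.
have mbc : measurable_fun setT (fun q : H => bx e u (slice_coord q)).
  exact: measurableT_comp mb measurable_slice_coord.
have X : (\int[leb2]_(p in upper) (bx e u p)%:E = ((2 * e) ^+ 2)%:E)%E.
  rewrite integral_indic//; last exact: measurable_box.
  - by rewrite setIidl// leb2_box// ltW.
  - exact: measurable_upper.
have h1 := dV_sqnorm m1 m2 mb (bx_ge0 e u).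
(* The stem of the constant function [M], so that both sides of the comparison go through
   [dV_sqnorm]. *)
pose G : (R * R -> H) * (R * R -> H) := (cst (M%:A), cst 0).
have h2 := @dV_sqnorm G (bx e u) (measurable_cst _) (measurable_cst _) mb (bx_ge0 e u).
have le : (\int[dV]_q (`|from_stem F q| ^+ 2 * bx e u (slice_coord q))%:E <=
   \int[dV]_q (`|from_stem G q| ^+ 2 * bx e u (slice_coord q))%:E)%E.
  apply: ae_ge0_le_integral => //.
  - by move=> q _; rewrite lee_fin mulr_ge0 ?sqr_ge0 ?bx_ge0.
  - apply/measurable_EFinP; apply: measurable_funM => //; apply: measurable_funX.
    exact: measurable_qnorm.
  - by move=> q _; rewrite lee_fin mulr_ge0 ?sqr_ge0 ?bx_ge0.
  - apply/measurable_EFinP; apply: measurable_funM => //; apply: measurable_funX.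
    apply: measurable_qnorm; apply: measurable_from_stem; exact: measurable_cst.
  - apply: filterS aeM => q hq _; rewrite lee_fin ler_wpM2r ?bx_ge0//.
    rewrite /from_stem /= mulr0 addr0 normrZ qnorm1 mulr1 real_normK ?num_real//.
    rewrite -[leRHS]real_normK ?num_real//.
    by rewrite ler_pXn2r ?nnegrE// (le_trans hq)// ler_norm.
move: le; rewrite h1 h2 leNgt => /negP; apply.
apply: (@lt_le_trans _ _ (\int[leb2]_(p in upper) ((M ^+ 2 + 1) * bx e u p)%:E)%E); last first.
  apply: ge0_le_integralR.
  - exact: measurable_upper.
  - by apply: measurable_funM.
  - apply: measurable_funM => //; apply: measurable_funD; apply: measurable_funX; exact: measurable_qnorm.
  - by move=> p; rewrite mulr_ge0 ?bx_ge0// addr_ge0// sqr_ge0.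
  - move=> p _; rewrite /bx indicE; case: (boolP (p \in _)); last by rewrite !mulr0.
    by rewrite inE => /big; rewrite !mulr1.
have -> : (fun p : P2 => ((`|G.1 p| ^+ 2 + `|G.2 p| ^+ 2) * bx e u p)%:E) =
    (fun p => (M ^+ 2 * bx e u p)%:E).
  apply/funext => p; rewrite /G /= normr0 expr0n addr0 normrZ qnorm1 mulr1.
  by rewrite real_normK ?num_real.
rewrite !ge0_integralZR ?sqr_ge0 ?addr_ge0 ?sqr_ge0//; try exact: measurable_upper; try exact: bx_ge0.
by rewrite X -!EFinM lte_fin ltr_pM2r ?exprn_gt0 ?mulr_gt0// ltrDl.
Qed.

End slice_integrals.

(** * The reproducing kernel *)

Section complex_exponential.
Context {R : realType}.
Implicit Types (z w : R * R).

Definition cmul z w : R * R := (z.1 * w.1 - z.2 * w.2, z.1 * w.2 + z.2 * w.1).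
Definition cpow z n : R * R := iter n (cmul z) (1, 0).

Lemma cpowS z n : cpow z n.+1 = cmul z (cpow z n). Proof. by []. Qed.

Lemma cpowM z w n : cpow (cmul z w) n = cmul (cpow z n) (cpow w n).
Proof.
elim: n => [|n IH]; first by rewrite /cpow /cmul /=; congr (_, _); ring.
by rewrite !cpowS IH /cmul /=; congr (_, _); ring.
Qed.

Lemma cpowZ (a : R) z n :
  cpow (a * z.1, a * z.2) n = (a ^+ n * (cpow z n).1, a ^+ n * (cpow z n).2).
Proof.
elim: n => [|n IH]; first by rewrite /cpow /= expr0 !mul1r.
by rewrite !cpowS IH /cmul /= exprS; congr (_, _); ring.
Qed.

Lemma cpow_conj z n : cpow (z.1, - z.2) n = ((cpow z n).1, - (cpow z n).2).
Proof.
elim: n => [|n IH]; first by rewrite /cpow /= oppr0.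
by rewrite !cpowS IH /cmul /=; congr (_, _); ring.
Qed.

(** [ce] and [se] are the real and imaginary parts of the complex exponential. *)
Definition ce z : R := expR z.1 * cos z.2.
Definition se z : R := expR z.1 * sin z.2.

(** Real and imaginary parts of exp (t z) minus the first [n] terms of its power series. *)
Let crem z (n : nat) (t : R) : R * R :=
  (ce (t * z.1, t * z.2) - \sum_(k < n) t ^+ k * (cpow z k).1 / k`!%:R,
   se (t * z.1, t * z.2) - \sum_(k < n) t ^+ k * (cpow z k).2 / k`!%:R).

Lemma abs_cos_le1 (t : R) : `|cos t| <= 1.
Proof. by rewrite ler_norml cos_geN1 cos_le1. Qed.

Lemma abs_sin_le1 (t : R) : `|sin t| <= 1.
Proof. by rewrite ler_norml sin_geN1 sin_le1. Qed.

Lemma ce_le z : `|ce z| <= expR z.1.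
Proof. by rewrite normrM ger0_norm ?expR_ge0// ler_piMr ?expR_ge0// abs_cos_le1. Qed.

Lemma se_le z : `|se z| <= expR z.1.
Proof. by rewrite normrM ger0_norm ?expR_ge0// ler_piMr ?expR_ge0// abs_sin_le1. Qed.

Lemma is_derive_exprn (n : nat) (t : R) :
  is_derive t 1 (fun t => t ^+ n.+1) (n.+1%:R * t ^+ n).
Proof.
apply: DeriveDef; first exact: exprn_derivable.
by rewrite exp_derive /GRing.scale /= mulr1.
Qed.

Lemma is_derive_sum (n : nat) (a : nat -> R) (t : R) :
  is_derive t 1 (fun t => \sum_(k < n.+1) t ^+ k * a k / k`!%:R)
    (\sum_(k < n) t ^+ k * a k.+1 / k`!%:R).
Proof.
elim: n => [|n IH].
  rewrite big_ord0; under eq_fun do rewrite big_ord_recl big_ord0 expr0.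
  by apply: is_derive_eq.
have h : is_derive t 1 (fun t => t ^+ n.+1 * a n.+1 / n.+1`!%:R)
    (t ^+ n * a n.+1 / n`!%:R).
  have hx := is_derive_exprn n t.
  apply: is_derive_eq; rewrite /GRing.scale factS natrM /=; field.
  by rewrite nat1r !pnatr_eq0 -lt0n fact_gt0.
rewrite big_ord_recr /=.
under eq_fun do rewrite big_ord_recr.
exact: is_deriveD IH h.
Qed.

Lemma is_derive_ce z (t : R) : is_derive t 1 (fun t => ce (t * z.1, t * z.2))
  (z.1 * ce (t * z.1, t * z.2) - z.2 * se (t * z.1, t * z.2)).
Proof. by rewrite /ce /se /=; apply: is_derive_eq; rewrite /GRing.scale /=; ring. Qed.

Lemma is_derive_se z (t : R) : is_derive t 1 (fun t => se (t * z.1, t * z.2))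
  (z.1 * se (t * z.1, t * z.2) + z.2 * ce (t * z.1, t * z.2)).
Proof. by rewrite /ce /se /=; apply: is_derive_eq; rewrite /GRing.scale /=; ring. Qed.

(** For each sign s, the function K u^(n+1) / (n+1)! - s f(u) vanishes at 0 and has nonnegative
    derivative on [0, 1]. *)
Lemma derive_power_bound (f df : R -> R) (K : R) (n : nat) :
  (forall t : R, is_derive t 1 f (df t)) -> f 0 = 0 ->
  (forall t : R, 0 <= t <= 1 -> `|df t| <= K * t ^+ n / n`!%:R) ->
  forall t : R, 0 <= t <= 1 -> `|f t| <= K * t ^+ n.+1 / n.+1`!%:R.
Proof.
move=> hf f0 hdf t /andP[t0 t1].
have half (s : R) : `|s| = 1 -> s * f t <= K * t ^+ n.+1 / n.+1`!%:R.
  move=> s1; rewrite -subr_ge0.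
  pose g u := K * u ^+ n.+1 / n.+1`!%:R - s * f u.
  have dg (u : R) : is_derive u 1 g (K * u ^+ n / n`!%:R - s * df u).
    have h := hf u; have hx := is_derive_exprn n u.
    rewrite /g; apply: is_derive_eq; rewrite /GRing.scale factS natrM /=; field.
    by rewrite nat1r !pnatr_eq0 -lt0n fact_gt0.
  have cg a b : {within `[a, b], continuous g}.
    by apply: derivable_within_continuous => u _; exact: (@ex_derive _ _ _ _ _ _ _ (dg u)).
  have [c] := MVT_segment t0 (fun u _ => dg u) (cg 0 t).
  rewrite in_itv /= => /andP[c0 ct]; rewrite -/(g t) subr0.
  have -> : g 0 = 0 by rewrite /g f0 expr0n /= !mulr0 mul0r subr0.
  rewrite subr0 => ->; rewrite mulr_ge0// subr_ge0.
  apply: le_trans (ler_norm _) _; rewrite normrM s1 mul1r; apply: hdf.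
  by rewrite c0 (le_trans ct).
rewrite ler_norml lerNl -[- f t]mulN1r -{2}[f t]mul1r !half ?normrN ?normr1//.
Qed.

(** The derivative in [t] of the remainder of index n + 1 is [z] times the remainder of index n, so
    the bound follows by integrating n times from |exp (t z)| <= exp |z.1|. *)
Let crem_bound z n t : 0 <= t <= 1 ->
  `|(crem z n t).1| <= expR `|z.1| * (`|z.1| + `|z.2|) ^+ n * t ^+ n / n`!%:R /\
  `|(crem z n t).2| <= expR `|z.1| * (`|z.1| + `|z.2|) ^+ n * t ^+ n / n`!%:R.
Proof.
elim: n t => [|n IH] t t01.
  rewrite /crem /= !big_ord0 !subr0 !expr0 !mulr1 divr1.
  have e : expR (t * z.1) <= expR `|z.1|.
    rewrite ler_expR (le_trans (ler_norm _))// normrM ler_piMl//.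
    by case/andP: t01 => t0 t1; rewrite ger0_norm.
  by split; [apply: le_trans (ce_le _) _|apply: le_trans (se_le _) _].
have L0 : 0 <= `|z.1| + `|z.2| by rewrite addr_ge0.
have e0 : 0 <= expR `|z.1| by exact: expR_ge0.
have fn0 : 0 <= n`!%:R^-1 :> R by rewrite invr_ge0 ler0n.
have pre (a b : R) (s : R) : 0 <= s <= 1 ->
    `|a| <= expR `|z.1| * (`|z.1| + `|z.2|) ^+ n * s ^+ n / n`!%:R ->
    `|b| <= expR `|z.1| * (`|z.1| + `|z.2|) ^+ n * s ^+ n / n`!%:R ->
    `|z.1| * `|a| + `|z.2| * `|b| <=
      expR `|z.1| * (`|z.1| + `|z.2|) ^+ n.+1 * s ^+ n / n`!%:R.
  move=> _ ha hb; set B := (X in `|a| <= X) in ha.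
  have -> : expR `|z.1| * (`|z.1| + `|z.2|) ^+ n.+1 * s ^+ n / n`!%:R =
      `|z.1| * B + `|z.2| * B by rewrite /B exprS; ring.
  by rewrite lerD// ler_wpM2l.
split.
- apply: (@derive_power_bound (fun t => (crem z n.+1 t).1)
    (fun t => z.1 * (crem z n t).1 - z.2 * (crem z n t).2)) => //.
  + move=> s; rewrite /crem /=.
    have h1 := is_derive_sum n (fun k => (cpow z k).1) s.
    have h2 := is_derive_ce z s.
    apply: is_derive_eq.
    have -> : \sum_(k < n) s ^+ k * (cpow z k.+1).1 / k`!%:R =
        z.1 * (\sum_(k < n) s ^+ k * (cpow z k).1 / k`!%:R) -
        z.2 * (\sum_(k < n) s ^+ k * (cpow z k).2 / k`!%:R).
      rewrite !mulr_sumr -sumrB; apply: eq_bigr => k _.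
      by rewrite cpowS /cmul /=; ring.
    by ring.
  + rewrite /crem /= !mul0r /ce /= expR0 cos0 mul1r big_ord_recl /= big1 => [|k _].
      by rewrite addr0 expr0 /cpow /= fact0 mulr1n !mul1r invr1 subrr.
    by rewrite expr0n /= !mul0r.
  + move=> s s01; have [h1 h2] := IH s s01.
    apply: le_trans (pre _ _ _ s01 h1 h2); apply: le_trans (ler_normB _ _) _.
    by rewrite !normrM.
- apply: (@derive_power_bound (fun t => (crem z n.+1 t).2)
    (fun t => z.1 * (crem z n t).2 + z.2 * (crem z n t).1)) => //.
  + move=> s; rewrite /crem /=.
    have h1 := is_derive_sum n (fun k => (cpow z k).2) s.
    have h2 := is_derive_se z s.
    apply: is_derive_eq.
    have -> : \sum_(k < n) s ^+ k * (cpow z k.+1).2 / k`!%:R =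
        z.1 * (\sum_(k < n) s ^+ k * (cpow z k).2 / k`!%:R) +
        z.2 * (\sum_(k < n) s ^+ k * (cpow z k).1 / k`!%:R).
      rewrite !mulr_sumr -big_split; apply: eq_bigr => k _.
      by rewrite cpowS /cmul /=; ring.
    by ring.
  + rewrite /crem /= !mul0r /se /= sin0 mulr0 big_ord_recl /= big1 => [|k _].
      by rewrite addr0 /cpow /= !mulr0 mul0r subrr.
    by rewrite expr0n /= !mul0r.
  + move=> s s01; have [h1 h2] := IH s s01.
    apply: le_trans (pre _ _ _ s01 h2 h1); apply: le_trans (ler_normD _ _) _.
    by rewrite !normrM.
Qed.

Let cvg_crem (u : nat -> R) (l C L : R) :
  (forall n, `|l - series u n| <= C * L ^+ n / n`!%:R) -> series u @ \oo --> l.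
Proof.
move=> h.
have e0 : C * exp_coeff L n @[n --> \oo] --> (0 : R).
  rewrite -(mulr0 C); apply: cvgM; first exact: cvg_cst.
  exact: cvg_series_cvg_0 (is_cvg_series_exp_coeff L).
apply/cvgrPdist_le => e epos.
move/cvgrPdist_le: e0 => /(_ e epos); apply: filterS => n.
rewrite sub0r normrN => hn; apply: le_trans (h n) _.
by rewrite -mulrA (le_trans (ler_norm _)).
Qed.

Lemma cvg_ce z : series (fun n => (cpow z n).1 / n`!%:R) @ \oo --> ce z.
Proof.
apply: (@cvg_crem _ _ (expR `|z.1|) (`|z.1| + `|z.2|)) => n.
have [|h _] := @crem_bound z n 1; first by rewrite ler01 lexx.
move: h; rewrite /crem /= !mul1r expr1n mulr1 -surjective_pairing.
rewrite /series /= big_mkord; under [X in _ - X]eq_bigr do rewrite expr1n mul1r.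
by [].
Qed.

Lemma cvg_se z : series (fun n => (cpow z n).2 / n`!%:R) @ \oo --> se z.
Proof.
apply: (@cvg_crem _ _ (expR `|z.1|) (`|z.1| + `|z.2|)) => n.
have [|_ h] := @crem_bound z n 1; first by rewrite ler01 lexx.
move: h; rewrite /crem /= !mul1r expr1n mulr1 -surjective_pairing.
rewrite /series /= big_mkord; under [X in _ - X]eq_bigr do rewrite expr1n mul1r.
by [].
Qed.

End complex_exponential.

Section kernel.
Context {R : realType}.
Local Notation H := (quat R).
Local Notation mR := (measurableTypeR R).
Local Notation P2 := (mR * mR)%type.
Implicit Types (I J : H) (p q : R * R) (a : R).

(** With [p] and [q] read as complex numbers, [zp] is a p q and [zm] is a p q^bar. *)
Definition zp a p q : R * R := (a * (p.1 * q.1 - p.2 * q.2), a * (p.1 * q.2 + p.2 * q.1)).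
Definition zm a p q : R * R := (a * (p.1 * q.1 + p.2 * q.2), a * (p.2 * q.1 - p.1 * q.2)).

(** The four sums of a^n / n! times a part of p^n times a part of q^n: the first letter after [k]
    selects the part of p^n, the second that of q^n, with [c] for real and [s] for imaginary. *)
Definition kcc a p q := 2^-1 * (ce (zm a p q) + ce (zp a p q)).
Definition ksc a p q := 2^-1 * (se (zm a p q) + se (zp a p q)).
Definition kcs a p q := 2^-1 * (se (zp a p q) - se (zm a p q)).
Definition kss a p q := 2^-1 * (ce (zm a p q) - ce (zp a p q)).

Lemma cpow_zp a p q n : cpow (zp a p q) n =
  (a ^+ n * ((cpow p n).1 * (cpow q n).1 - (cpow p n).2 * (cpow q n).2),
   a ^+ n * ((cpow p n).1 * (cpow q n).2 + (cpow p n).2 * (cpow q n).1)).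
Proof. by rewrite -[zp a p q]/(a * (cmul p q).1, a * (cmul p q).2) cpowZ cpowM. Qed.

Lemma cpow_zm a p q n : cpow (zm a p q) n =
  (a ^+ n * ((cpow p n).1 * (cpow q n).1 + (cpow p n).2 * (cpow q n).2),
   a ^+ n * ((cpow p n).2 * (cpow q n).1 - (cpow p n).1 * (cpow q n).2)).
Proof.
have -> : zm a p q = (a * (cmul p (q.1, - q.2)).1, a * (cmul p (q.1, - q.2)).2).
  by rewrite /zm /cmul /=; congr (_, _); ring.
by rewrite cpowZ cpowM cpow_conj /cmul /=; congr (_, _); ring.
Qed.

Let cvg_half (u v w : nat -> R) (l l' e : R) :
  (forall n, w n = 2^-1 * (u n + e * v n)) ->
  series u @ \oo --> l -> series v @ \oo --> l' ->
  series w @ \oo --> 2^-1 * (l + e * l').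
Proof.
move=> wE ul vl.
have -> : series w = fun n => 2^-1 * (series u n + e * series v n).
  apply/funext => n; rewrite /series /= !mulr_sumr -big_split /= mulr_sumr.
  by apply: eq_bigr => k _; exact: wE.
apply: cvgM; first exact: cvg_cst.
by apply: cvgD => //; apply: cvgM => //; exact: cvg_cst.
Qed.

Lemma cvg_kcc a p q :
  series (fun n => a ^+ n / n`!%:R * ((cpow p n).1 * (cpow q n).1)) @ \oo --> kcc a p q.
Proof.
rewrite /kcc -[ce (zp a p q)]mul1r; apply: cvg_half (@cvg_ce _ _) (@cvg_ce _ _) => n.
by rewrite cpow_zp cpow_zm /=; field; rewrite pnatr_eq0 -lt0n fact_gt0.
Qed.

Lemma cvg_ksc a p q :
  series (fun n => a ^+ n / n`!%:R * ((cpow p n).2 * (cpow q n).1)) @ \oo --> ksc a p q.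
Proof.
rewrite /ksc -[se (zp a p q)]mul1r; apply: cvg_half (@cvg_se _ _) (@cvg_se _ _) => n.
by rewrite cpow_zp cpow_zm /=; field; rewrite pnatr_eq0 -lt0n fact_gt0.
Qed.

Lemma cvg_kcs a p q :
  series (fun n => a ^+ n / n`!%:R * ((cpow p n).1 * (cpow q n).2)) @ \oo --> kcs a p q.
Proof.
rewrite /kcs -[se (zm a p q)]mul1r -mulNr; apply: cvg_half (@cvg_se _ _) (@cvg_se _ _) => n.
by rewrite cpow_zp cpow_zm /=; field; rewrite pnatr_eq0 -lt0n fact_gt0.
Qed.

Lemma cvg_kss a p q :
  series (fun n => a ^+ n / n`!%:R * ((cpow p n).2 * (cpow q n).2)) @ \oo --> kss a p q.
Proof.
rewrite /kss -[ce (zp a p q)]mul1r -mulNr; apply: cvg_half (@cvg_ce _ _) (@cvg_ce _ _) => n.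
by rewrite cpow_zp cpow_zm /=; field; rewrite pnatr_eq0 -lt0n fact_gt0.
Qed.

Lemma slice_ptM I p q : imag_unit I ->
  slice_pt I p * slice_pt I q = slice_pt I (cmul p q).
Proof.
move=> hI; rewrite !slice_ptE//; case/imag_unitP: hI => _ e.
apply: quat_ext => /=; [|ring|ring|ring].
have -> : p.2 * q.2 = p.2 * q.2 * (q_i I ^+ 2 + q_j I ^+ 2 + q_k I ^+ 2) by rewrite e mulr1.
by ring.
Qed.

Lemma slice_ptX I p n : imag_unit I -> slice_pt I p ^+ n = slice_pt I (cpow p n).
Proof.
move=> hI; elim: n => [|n IH]; last by rewrite exprS IH slice_ptM.
by rewrite expr0 /slice_pt /cpow /= scale0r addr0 scale1r.
Qed.

Lemma qconj_slice_pt J q : imag_unit J -> qconj (slice_pt J q) = slice_pt (- J) q.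
Proof.
move=> hJ; rewrite slice_ptE// slice_ptE; last exact: imag_unitN.
by rewrite /qconj /=; congr Quat; ring.
Qed.

Lemma cvgZcst (u : nat -> R) (l : R) (v : H) :
  u @ \oo --> l -> u n *: v @[n --> \oo] --> l *: v.
Proof. by move=> ul; apply: cvgZr_tmp. Qed.

Lemma slice_pt_expand (c : R) I J p q :
  c *: (slice_pt I p * slice_pt (- J) q) =
  (c * (p.1 * q.1)) *: 1 + (c * (p.2 * q.1)) *: I - (c * (p.1 * q.2)) *: J -
  (c * (p.2 * q.2)) *: (I * J).
Proof. by rewrite /slice_pt; apply: quat_ext => /=; ring. Qed.

(** Powers stay in their slices, so each term is a product of an element of the slice of [I] and one
    of the slice of [J]. Expanding it in 1, I, J, I J leaves four real series. *)
Lemma fock_kernelE a I J p q : imag_unit I -> imag_unit J ->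
  fock_kernel a (slice_pt I p) (slice_pt J q) =
  kcc a p q *: 1 + ksc a p q *: I - kcs a p q *: J - kss a p q *: (I * J).
Proof.
move=> hI hJ; apply: cvg_lim; first exact: norm_hausdorff.
pose A := series (fun n => a ^+ n / n`!%:R * ((cpow p n).1 * (cpow q n).1)).
pose B := series (fun n => a ^+ n / n`!%:R * ((cpow p n).2 * (cpow q n).1)).
pose C := series (fun n => a ^+ n / n`!%:R * ((cpow p n).1 * (cpow q n).2)).
pose D := series (fun n => a ^+ n / n`!%:R * ((cpow p n).2 * (cpow q n).2)).
have -> : series (fun n => (a ^+ n / n`!%:R) *: (slice_pt I p ^+ n * qconj (slice_pt J q) ^+ n)) =
    fun n => A n *: 1 + B n *: I - C n *: J - D n *: (I * J).
  apply/funext => n; rewrite /A /B /C /D /series /= !scaler_suml -!sumrN -!big_split /=.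
  apply: eq_bigr => k _.
  rewrite qconj_slice_pt// !slice_ptX//; last exact: imag_unitN.
  exact: slice_pt_expand.
apply: cvgB; last exact: cvgZcst (@cvg_kss _ _ _).
apply: cvgB; last exact: cvgZcst (@cvg_kcs _ _ _).
by apply: cvgD; [exact: cvgZcst (@cvg_kcc _ _ _)|exact: cvgZcst (@cvg_ksc _ _ _)].
Qed.

End kernel.

(** * The projection in terms of stem functions *)

Section projection.
Context {R : realType}.
Local Notation H := (quat R).
Local Notation mR := (measurableTypeR R).
Local Notation P2 := (mR * mR)%type.
Implicit Types (I J : H) (p q : P2) (a : R) (phi psi : P2 -> R).

Definition l1 q : R := `|q.1| + `|q.2|.

Lemma l1_ge0 q : 0 <= l1 q. Proof. exact: addr_ge0. Qed.

Lemma measurable_l1 : measurable_fun setT l1. Proof. by rewrite /l1; mfun. Qed.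

(** Integrability against all exponentials. The reproducing kernel at a fixed point is bounded by
    one, so for such weighted functions the projection converges and can be differentiated under the
    integral. *)
Definition expint phi := measurable_fun setT phi /\
  forall C : R, (\int[leb2]_q (expR (C * l1 q) * `|phi q|)%:E < +oo)%E.

Let measurable_el1 C : measurable_fun setT (fun q => expR (C * l1 q)).
Proof. by mfun; exact: measurable_l1. Qed.

Lemma expint_le (A : R) phi psi : 0 <= A -> measurable_fun setT psi ->
  (forall q, `|psi q| <= A * `|phi q|) -> expint phi -> expint psi.
Proof.
move=> A0 mpsi le [mphi h]; split => // C; have me := measurable_el1 C.
apply: (@le_lt_trans _ _ (\int[leb2]_q (A * (expR (C * l1 q) * `|phi q|))%:E)%E).
  apply: ge0_le_integralR => //.
  - by apply: measurable_funM => //; mfun.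
  - by apply: measurable_funM => //; apply: measurable_funM => //; mfun.
  - by move=> q _; rewrite mulrCA ler_wpM2l ?expR_ge0.
rewrite ge0_integralZR//.
- by rewrite lte_mul_pinfty ?lee_fin.
- by apply: measurable_funM => //; mfun.
Qed.

Lemma expint_integrable phi (k : P2 -> R) (A C : R) : 0 <= A -> expint phi ->
  measurable_fun setT k -> (forall q, `|k q| <= A * expR (C * l1 q)) ->
  leb2.-integrable setT (EFin \o (fun q => k q * phi q)).
Proof.
move=> A0 [mphi h] mk kA; have me := measurable_el1 C.
apply: integrableR => //; first exact: measurable_funM.
apply: (@le_lt_trans _ _ (\int[leb2]_q (A * (expR (C * l1 q) * `|phi q|))%:E)%E).
  apply: ge0_le_integralR => //.
  - by mfun; exact: measurable_funM.
  - by apply: measurable_funM => //; apply: measurable_funM => //; mfun.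
  - by move=> q _; rewrite normrM mulrA ler_wpM2r.
rewrite ge0_integralZR//.
- by rewrite lte_mul_pinfty ?lee_fin.
- by apply: measurable_funM => //; mfun.
Qed.

Lemma expintD phi psi : expint phi -> expint psi -> expint (fun q => phi q + psi q).
Proof.
move=> [m1 h1] [m2 h2]; split; first exact: measurable_funD.
move=> C; have me := measurable_el1 C.
apply: (@le_lt_trans _ _ (\int[leb2]_q (expR (C * l1 q) * `|phi q| + expR (C * l1 q) * `|psi q|)%:E)%E).
  apply: ge0_le_integralR => //.
  - by apply: measurable_funM => //; mfun.
  - by apply: measurable_funD; apply: measurable_funM => //; mfun.
  - by move=> q _; rewrite -mulrDr ler_wpM2l ?expR_ge0// ler_normD.
rewrite ge0_integralDR//.
- by rewrite lte_add_pinfty.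
- by apply: measurable_funM => //; mfun.
- by apply: measurable_funM => //; mfun.
Qed.

Lemma zm_le a p q : 0 < a -> (zm a p q).1 <= a * l1 p * l1 q.
Proof.
move=> a0; rewrite /zm /l1 /= -mulrA ler_pM2l//.
apply: le_trans (ler_norm _) _; apply: le_trans (ler_normD _ _) _.
rewrite !normrM.
have [[h1 h2] [h3 h4]] := ((normr_ge0 p.1, normr_ge0 p.2), (normr_ge0 q.1, normr_ge0 q.2)).
by nra.
Qed.

Lemma zp_le a p q : 0 < a -> (zp a p q).1 <= a * l1 p * l1 q.
Proof.
move=> a0; rewrite /zp /l1 /= -mulrA ler_pM2l//.
apply: le_trans (ler_norm _) _; apply: le_trans (ler_normB _ _) _.
rewrite !normrM.
have [[h1 h2] [h3 h4]] := ((normr_ge0 p.1, normr_ge0 p.2), (normr_ge0 q.1, normr_ge0 q.2)).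
by nra.
Qed.

Lemma cem_le a p q : 0 < a -> `|ce (zm a p q)| <= expR (a * l1 p * l1 q).
Proof. by move=> a0; apply: le_trans (ce_le _) _; rewrite ler_expR zm_le. Qed.
Lemma sem_le a p q : 0 < a -> `|se (zm a p q)| <= expR (a * l1 p * l1 q).
Proof. by move=> a0; apply: le_trans (se_le _) _; rewrite ler_expR zm_le. Qed.
Lemma cep_le a p q : 0 < a -> `|ce (zp a p q)| <= expR (a * l1 p * l1 q).
Proof. by move=> a0; apply: le_trans (ce_le _) _; rewrite ler_expR zp_le. Qed.
Lemma sep_le a p q : 0 < a -> `|se (zp a p q)| <= expR (a * l1 p * l1 q).
Proof. by move=> a0; apply: le_trans (se_le _) _; rewrite ler_expR zp_le. Qed.

Let half_le (u v B : R) : `|u| <= B -> `|v| <= B -> `|2^-1 * (u + v)| <= B.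
Proof.
move=> hu hv; rewrite normrM ger0_norm ?invr_ge0//.
by have := ler_normD u v; lra.
Qed.

Lemma k_le a p q : 0 < a -> [/\ `|kcc a p q| <= expR (a * l1 p * l1 q),
  `|ksc a p q| <= expR (a * l1 p * l1 q), `|kcs a p q| <= expR (a * l1 p * l1 q) &
  `|kss a p q| <= expR (a * l1 p * l1 q)].
Proof.
move=> a0; split.
- by apply: half_le; [exact: cem_le|exact: cep_le].
- by apply: half_le; [exact: sem_le|exact: sep_le].
- by apply: half_le; [exact: sep_le|rewrite normrN; exact: sem_le].
- by apply: half_le; [exact: cem_le|rewrite normrN; exact: cep_le].
Qed.

Lemma continuous_zE (f : R -> R) a : continuous f ->
  [/\ forall p : R * R, continuous (fun q : R * R => f (zm a p q).1),
      forall p : R * R, continuous (fun q : R * R => f (zm a p q).2),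
      forall p : R * R, continuous (fun q : R * R => f (zp a p q).1) &
      forall p : R * R, continuous (fun q : R * R => f (zp a p q).2)].
Proof.
move=> cf; split=> p; apply: cont_comp => //; rewrite /zm /zp /=; cont.
Qed.

Lemma measurable_kE a p : [/\ measurable_fun setT (fun q => ce (zm a p q)),
  measurable_fun setT (fun q => se (zm a p q)),
  measurable_fun setT (fun q => ce (zp a p q)) &
  measurable_fun setT (fun q => se (zp a p q))].
Proof.
have [e1 _ e3 _] := continuous_zE a (@continuous_expR R).
have [_ c2 _ c4] := continuous_zE a (@continuous_cos R).
have [_ s2 _ s4] := continuous_zE a (@continuous_sin R).
by split; apply: continuous2_measurable; exact: contM.
Qed.

Lemma measurable_k a p : [/\ measurable_fun setT (kcc a p),
  measurable_fun setT (ksc a p), measurable_fun setT (kcs a p) & measurable_fun setT (kss a p)].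
Proof.
have [m1 m2 m3 m4] := measurable_kE a p.
by split; apply: measurable_funM => //; first [exact: measurable_funD|exact: measurable_funB].
Qed.

Definition wt a q : R := expR (- a * (q.1 ^+ 2 + q.2 ^+ 2)).

Lemma wt_ge0 a q : 0 <= wt a q. Proof. exact: expR_ge0. Qed.

Lemma measurable_wt a : measurable_fun setT (wt a).
Proof. by rewrite /wt; mfun. Qed.

Lemma fock_weight_pt a J q : imag_unit J ->
  fock_weight a (slice_pt J q) = 2 * a / pi * wt a q.
Proof. by move=> hJ; rewrite /fock_weight sqr_norm_slice_pt. Qed.

Lemma measurable_fock_weight a : measurable_fun setT (@fock_weight R a).
Proof.
apply: measurable_funM => //; apply: (measurableT_comp (@measurable_expR _)).
apply: measurable_funM => //; apply: measurable_funX; apply: measurable_qnorm.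
exact: measurable_id.
Qed.

Lemma measurable_fock_kernel a I p : imag_unit I ->
  measurable_fun setT (fock_kernel a (slice_pt I p)).
Proof.
move=> hI; have [m1 m2 m3 m4] := measurable_k a p.
have -> : fock_kernel a (slice_pt I p) = fun w =>
   kcc a p (slice_coord w) *: 1 + ksc a p (slice_coord w) *: I -
   kcs a p (slice_coord w) *: slice_unit w - kss a p (slice_coord w) *: (I * slice_unit w).
  apply/funext => w; rewrite -{1}(slice_coordK w) fock_kernelE//.
  exact: slice_unit_imag.
have mc := @measurable_slice_coord R; have mu := @measurable_slice_unit R.
apply: measurable_qB.
  apply: measurable_qB.
    by apply: measurable_qD; apply: measurable_qZ => //; exact: measurableT_comp mc.
  by apply: measurable_qZ => //; exact: measurableT_comp mc.
apply: measurable_qZ; first exact: measurableT_comp mc.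
by apply: measurable_qM.
Qed.

Section formula.
Variables (a : R) (h0 h1 : P2 -> H).
Hypotheses (a0 : 0 < a) (mh0 : measurable_fun setT h0) (mh1 : measurable_fun setT h1).
Hypotheses (eh0 : expint (fun q => wt a q * `|h0 q|)).
Hypotheses (eh1 : expint (fun q => wt a q * `|h1 q|)).

(** [proj0] and [proj1] are the two components of the Bargmann projection of h0 + iota h1, with
    kernel exp (a z q^bar). The factor is a / pi where dV has 2 a / pi, because the whole plane
    replaces the upper half. *)
Definition proj0 (z : P2) : H := qintegral leb2 setT (fun q =>
  (a / pi * wt a q) *: (ce (zm a z q) *: h0 q - se (zm a z q) *: h1 q)).
Definition proj1 (z : P2) : H := qintegral leb2 setT (fun q =>
  (a / pi * wt a q) *: (se (zm a z q) *: h0 q + ce (zm a z q) *: h1 q)).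

Lemma expint_qc0 c : expint (fun q => wt a q * qc c (h0 q)).
Proof.
apply: expint_le ler01 _ _ eh0.
  by apply: measurable_funM; [exact: measurable_wt|exact: (measurable_qcP h0).1].
move=> q; rewrite mul1r !normrM ler_wpM2l// normr_id; exact: qc_le_norm.
Qed.

Lemma expint_qc1 c : expint (fun q => wt a q * qc c (h1 q)).
Proof.
apply: expint_le ler01 _ _ eh1.
  by apply: measurable_funM; [exact: measurable_wt|exact: (measurable_qcP h1).1].
move=> q; rewrite mul1r !normrM ler_wpM2l// normr_id; exact: qc_le_norm.
Qed.

Let int0 c (k : P2 -> R) (C : R) : measurable_fun setT k ->
  (forall q, `|k q| <= expR (C * l1 q)) ->
  leb2.-integrable setT (EFin \o (fun q => k q * (wt a q * qc c (h0 q)))).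
Proof.
move=> mk kC; apply: (expint_integrable ler01 (expint_qc0 c) mk (C := C)) => q.
by rewrite mul1r.
Qed.

Let int1 c (k : P2 -> R) (C : R) : measurable_fun setT k ->
  (forall q, `|k q| <= expR (C * l1 q)) ->
  leb2.-integrable setT (EFin \o (fun q => k q * (wt a q * qc c (h1 q)))).
Proof.
move=> mk kC; apply: (expint_integrable ler01 (expint_qc1 c) mk (C := C)) => q.
by rewrite mul1r.
Qed.

Let int2 c (k k' : P2 -> R) (C B : R) : measurable_fun setT k -> measurable_fun setT k' ->
  (forall q, `|k q| <= expR (C * l1 q)) -> (forall q, `|k' q| <= expR (C * l1 q)) ->
  leb2.-integrable setT (EFin \o (fun q => qc c ((B * wt a q) *: (k q *: h0 q + k' q *: h1 q)))).
Proof.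
move=> mk mk' kC kC'.
have := integrableD measurableT (int0 c mk kC) (int1 c mk' kC').
move=> /(integrableZl measurableT B).
apply: eq_integrable => // q _ /=.
by rewrite -EFinD -EFinM qcZ qcD !qcZ; congr EFin; ring.
Qed.

Hypotheses (even0 : forall q, h0 (refl q) = h0 q) (odd1 : forall q, h1 (refl q) = - h1 q).

(** The lower half plane is folded onto the upper one. By the parities of [h0] and [h1], [k]
    contributes its even part and [k'] its odd part, which turn exponentials into the kernel
    sums. *)
Let proj_upper (k k' m m' : P2 -> R) (C : R) c :
  measurable_fun setT k -> measurable_fun setT k' ->
  measurable_fun setT m -> measurable_fun setT m' ->
  (forall q, `|k q| <= expR (C * l1 q)) -> (forall q, `|k' q| <= expR (C * l1 q)) ->
  (forall q, `|m q| <= expR (C * l1 q)) -> (forall q, `|m' q| <= expR (C * l1 q)) ->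
  (forall q, k q + k (refl q) = 2 * m q) ->
  (forall q, k' q - k' (refl q) = 2 * m' q) ->
  \int[leb2]_q qc c ((a / pi * wt a q) *: (k q *: h0 q + k' q *: h1 q)) =
  \int[leb2]_(q in upper) qc c ((2 * a / pi * wt a q) *: (m q *: h0 q + m' q *: h1 q)).
Proof.
move=> mk mk' mm mm' kC kC' mC mC' km km'.
have mU := @measurable_upper R.
have iF := int2 c (a / pi) mk mk' kC kC'.
rewrite (Rintegral_upper iF) -RintegralD//; last 2 first.
- exact: integrableS iF.
- apply: (@integrableS _ _ _ _ setT) => //.
  case/integrableP: (iF) => mF Fy.
  apply/integrableP; split.
    exact: (measurableT_comp mF measurable_refl).
  apply: le_lt_trans Fy.
  have := leb2_refl (f := abse \o (EFin \o (fun q => qc c ((a / pi * wt a q) *: (k q *: h0 q + k' q *: h1 q)))))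
     (measurableT_comp (@abse_measurable _ _) mF).
  by rewrite /= => ->.
apply: eq_Rintegral => q _; rewrite even0 odd1.
have -> : wt a (refl q) = wt a q by rewrite /wt /refl /= sqrrN.
rewrite !qcZ !qcD !qcZ qcN; set A := qc c (h0 q); set B := qc c (h1 q).
transitivity (a / pi * wt a q * ((k q + k (refl q)) * A + (k' q - k' (refl q)) * B)).
  by ring.
by rewrite km km'; ring.
Qed.

Lemma zm_refl p q : zm a p (refl q) = zp a p q.
Proof. by rewrite /zm /zp /refl /=; congr (_, _); ring. Qed.

(** The sphere average removes every term in which [J] survives; the rest is an integral over the
    upper half plane, unfolded to the plane by [proj_upper]. *)
Lemma fock_projE I p : imag_unit I ->
  fock_proj a (from_stem (h0, h1)) (slice_pt I p) = proj0 p + I * proj1 p.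
Proof.
move=> hI.
have mU := @measurable_upper R.
have [me mse mep msep] := measurable_kE a p.
have [mcc msc mcs mss] := measurable_k a p.
have kb q := k_le p q a0.
pose A0 q := (2 * a / pi * wt a q) *: (kcc a p q *: h0 q + kcs a p q *: h1 q).
pose A1 q := (2 * a / pi * wt a q) *: (ksc a p q *: h0 q + kss a p q *: h1 q).
pose s q : H := kcc a p q *: 1 + ksc a p q *: I.
pose t q : H := kcs a p q *: 1 + kss a p q *: I.
(* [L] collects the terms containing [J] once. In [A0] and [A1] it is either absent or squared to
   -1. *)
pose L q (J : H) := (2 * a / pi * wt a q) *: (s q * (J * h1 q) - t q * (J * h0 q)).
(* The 4 counts the terms of the kernel, each bounded by the same exponential. *)
pose b q := 4 * (2 * a / pi) * (expR (a * l1 p * l1 q) * (wt a q * `|h0 q| + wt a q * `|h1 q|)).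
have c0 : 0 <= 2 * a / pi by rewrite divr_ge0 ?pi_ge0// mulr_ge0// ltW.
have b0 q : 0 <= b q.
  apply: mulr_ge0; first by rewrite mulr_ge0.
  apply: mulr_ge0; first exact: expR_ge0.
  by apply: addr_ge0; apply: mulr_ge0 => //; exact: wt_ge0.
have iA0 : qintegrable leb2 upper A0.
  move=> c; apply: (@integrableS _ _ _ _ setT) => //.
  by apply: (@int2 c _ _ (a * l1 p)) => // q; have [] := kb q.
have iA1 : qintegrable leb2 upper A1.
  move=> c; apply: (@integrableS _ _ _ _ setT) => //.
  by apply: (@int2 c _ _ (a * l1 p)) => // q; have [] := kb q.
have mh : measurable_fun setT (from_stem (h0, h1)) by exact: measurable_from_stem.
have PhiE q J : upper q -> imag_unit J ->
    fock_weight a (slice_pt J q) *: (fock_kernel a (slice_pt I p) (slice_pt J q) *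
       from_stem (h0, h1) (slice_pt J q)) = (A0 q + I * A1 q) + L q J.
  move=> uq hJ; rewrite fock_weight_pt// fock_kernelE// from_stem_pt//= /A0 /A1 /L /s /t.
  rewrite -scalerAr -!scalerDr; congr (_ *: _).
  rewrite !mulrDr !mulrDl !mulNr -!scalerAl -!scalerAr !mul1r.
  rewrite !mulrA (_ : I * J * J = - I); last by rewrite -mulrA imag_unitM// mulrN1.
  rewrite imag_unitM// mulN1r !scalerN mulNr scalerN !opprK.
  move: (kcc a p q *: h0 q) (ksc a p q *: (I * h0 q)) (kcs a p q *: (J * h0 q))
    (kss a p q *: (I * J * h0 q)) (kcc a p q *: (J * h1 q))
    (ksc a p q *: (I * J * h1 q)) (kcs a p q *: h1 q) (kss a p q *: (I * h1 q)).
  move=> x1 x2 x3 x4 x5 x6 x7 x8.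
  by apply: qcP => c; rewrite !(qcD, qcN, qcB); ring.
rewrite /fock_proj (@qintegral_dV _ _ (fun q => A0 q + I * A1 q) L b).
- rewrite qintegralD//; last exact: qintegrableMl.
  rewrite qintegralMl//; congr (_ + I * _); apply: qcP => c; rewrite !qc_qintegral.
  + symmetry; apply: etrans (@proj_upper (fun q => ce (zm a p q)) (fun q => - se (zm a p q))
      (kcc a p) (kcs a p) (a * l1 p) c _ _ _ _ _ _ _ _ _ _) => //.
    * by apply: eq_Rintegral => q _; rewrite scaleNr.
    * exact: measurable_funN.
    * by move=> q; exact: cem_le.
    * by move=> q; rewrite normrN; exact: sem_le.
    * by move=> q; have [] := kb q.
    * by move=> q; have [] := kb q.
    * by move=> q; rewrite zm_refl /kcc; field.
    * by move=> q; rewrite zm_refl /kcs; field.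
  + symmetry; apply: etrans (@proj_upper (fun q => se (zm a p q)) (fun q => ce (zm a p q))
      (ksc a p) (kss a p) (a * l1 p) c _ _ _ _ _ _ _ _ _ _) => //.
    * by move=> q; exact: sem_le.
    * by move=> q; exact: cem_le.
    * by move=> q; have [] := kb q.
    * by move=> q; have [] := kb q.
    * by move=> q; rewrite zm_refl /ksc; field.
    * by move=> q; rewrite zm_refl /kss; field.
- apply: measurable_qZ; first exact: measurable_fock_weight.
  by apply: measurable_qM => //; exact: measurable_fock_kernel.
- have mc : measurable_fun setT (fun q : P2 => 2 * a / pi * wt a q).
    by apply: measurable_funM => //; exact: measurable_wt.
  apply: measurable_qD; last apply: measurable_qM => //.
    by apply: measurable_qZ => //; apply: measurable_qD; apply: measurable_qZ.
  by apply: measurable_qZ => //; apply: measurable_qD; apply: measurable_qZ.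
- have mw := @measurable_wt a.
  apply: measurable_funM => //; apply: measurable_funM; first exact: measurable_el1.
  by apply: measurable_funD; apply: measurable_funM => //; exact: measurable_qnorm.
- exact: b0.
- move=> q x y; rewrite /L -scalerDr; congr (_ *: _).
  by rewrite !(mulrDl x y) (mulrDr (s q)) (mulrDr (t q)) opprD addrACA.
- move=> q c x; rewrite /L [RHS]scalerA (mulrC c) -(scalerA _ c); congr (_ *: _).
  by rewrite [RHS]scalerBr -!(scalerAl c x) -(scalerAr c (s q)) -(scalerAr c (t q)).
- by move=> q J uq hJ; exact: PhiE.
- move=> q J uq hJ; rewrite fock_weight_pt// fock_kernelE// from_stem_pt//= normrZ.
  rewrite ger0_norm; last by rewrite mulr_ge0 ?wt_ge0.
  rewrite qnormM.
  have [k1 k2 k3 k4] := kb q; set E := expR _ in k1 k2 k3 k4.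
  have nK : `|kcc a p q *: 1 + ksc a p q *: I - kcs a p q *: J - kss a p q *: (I * J)| <= 4 * E.
    apply: le_trans (ler_normB _ _) _; apply: le_trans (lerD (ler_normB _ _) (lexx _)) _.
    apply: le_trans (lerD (lerD (ler_normD _ _) (lexx _)) (lexx _)) _.
    rewrite (normrZ _ (1 : H)) (normrZ _ I) (normrZ _ J) (normrZ _ (I * J)).
    rewrite qnormM (imag_unit_norm hI) (imag_unit_norm hJ) qnorm1 !mulr1; lra.
  have nh : `|h0 q + J * h1 q| <= `|h0 q| + `|h1 q|.
    by apply: le_trans (ler_normD _ _) _; rewrite qnormM (imag_unit_norm hJ) mul1r.
  have -> : b q = 2 * a / pi * wt a q * (4 * E * (`|h0 q| + `|h1 q|)) by rewrite /b -/E; ring.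
  apply: ler_wpM2l; first by rewrite mulr_ge0 ?wt_ge0.
  exact: ler_pM.
- have es := expintD eh0 eh1; have [ms Fs] := es.
  have sE q : `|wt a q * `|h0 q| + wt a q * `|h1 q| | = wt a q * `|h0 q| + wt a q * `|h1 q|.
    by rewrite ger0_norm// addr_ge0// mulr_ge0// wt_ge0.
  apply: (@le_lt_trans _ _ (\int[leb2]_q (b q)%:E)%E).
    apply: ge0_subset_integral => //.
    + apply/measurable_EFinP; apply: measurable_funM => //.
      by apply: measurable_funM; [exact: measurable_el1|exact: ms].
    + by move=> q _; rewrite lee_fin b0.
  rewrite ge0_integralZR//.
  + apply: lte_mul_pinfty => //; first by rewrite lee_fin mulr_ge0.
    apply: le_lt_trans (Fs (a * l1 p)); apply: ge0_le_integralR => //.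
    * by apply: measurable_funM; [exact: measurable_el1|exact: ms].
    * by apply: measurable_funM; [exact: measurable_el1|exact: measurableT_comp ms].
    * move=> q; apply: mulr_ge0; first exact: expR_ge0.
      by apply: addr_ge0; apply: mulr_ge0 => //; exact: wt_ge0.
    * by move=> q _; rewrite sE.
  + by apply: measurable_funM; [exact: measurable_el1|exact: ms].
  + by rewrite mulr_ge0.
  + move=> q; apply: mulr_ge0; first exact: expR_ge0.
    by apply: addr_ge0; apply: mulr_ge0 => //; exact: wt_ge0.
Qed.

Let leb2_refl_qc (F : P2 -> H) c : measurable_fun setT F ->
  \int[leb2]_q qc c (F (refl q)) = \int[leb2]_q qc c (F q).
Proof.
move=> mF; rewrite /Rintegral; congr fine.
apply: (@leb2_refl _ (fun q => (qc c (F q))%:E)).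
by apply/measurable_EFinP; exact: (measurable_qcP F).1.
Qed.

Let wt_refl q : wt a (refl q) = wt a q.
Proof. by rewrite /wt /refl /= sqrrN. Qed.

Let zm_refl2 p q : zm a (refl p) (refl q) = ((zm a p q).1, - (zm a p q).2).
Proof. by rewrite /zm /refl /=; congr (_, _); ring. Qed.

Lemma proj0_even p : proj0 (refl p) = proj0 p.
Proof.
have [me mse _ _] := measurable_kE a (refl p).
apply: qcP => c; rewrite !qc_qintegral -leb2_refl_qc; last first.
  apply: measurable_qZ; first by apply: measurable_funM => //; exact: measurable_wt.
  by apply: measurable_qB; apply: measurable_qZ.
apply: eq_Rintegral => q _; rewrite even0 odd1 wt_refl zm_refl2.
by rewrite /ce /se /= cosN sinN mulrN scaleNr scalerN opprK.
Qed.

Lemma proj1_odd p : proj1 (refl p) = - proj1 p.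
Proof.
have [me mse _ _] := measurable_kE a (refl p).
have [me' mse' _ _] := measurable_kE a p.
apply: qcP => c; rewrite qcN !qc_qintegral -leb2_refl_qc; last first.
  apply: measurable_qZ; first by apply: measurable_funM => //; exact: measurable_wt.
  by apply: measurable_qD; apply: measurable_qZ.
rewrite -mulN1r -RintegralZl//.
  apply: eq_Rintegral => q _; rewrite even0 odd1 wt_refl zm_refl2 mulN1r -qcN.
  by rewrite /ce /se /= cosN sinN mulrN scaleNr scalerN -opprD scalerN.
apply: (@int2 c _ _ (a * l1 p)) => // q; [exact: sem_le|exact: cem_le].
Qed.

End formula.
End projection.

(** * Integrals depending on a point of the plane *)

Section parameter_integrals.
Context {R : realType}.
Local Notation mR := (measurableTypeR R).
Local Notation P2 := (mR * mR)%type.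
Implicit Types (z p : R * R) (q : P2) (phi : P2 -> R).

(** The exponential rate in [q] depends on [z] only through [l1 z], so one integrable function
    dominates the kernel while [z] stays bounded. *)
Definition exp_kernel (A B D : R) (k : R * R -> P2 -> R) :=
  (forall z, measurable_fun setT (k z)) /\
  forall z q, `|k z q| <= A * expR ((B * l1 z + D) * l1 q).

Definition pint (k : R * R -> P2 -> R) phi z := \int[leb2]_q (k z q * phi q).

Section lemmas.
Variables (A B D : R) (k kx ky : R * R -> P2 -> R) (phi : P2 -> R).
Hypotheses (A0 : 0 <= A) (B0 : 0 <= B).
Hypotheses (hk : exp_kernel A B D k) (hkx : exp_kernel A B D kx) (hky : exp_kernel A B D ky).
Hypothesis hC1 : forall q, has_C1 (k ^~ q) (kx ^~ q) (ky ^~ q).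
Hypothesis ephi : expint phi.

Lemma exp_kernel_integrable (k' : R * R -> P2 -> R) z : exp_kernel A B D k' ->
  leb2.-integrable setT (EFin \o (fun q => k' z q * phi q)).
Proof. by move=> [mk' bk']; exact: (expint_integrable A0 ephi (mk' z) (bk' z)). Qed.

Let G (r : R) q := A * expR ((B * r + D) * l1 q) * `|phi q|.

Let G0 r q : 0 <= G r q. Proof. by rewrite /G !mulr_ge0 ?expR_ge0. Qed.

Let mG r : measurable_fun setT (G r).
Proof.
have [mphi _] := ephi; apply: measurable_funM; last by mfun.
by mfun; exact: measurable_l1.
Qed.

Let iG r : leb2.-integrable setT (EFin \o G r).
Proof.
have [mphi _] := ephi.
apply: (expint_integrable A0 (expint_le ler01 _ _ ephi)) => //.
- by mfun.
- by move=> q; rewrite mul1r normr_id.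
- by mfun; exact: measurable_l1.
- by move=> q; rewrite ger0_norm// mulr_ge0 ?expR_ge0.
Qed.

Let bound (k' : R * R -> P2 -> R) z q (r : R) : exp_kernel A B D k' -> l1 z <= r ->
  `|k' z q * phi q| <= G r q.
Proof.
move=> [_ bk'] zr; rewrite normrM ler_wpM2r//; apply: le_trans (bk' z q) _.
by rewrite ler_wpM2l// ler_expR ler_wpM2r ?l1_ge0// lerD2r ler_wpM2l.
Qed.

Lemma pint_dx (x y : R) : is_derive x 1 (fun t => pint k phi (t, y)) (pint kx phi (x, y)).
Proof.
pose f t q := k (t, y) q * phi q.
(* Bounds [l1 (t, y)] on the whole interval of radius 1 around [x], so that [G r] dominates
   there. *)
pose r := `|x| + 1 + `|y|.
have Ix : `]x - 1, x + 1[%classic x by rewrite /= in_itv /=; apply/andP; split; lra.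
have iF t : `]x - 1, x + 1[%classic t -> leb2.-integrable setT (EFin \o f t).
  by move=> _; exact: exp_kernel_integrable.
have d1 (t : R) q : is_derive t 1 (f ^~ q) (kx (t, y) q * phi q).
  have [h _ _ _] := hC1 q; have h' := h t y.
  by apply: is_derive_eq; rewrite /GRing.scale /=; ring.
have der1 t q : `]x - 1, x + 1[%classic t -> setT q -> derivable (f ^~ q) t 1.
  by move=> _ _; exact: (@ex_derive _ _ _ _ _ _ _ (d1 t q)).
have pE t q : partial1of2 f t q = kx (t, y) q * phi q.
  by rewrite partial1of2E; exact: (@derive_val _ _ _ _ _ _ _ (d1 t q)).
have Gub t q : `]x - 1, x + 1[%classic t -> setT q -> `|partial1of2 f t q| <= G r q.
  rewrite /= in_itv /= => /andP[t1 t2] _; rewrite pE; apply: bound => //.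
  rewrite /l1 /r /= lerD2r; have := ler_normD x (t - x).
  rewrite addrC subrK => h; apply: (le_trans h); rewrite lerD2l.
  by rewrite ler_norml; apply/andP; split; lra.
apply: DeriveDef.
  exact: (derivable_under_integral measurableT Ix iF der1 (G0 r) (iG r) Gub).
rewrite -derive1E.
rewrite [LHS](differentiation_under_integral measurableT Ix iF der1 (G0 r) (iG r) Gub).
by apply: eq_Rintegral => q _; exact: pE.
Qed.

Lemma pint_dy (x y : R) : is_derive y 1 (fun t => pint k phi (x, t)) (pint ky phi (x, y)).
Proof.
pose f t q := k (x, t) q * phi q.
pose r := `|x| + (`|y| + 1).
have Ix : `]y - 1, y + 1[%classic y by rewrite /= in_itv /=; apply/andP; split; lra.
have iF t : `]y - 1, y + 1[%classic t -> leb2.-integrable setT (EFin \o f t).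
  by move=> _; exact: exp_kernel_integrable.
have d1 (t : R) q : is_derive t 1 (f ^~ q) (ky (x, t) q * phi q).
  have [_ h _ _] := hC1 q; have h' := h x t.
  by apply: is_derive_eq; rewrite /GRing.scale /=; ring.
have der1 t q : `]y - 1, y + 1[%classic t -> setT q -> derivable (f ^~ q) t 1.
  by move=> _ _; exact: (@ex_derive _ _ _ _ _ _ _ (d1 t q)).
have pE t q : partial1of2 f t q = ky (x, t) q * phi q.
  by rewrite partial1of2E; exact: (@derive_val _ _ _ _ _ _ _ (d1 t q)).
have Gub t q : `]y - 1, y + 1[%classic t -> setT q -> `|partial1of2 f t q| <= G r q.
  rewrite /= in_itv /= => /andP[t1 t2] _; rewrite pE; apply: bound => //.
  rewrite /l1 /r /= lerD2l; have := ler_normD y (t - y).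
  rewrite [y + _]addrC subrK => h; apply: (le_trans h); rewrite lerD2l.
  by rewrite ler_norml; apply/andP; split; lra.
apply: DeriveDef.
  exact: (derivable_under_integral measurableT Ix iF der1 (G0 r) (iG r) Gub).
rewrite -derive1E.
rewrite [LHS](differentiation_under_integral measurableT Ix iF der1 (G0 r) (iG r) Gub).
by apply: eq_Rintegral => q _; exact: pE.
Qed.

(** The mean value theorem along the segment between the two points bounds the increment by (|d1| +
    |d2|) times an integrable function. *)
Lemma pint_continuous : continuous (pint k phi).
Proof.
apply/continuous2P => p e e0.
(* Each coordinate moves by at most 1 along the segment. *)
pose r := l1 p + 2.
pose M := \int[leb2]_q G r q.
have M0 : 0 <= M by apply: Rintegral_ge0 => q _.
have M1 : 0 < M + 1 by rewrite ltr_pwDr.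
exists (Num.min 1 (e / (M + 1) / 2)) => [|p']; first by rewrite lt_min ltr01 !divr_gt0.
rewrite !lt_min => /andP[h1 h1'] /andP[h2 h2'].
set d1 := p'.1 - p.1 in h1 h1'; set d2 := p'.2 - p.2 in h2 h2'.
have dd : `|d1| + `|d2| < e / (M + 1) by have := ltrD h1' h2'; rewrite -splitr.
have key q : `|(k p' q - k p q) * phi q| <= (`|d1| + `|d2|) * G r q.
  have [c c01] := MVT_abs 0 1 (fun t => @C1_line R _ _ _ p d1 d2 t (hC1 q)).
  rewrite !subr0 normr1 in c01.
  rewrite !mul1r !mul0r !addr0 /d1 /d2 ![_ + (_ - _)]addrC !subrK -!surjective_pairing.
  rewrite subr0 mulr1 -/d1 -/d2 => ->.
  set z := (_, _); have lz : l1 z <= r.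
    rewrite /l1 /r /z /=.
    have n1 : `|p.1 + c * d1| <= `|p.1| + 1.
      apply: le_trans (ler_normD _ _) _; rewrite lerD2l normrM.
      rewrite -[leRHS]mulr1; apply: ler_pM => //; exact: ltW.
    have n2 : `|p.2 + c * d2| <= `|p.2| + 1.
      apply: le_trans (ler_normD _ _) _; rewrite lerD2l normrM.
      rewrite -[leRHS]mulr1; apply: ler_pM => //; exact: ltW.
    by rewrite /l1; lra.
  rewrite mulrDl -!mulrA; apply: le_trans (ler_normD _ _) _.
  rewrite !(normrM d1) !(normrM d2) mulrDl; apply: lerD; rewrite ler_wpM2l//; exact: bound.
have ik z := exp_kernel_integrable z hk.
rewrite /pint -RintegralB// -lte_fin.
have [mk _] := hk; have [mphi _] := ephi.
apply: le_lt_trans (le_normr_RintegralE _ _ _) _ => //.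
  by apply: measurable_funB; exact: measurable_funM.
apply: (@le_lt_trans _ _ (\int[leb2]_q ((`|d1| + `|d2|) * G r q)%:E)%E).
  apply: ge0_le_integralR => //.
  - by apply: measurableT_comp => //; apply: measurable_funB; exact: measurable_funM.
  - exact: measurable_funM.
  - by move=> q _; rewrite -mulrBl key.
rewrite ge0_integralZR// -[X in (_ * X)%E]fineK; last exact: integrable_fin_num (iG r).
rewrite -EFinM lte_fin -/(Rintegral _ _ _) -/M.
apply: (@le_lt_trans _ _ ((`|d1| + `|d2|) * (M + 1))); first by rewrite ler_wpM2l// lerDl.
by rewrite -ltr_pdivlMr.
Qed.

End lemmas.

End parameter_integrals.

(** * Slice regularity read on the four real coordinates *)

Section slice_regularity.
Context {R : realType}.
Local Notation H := (quat R).
Implicit Types (F : R * R -> H) (p : R * R) (c : qcoord).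

Definition qmk (d : qcoord -> R) : H := Quat (d Cre) (d Ci) (d Cj) (d Ck).

Lemma qc_mk c d : qc c (qmk d) = d c. Proof. by case: c. Qed.

Lemma continuous_qc c : continuous (@qc R c).
Proof.
move=> q; have FF : Filter (nbhs q) := nbhs_filter q.
apply/cvgrPdist_lt => e e0.
have /cvgrPdist_lt/(_ e e0) : id x @[x --> q] --> q by exact: cvg_id.
apply: filterS => q' h; rewrite -qcB.
exact: le_lt_trans (qc_le_norm _ _) h.
Qed.

Lemma continuous_coords F : (forall c, continuous (fun p => qc c (F p))) -> continuous F.
Proof.
move=> h; have -> : F = fun p => qc Cre (F p) *: qe Cre + qc Ci (F p) *: qe Ci +
    qc Cj (F p) *: qe Cj + qc Ck (F p) *: qe Ck.
  by apply/funext => p; exact: qdecomp.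
move=> p.
apply: cvgD; last exact: cvgZr_tmp (h Ck p).
apply: cvgD; last exact: cvgZr_tmp (h Cj p).
by apply: cvgD; [exact: cvgZr_tmp (h Cre p)|exact: cvgZr_tmp (h Ci p)].
Qed.

Lemma is_derive_coords F p (v : R * R) (ux uy : qcoord -> R * R -> R) :
  (forall c, has_C1 (fun p => qc c (F p)) (ux c) (uy c)) ->
  is_derive p v F (qmk (fun c => v.1 * ux c p + v.2 * uy c p)).
Proof.
move=> h; apply: is_derive_eps => e e0.
pose L := `|v.1| + `|v.2| + 1; have L0 : 0 < L by rewrite ltr_pwDr// addr_ge0.
(* The 4 shares [e] among the coordinates, and [L] accounts for the length of the direction. *)
have eL : 0 < e / (4 * L) by rewrite divr_gt0// mulr_gt0.
have H c := C1_estimate p (h c) eL.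
have [d0 d00 H0] := H Cre; have [d1 d10 H1] := H Ci.
have [d2 d20 H2] := H Cj; have [d3 d30 H3] := H Ck.
pose d := Num.min (Num.min d0 d1) (Num.min d2 d3).
have dpos : 0 < d by rewrite !lt_min d00 d10 d20 d30.
exists (d / L) => [|t]; first exact: divr_gt0.
rewrite ltr_pdivlMr// => td.
have small (s : R) : `|s| <= L -> `|t * s| < d.
  by move=> sL; rewrite normrM; apply: le_lt_trans td; rewrite ler_wpM2l.
have v1 : `|v.1| <= L by rewrite /L; have : 0 <= `|v.2| by []; lra.
have v2 : `|v.2| <= L by rewrite /L; have : 0 <= `|v.1| by []; lra.
have := small _ v1; have := small _ v2; rewrite !lt_min => /andP[/andP[b0 b1] /andP[b2 b3]].
move=> /andP[/andP[a0 a1] /andP[a2 a3]].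
set E := _ - _ - _.
have Ec c : qc c E = qc c (F (p.1 + t * v.1, p.2 + t * v.2)) - qc c (F p) -
    (t * v.1 * ux c p + t * v.2 * uy c p).
  rewrite /E !qcB qcZ qc_mk; congr (qc c (F _) - _ - _).
  ring.
have small4 c : `|qc c E| <= e / (4 * L) * (`|t * v.1| + `|t * v.2|).
  by rewrite Ec; case: c; [apply: H0|apply: H1|apply: H2|apply: H3].
apply: le_trans (qnorm_le_sum _) _.
have e1 : e / (4 * L) * (`|t * v.1| + `|t * v.2|) <= e * `|t| / 4.
  have -> : e / (4 * L) * (`|t * v.1| + `|t * v.2|) = e * `|t| / 4 * ((`|v.1| + `|v.2|) / L).
    by rewrite !normrM; field; rewrite gt_eqF.
  rewrite ler_piMr// ?divr_ge0 ?mulr_ge0 ?(ltW e0)// ler_pdivrMr// mul1r /L; lra.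
have := small4 Cre; have := small4 Ci; have := small4 Cj; have := small4 Ck.
lra.
Qed.

Lemma slice_regular_of_coords (F : (R * R -> H) * (R * R -> H)) (f : H -> H)
    (ux uy vx vy : qcoord -> R * R -> R) : is_stem F -> induced_by F f ->
  (forall c, has_C1 (fun p => qc c (F.1 p)) (ux c) (uy c)) ->
  (forall c, has_C1 (fun p => qc c (F.2 p)) (vx c) (vy c)) ->
  (forall c p, ux c p = vy c p) -> (forall c p, uy c p = - vx c p) ->
  slice_regular f.
Proof.
move=> sF iF h1 h2 cr1 cr2.
have D1 p v := is_derive_coords p v h1.
have D2 p v := is_derive_coords p v h2.
have E1 p v : 'D_v F.1 p = qmk (fun c => v.1 * ux c p + v.2 * uy c p).
  exact: (@derive_val _ _ _ _ _ _ _ (D1 p v)).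
have E2 p v : 'D_v F.2 p = qmk (fun c => v.1 * vx c p + v.2 * vy c p).
  exact: (@derive_val _ _ _ _ _ _ _ (D2 p v)).
exists F; split => //.
- move=> v _; split=> [p|]; first exact: (@ex_derive _ _ _ _ _ _ _ (D1 p v)).
  apply: continuous_coords => c; under eq_fun do rewrite E1 qc_mk.
  by have [_ _ c1 c2] := h1 c; apply: contD; apply: contM => //; exact: cst_continuous.
- move=> v _; split=> [p|]; first exact: (@ex_derive _ _ _ _ _ _ _ (D2 p v)).
  apply: continuous_coords => c; under eq_fun do rewrite E2 qc_mk.
  by have [_ _ c1 c2] := h2 c; apply: contD; apply: contM => //; exact: cst_continuous.
- move=> p; rewrite !E1 !E2; split; apply: qcP => c; rewrite ?qcB ?qcD !qc_mk qc0 /=.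
    by rewrite cr1; ring.
  by rewrite cr2; ring.
Qed.

Let partial_x F c p : derivable F p (1, 0) ->
  is_derive p.1 1 (fun t => qc c (F (t, p.2))) (qc c ('D_(1, 0) F p)).
Proof.
move=> dF.
suff cv : h^-1 *: (qc c (F (h *: 1 + p.1, p.2)) - qc c (F (p.1, p.2))) @[h --> (0:R)^'] -->
    qc c ('D_(1, 0) F p).
  by apply: DeriveDef; [apply/cvg_ex; eexists; exact: cv|apply: cvg_lim].
have dF' : (fun h : R => h^-1 *: ((F \o shift p) (h *: (1, 0)) - F p)) @ (0:R)^' --> 'D_(1, 0) F p.
  exact: dF.
have := cvg_comp _ _ dF' (@continuous_qc c ('D_(1, 0) F p)).
apply: cvg_trans; apply: near_eq_cvg; near=> h; rewrite /= qcZ qcB.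
rewrite -surjective_pairing /GRing.scale /=; congr (_ * (qc c (F _) - _)).
by case: p {dF dF'} => x y /=; congr (_, _); rewrite /= /GRing.scale /=; ring.
Unshelve. all: by end_near. Qed.

Let partial_y F c p : derivable F p (0, 1) ->
  is_derive p.2 1 (fun t => qc c (F (p.1, t))) (qc c ('D_(0, 1) F p)).
Proof.
move=> dF.
suff cv : h^-1 *: (qc c (F (p.1, h *: 1 + p.2)) - qc c (F (p.1, p.2))) @[h --> (0:R)^'] -->
    qc c ('D_(0, 1) F p).
  by apply: DeriveDef; [apply/cvg_ex; eexists; exact: cv|apply: cvg_lim].
have dF' : (fun h : R => h^-1 *: ((F \o shift p) (h *: (0, 1)) - F p)) @ (0:R)^' --> 'D_(0, 1) F p.
  exact: dF.
have := cvg_comp _ _ dF' (@continuous_qc c ('D_(0, 1) F p)).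
apply: cvg_trans; apply: near_eq_cvg; near=> h; rewrite /= qcZ qcB.
rewrite -surjective_pairing /GRing.scale /=; congr (_ * (qc c (F _) - _)).
by case: p {dF dF'} => x y /=; congr (_, _); rewrite /= /GRing.scale /=; ring.
Unshelve. all: by end_near. Qed.

Lemma C1_coords F c : continuously_differentiable F ->
  has_C1 (fun p => qc c (F p)) (fun p => qc c ('D_(1, 0) F p)) (fun p => qc c ('D_(0, 1) F p)).
Proof.
move=> h; have [dx cx] := h (1, 0) (or_introl erefl); have [dy cy] := h (0, 1) (or_intror erefl).
split.
- by move=> x y; exact: (@partial_x F c (x, y)).
- by move=> x y; exact: (@partial_y F c (x, y)).
- by move=> p; exact: (cvg_comp _ _ (cx p) (@continuous_qc c _)).
- by move=> p; exact: (cvg_comp _ _ (cy p) (@continuous_qc c _)).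
Qed.

(** Each pair of corresponding real coordinates of the two stem functions is a holomorphic function
    of class [C^1]; this is the form in which planar complex analysis is applied. *)
Definition CR_coords (F : (R * R -> H) * (R * R -> H)) := forall c : qcoord,
  exists ux uy vx vy : R * R -> R, [/\ has_C1 (fun p => qc c (F.1 p)) ux uy,
    has_C1 (fun p => qc c (F.2 p)) vx vy, forall p, ux p = vy p &
    forall p, uy p = - vx p].

Lemma slice_regular_of_CR (F : (R * R -> H) * (R * R -> H)) (f : H -> H) :
  is_stem F -> induced_by F f -> CR_coords F -> slice_regular f.
Proof.
move=> sF iF h.
pose T := ((R * R -> R) * (R * R -> R) * (R * R -> R) * (R * R -> R))%type.
have /choice[D hD] : forall c, exists D : T, [/\ has_C1 (fun p => qc c (F.1 p)) D.1.1.1 D.1.1.2,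
    has_C1 (fun p => qc c (F.2 p)) D.1.2 D.2, forall p, D.1.1.1 p = D.2 p &
    forall p, D.1.1.2 p = - D.1.2 p].
  by move=> c; have [ux [uy [vx [vy k]]]] := h c; exists (ux, uy, vx, vy).
apply: (slice_regular_of_coords sF iF (ux := fun c => (D c).1.1.1) (uy := fun c => (D c).1.1.2)
  (vx := fun c => (D c).1.2) (vy := fun c => (D c).2)) => c;
by have [] := hD c.
Qed.

Lemma slice_regular_coords (f : H -> H) : slice_regular f ->
  exists F : (R * R -> H) * (R * R -> H), [/\ is_stem F, induced_by F f & CR_coords F].
Proof.
move=> [F [sF iF c1 c2 cr]]; exists F; split => // c.
exists (fun p => qc c ('D_(1, 0) F.1 p)), (fun p => qc c ('D_(0, 1) F.1 p)),
  (fun p => qc c ('D_(1, 0) F.2 p)), (fun p => qc c ('D_(0, 1) F.2 p)).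
split; [exact: C1_coords|exact: C1_coords| |] => p; have [e1 e2] := cr p.
  by apply/eqP; rewrite -subr_eq0 -qcB; apply/eqP; rewrite e1 qc0.
by apply/eqP; rewrite -addr_eq0 -qcD; apply/eqP; rewrite e2 qc0.
Qed.

End slice_regularity.

Section C1_algebra.
Context {R : realType}.
Implicit Types u v : R * R -> R.

Lemma has_C1D u ux uy v vx vy : has_C1 u ux uy -> has_C1 v vx vy ->
  has_C1 (fun p => u p + v p) (fun p => ux p + vx p) (fun p => uy p + vy p).
Proof.
move=> [h1 h2 h3 h4] [k1 k2 k3 k4]; split.
- by move=> x y; exact: is_deriveD (h1 x y) (k1 x y).
- by move=> x y; exact: is_deriveD (h2 x y) (k2 x y).
- exact: contD.
- exact: contD.
Qed.

Lemma has_C1Z (a : R) u ux uy : has_C1 u ux uy ->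
  has_C1 (fun p => a * u p) (fun p => a * ux p) (fun p => a * uy p).
Proof.
move=> [h1 h2 h3 h4]; split.
- by move=> x y; exact: is_deriveZ (h1 x y).
- by move=> x y; exact: is_deriveZ (h2 x y).
- by apply: contM => //; exact: cst_continuous.
- by apply: contM => //; exact: cst_continuous.
Qed.

Lemma has_C1_eq u ux uy u' ux' uy' : has_C1 u ux uy -> u' =1 u -> ux' =1 ux -> uy' =1 uy ->
  has_C1 u' ux' uy'.
Proof. by move=> h /funext-> /funext-> /funext->. Qed.

Lemma has_C1B u ux uy v vx vy : has_C1 u ux uy -> has_C1 v vx vy ->
  has_C1 (fun p => u p - v p) (fun p => ux p - vx p) (fun p => uy p - vy p).
Proof.
move=> h /(has_C1Z (-1)) k; apply: has_C1_eq (has_C1D h k) _ _ _ => p;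
by rewrite mulN1r.
Qed.

(** All the exponents met below are real-linear in the variable of differentiation, so this and
    [has_C1_se_linear] cover every kernel. *)
Lemma has_C1_ce_linear (a b c d : R) :
  has_C1 (fun p => ce (a * p.1 + b * p.2, c * p.1 + d * p.2))
    (fun p => a * ce (a * p.1 + b * p.2, c * p.1 + d * p.2) -
      c * se (a * p.1 + b * p.2, c * p.1 + d * p.2))
    (fun p => b * ce (a * p.1 + b * p.2, c * p.1 + d * p.2) -
      d * se (a * p.1 + b * p.2, c * p.1 + d * p.2)).
Proof.
have L1 : continuous (fun p : R * R => a * p.1 + b * p.2).
  by apply: contD; apply: contM;
    [exact: cst_continuous|exact: cont_fst|exact: cst_continuous|exact: cont_snd].
have L2 : continuous (fun p : R * R => c * p.1 + d * p.2).
  by apply: contD; apply: contM;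
    [exact: cst_continuous|exact: cont_fst|exact: cst_continuous|exact: cont_snd].
have cE : continuous (fun p : R * R => ce (a * p.1 + b * p.2, c * p.1 + d * p.2)).
  by apply: contM; [apply: cont_comp L1; exact: continuous_expR|
    apply: cont_comp L2; exact: continuous_cos].
have sE : continuous (fun p : R * R => se (a * p.1 + b * p.2, c * p.1 + d * p.2)).
  by apply: contM; [apply: cont_comp L1; exact: continuous_expR|
    apply: cont_comp L2; exact: continuous_sin].
split.
- by move=> x y; rewrite /ce /se /=; apply: is_derive_eq; rewrite /GRing.scale /=; ring.
- by move=> x y; rewrite /ce /se /=; apply: is_derive_eq; rewrite /GRing.scale /=; ring.
- by apply: contB; apply: contM => //; exact: cst_continuous.
- by apply: contB; apply: contM => //; exact: cst_continuous.
Qed.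

Lemma has_C1_se_linear (a b c d : R) :
  has_C1 (fun p => se (a * p.1 + b * p.2, c * p.1 + d * p.2))
    (fun p => a * se (a * p.1 + b * p.2, c * p.1 + d * p.2) +
      c * ce (a * p.1 + b * p.2, c * p.1 + d * p.2))
    (fun p => b * se (a * p.1 + b * p.2, c * p.1 + d * p.2) +
      d * ce (a * p.1 + b * p.2, c * p.1 + d * p.2)).
Proof.
have L1 : continuous (fun p : R * R => a * p.1 + b * p.2).
  by apply: contD; apply: contM;
    [exact: cst_continuous|exact: cont_fst|exact: cst_continuous|exact: cont_snd].
have L2 : continuous (fun p : R * R => c * p.1 + d * p.2).
  by apply: contD; apply: contM;
    [exact: cst_continuous|exact: cont_fst|exact: cst_continuous|exact: cont_snd].
have cE : continuous (fun p : R * R => ce (a * p.1 + b * p.2, c * p.1 + d * p.2)).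
  by apply: contM; [apply: cont_comp L1; exact: continuous_expR|
    apply: cont_comp L2; exact: continuous_cos].
have sE : continuous (fun p : R * R => se (a * p.1 + b * p.2, c * p.1 + d * p.2)).
  by apply: contM; [apply: cont_comp L1; exact: continuous_expR|
    apply: cont_comp L2; exact: continuous_sin].
split.
- by move=> x y; rewrite /ce /se /=; apply: is_derive_eq; rewrite /GRing.scale /=; ring.
- by move=> x y; rewrite /ce /se /=; apply: is_derive_eq; rewrite /GRing.scale /=; ring.
- by apply: contD; apply: contM => //; exact: cst_continuous.
- by apply: contD; apply: contM => //; exact: cst_continuous.
Qed.

End C1_algebra.

(** * Slice regularity of the projection *)

Section projection_regular.
Context {R : realType}.
Local Notation H := (quat R).
Local Notation mR := (measurableTypeR R).
Local Notation P2 := (mR * mR)%type.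
Variable a : R.
Hypothesis a0 : 0 < a.

Let measurable_oppr' (u : P2 -> R) : measurable_fun setT u -> measurable_fun setT (fun q => - u q).
Proof. exact: measurableT_comp (@oppr_measurable R setT). Qed.

Let ke (z : R * R) (q : P2) := ce (zm a z q).
Let ks (z : R * R) (q : P2) := se (zm a z q).
(** [kA] and [kB] are the components of a q^bar exp (a z q^bar), the complex derivative of the
    kernel in [z]. *)
Let kA (z : R * R) (q : P2) := a * q.1 * ke z q + a * q.2 * ks z q.
Let kB (z : R * R) (q : P2) := a * q.1 * ks z q - a * q.2 * ke z q.

(** Two terms, each with a coefficient at most (1 + a) exp (l1 q): one more unit in the exponential
    rate absorbs the factor linear in [q]. *)
Let A := 2 * (1 + a).

Let expk (u v : P2 -> R) : measurable_fun setT u -> measurable_fun setT v ->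
  (forall q, `|u q| <= (1 + a) * expR (l1 q)) -> (forall q, `|v q| <= (1 + a) * expR (l1 q)) ->
  exp_kernel A a 1 (fun z q => u q * ke z q + v q * ks z q).
Proof.
move=> mu mv bu bv; split=> [z|z q].
  have [m1 m2 _ _] := measurable_kE a z.
  by apply: measurable_funD; exact: measurable_funM.
apply: le_trans (ler_normD _ _) _; rewrite (normrM (u q)) (normrM (v q)) mulrDl mul1r expRD /A.
have h1 : `|u q| * `|ke z q| <= _ := ler_pM (normr_ge0 _) (normr_ge0 _) (bu q) (cem_le z q a0).
have h2 : `|v q| * `|ks z q| <= _ := ler_pM (normr_ge0 _) (normr_ge0 _) (bv q) (sem_le z q a0).
apply: (le_trans (lerD h1 h2)).
by rewrite le_eqVlt; apply/orP; left; apply/eqP; ring.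
Qed.

Let b1 (q : P2) : `|1 : R| <= (1 + a) * expR (l1 q).
Proof.
rewrite normr1 -[leLHS]mulr1; apply: ler_pM => //; first by rewrite lerDl ltW.
by rewrite -expR0 ler_expR l1_ge0.
Qed.

Let b0 (q : P2) : `|0 : R| <= (1 + a) * expR (l1 q).
Proof. by rewrite normr0 mulr_ge0 ?expR_ge0// addr_ge0// ltW. Qed.

Let bl (q : P2) (s t : R) : `|s| = 1 -> `|t| <= l1 q -> `|s * (a * t)| <= (1 + a) * expR (l1 q).
Proof.
move=> s1 tl; rewrite !normrM s1 mul1r (gtr0_norm a0); apply: ler_pM => //; first exact: ltW.
  by rewrite lerDr.
by apply: le_trans tl _; have := expR_ge1Dx (l1 q); lra.
Qed.

Let b_1 (q : P2) : `|a * q.1| <= (1 + a) * expR (l1 q).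
Proof. by rewrite -[a * _]mul1r; apply: bl; rewrite ?normr1// /l1 lerDl. Qed.
Let b_2 (q : P2) : `|a * q.2| <= (1 + a) * expR (l1 q).
Proof. by rewrite -[a * _]mul1r; apply: bl; rewrite ?normr1// /l1 lerDr. Qed.
Let b_3 (q : P2) : `|- (a * q.2)| <= (1 + a) * expR (l1 q).
Proof. by rewrite normrN; exact: b_2. Qed.

Let m_1 : measurable_fun setT (fun q : P2 => a * q.1). Proof. by mfun. Qed.
Let m_2 : measurable_fun setT (fun q : P2 => a * q.2). Proof. by mfun. Qed.
Let m_3 : measurable_fun setT (fun q : P2 => - (a * q.2)).
Proof. exact: measurable_oppr'. Qed.

Let expe : exp_kernel A a 1 ke.
Proof.
have -> : ke = fun z q => 1 * ke z q + 0 * ks z q.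
  by apply/funext => z; apply/funext => q; rewrite mul1r mul0r addr0.
exact: expk.
Qed.
Let exps : exp_kernel A a 1 ks.
Proof.
have -> : ks = fun z q => 0 * ke z q + 1 * ks z q.
  by apply/funext => z; apply/funext => q; rewrite mul1r mul0r add0r.
exact: expk.
Qed.
Let expA : exp_kernel A a 1 kA. Proof. exact: expk. Qed.
Let expB : exp_kernel A a 1 kB.
Proof.
have -> : kB = fun z q => - (a * q.2) * ke z q + a * q.1 * ks z q.
  by apply/funext => z; apply/funext => q; rewrite /kB; ring.
exact: expk.
Qed.
Let expBN : exp_kernel A a 1 (fun z q => - kB z q).
Proof.
have [m b] := expB; split => [z|z q]; first exact: measurable_oppr'.
by rewrite normrN.
Qed.

Let C1e q : has_C1 (ke ^~ q) (kA ^~ q) (fun z => - kB z q).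
Proof.
apply: has_C1_eq (has_C1_ce_linear (a * q.1) (a * q.2) (- (a * q.2)) (a * q.1)) _ _ _ => p.
- by rewrite /ke /zm; congr ce; congr (_, _); ring.
- by rewrite /kA /ke /ks (_ : (_ , _) = zm a p q) 1?mulNr ?opprK// /zm; congr (_, _); ring.
- rewrite /kB /ke /ks (_ : (_ , _) = zm a p q); first by ring.
  by rewrite /zm; congr (_, _); ring.
Qed.

Let C1s q : has_C1 (ks ^~ q) (kB ^~ q) (kA ^~ q).
Proof.
apply: has_C1_eq (has_C1_se_linear (a * q.1) (a * q.2) (- (a * q.2)) (a * q.1)) _ _ _ => p.
- by rewrite /ks /zm; congr se; congr (_, _); ring.
- by rewrite /kB /ke /ks (_ : (_ , _) = zm a p q) 1?mulNr// /zm; congr (_, _); ring.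
- rewrite /kA /ke /ks (_ : (_ , _) = zm a p q); first by ring.
  by rewrite /zm; congr (_, _); ring.
Qed.

Let A0 : 0 <= A. Proof. by rewrite /A mulr_ge0// addr_ge0// ltW. Qed.

Let pintN phi z : expint phi -> pint (fun z q => - kB z q) phi z = - pint kB phi z.
Proof.
move=> e; rewrite /pint -mulN1r -RintegralZl//; last exact: exp_kernel_integrable expB.
by apply: eq_Rintegral => q _; rewrite mulN1r mulNr.
Qed.

Let expintM phi (u : P2 -> R) : measurable_fun setT u ->
  (forall q, `|u q| <= (1 + a) * expR (l1 q)) -> expint phi -> expint (fun q => u q * phi q).
Proof.
move=> mu bu [mphi hphi]; split; first exact: measurable_funM.
move=> C; have a1 : 0 <= 1 + a by rewrite addr_ge0// ltW.
have mE D : measurable_fun setT (fun q : P2 => expR (D * l1 q)) by mfun; exact: measurable_l1.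
apply: (@le_lt_trans _ _ (\int[leb2]_q ((1 + a) * (expR ((C + 1) * l1 q) * `|phi q|))%:E)%E).
  apply: ge0_le_integralR => //.
  - by apply: measurable_funM => //; apply: measurableT_comp => //; exact: measurable_funM.
  - by apply: measurable_funM => //; apply: measurable_funM => //; exact: measurableT_comp.
  - move=> q _; rewrite normrM (mulrDl C) mul1r expRD.
    have -> : (1 + a) * (expR (C * l1 q) * expR (l1 q) * `|phi q|) =
      expR (C * l1 q) * ((1 + a) * expR (l1 q) * `|phi q|) by ring.
    by rewrite ler_wpM2l ?expR_ge0// ler_wpM2r.
rewrite ge0_integralZR//.
- by rewrite lte_mul_pinfty ?lee_fin.
- by apply: measurable_funM => //; exact: measurableT_comp.
Qed.

Let cont_e phi : expint phi -> continuous (pint ke phi).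
Proof. by move=> e; exact: (pint_continuous A0 (ltW a0) expe expA expBN C1e e). Qed.

Let cont_s phi : expint phi -> continuous (pint ks phi).
Proof. by move=> e; exact: (pint_continuous A0 (ltW a0) exps expB expA C1s e). Qed.

(** The factors [u] and [v] do not involve [z], so they are moved into [phi]. Continuity of the
    derivatives thus reduces to that of the integrals of [ke] and [ks], without second
    derivatives. *)
Let pint2 (k : R * R -> P2 -> R) (u v : P2 -> R) phi : exp_kernel A a 1 k ->
  measurable_fun setT u -> measurable_fun setT v ->
  (forall q, `|u q| <= (1 + a) * expR (l1 q)) -> (forall q, `|v q| <= (1 + a) * expR (l1 q)) ->
  (forall z q, k z q = u q * ke z q + v q * ks z q) -> expint phi -> continuous (pint k phi).
Proof.
move=> _ mu mv bu bv kE e.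
have e1 := expintM mu bu e; have e2 := expintM mv bv e.
have -> : pint k phi = fun z => pint ke (fun q => u q * phi q) z + pint ks (fun q => v q * phi q) z.
  apply/funext => z; rewrite /pint -RintegralD//.
  - by apply: eq_Rintegral => q _; rewrite kE; ring.
  - exact: (exp_kernel_integrable A0 e1 z expe).
  - exact: (exp_kernel_integrable A0 e2 z exps).
by apply: contD; [exact: cont_e|exact: cont_s].
Qed.

Let cont_A phi : expint phi -> continuous (pint kA phi).
Proof. by move=> e; apply: (pint2 expA m_1 m_2 b_1 b_2 _ e) => z q. Qed.

Let cont_B phi : expint phi -> continuous (pint kB phi).
Proof.
move=> e; apply: (pint2 expB m_3 m_1 b_3 b_1 _ e) => z q.
by rewrite /kB mulNr addrC.
Qed.

Let C1pe phi : expint phi -> has_C1 (pint ke phi) (pint kA phi) (fun z => - pint kB phi z).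
Proof.
move=> e; have aa := ltW a0; split.
- exact: (pint_dx A0 aa expe expA C1e e).
- move=> x y; rewrite -pintN//; exact: (pint_dy A0 aa expe expBN C1e e).
- exact: cont_A.
- by apply: contN; exact: cont_B.
Qed.

Let C1ps phi : expint phi -> has_C1 (pint ks phi) (pint kB phi) (pint kA phi).
Proof.
move=> e; have aa := ltW a0; split.
- exact: (pint_dx A0 aa exps expB C1s e).
- exact: (pint_dy A0 aa exps expA C1s e).
- exact: cont_B.
- exact: cont_A.
Qed.

Variables h0 h1 : P2 -> H.
Hypotheses (mh0 : measurable_fun setT h0) (mh1 : measurable_fun setT h1).
Hypotheses (eh0 : expint (fun q => wt a q * `|h0 q|)).
Hypotheses (eh1 : expint (fun q => wt a q * `|h1 q|)).

Let phi0 c q := a / pi * (wt a q * qc c (h0 q)).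
Let phi1 c q := a / pi * (wt a q * qc c (h1 q)).

Let expintZ (b : R) phi : expint phi -> expint (fun q => b * phi q).
Proof.
move=> e; apply: (@expint_le _ `|b| phi) => //; last by move=> q; rewrite normrM.
by case: e => m _; mfun.
Qed.

Let e0 c : expint (phi0 c). Proof. by apply: expintZ; exact: expint_qc0. Qed.
Let e1 c : expint (phi1 c). Proof. by apply: expintZ; exact: expint_qc0 mh1 eh1 c. Qed.

Lemma qc_proj0 c z : qc c (proj0 a h0 h1 z) = pint ke (phi0 c) z - pint ks (phi1 c) z.
Proof.
rewrite /proj0 qc_qintegral /pint -RintegralB//.
- by apply: eq_Rintegral => q _; rewrite qcZ qcB !qcZ /phi0 /phi1 /ke /ks; ring.
- exact: (exp_kernel_integrable A0 (e0 c) z expe).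
- exact: (exp_kernel_integrable A0 (e1 c) z exps).
Qed.

Lemma qc_proj1 c z : qc c (proj1 a h0 h1 z) = pint ks (phi0 c) z + pint ke (phi1 c) z.
Proof.
rewrite /proj1 qc_qintegral /pint -RintegralD//.
- by apply: eq_Rintegral => q _; rewrite qcZ qcD !qcZ /phi0 /phi1 /ke /ks; ring.
- exact: (exp_kernel_integrable A0 (e0 c) z exps).
- exact: (exp_kernel_integrable A0 (e1 c) z expe).
Qed.

Lemma proj_CR : CR_coords (proj0 a h0 h1, proj1 a h0 h1).
Proof.
move=> c; exists (fun p => pint kA (phi0 c) p - pint kB (phi1 c) p),
  (fun p => - pint kB (phi0 c) p - pint kA (phi1 c) p),
  (fun p => pint kB (phi0 c) p + pint kA (phi1 c) p),
  (fun p => pint kA (phi0 c) p + - pint kB (phi1 c) p); split.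
- by apply: has_C1_eq (has_C1B (C1pe (e0 c)) (C1ps (e1 c))) (qc_proj0 c) _ _.
- by apply: has_C1_eq (has_C1D (C1ps (e0 c)) (C1pe (e1 c))) (qc_proj1 c) _ _.
- by [].
- by move=> p; rewrite opprD.
Qed.

Hypotheses (even0 : forall q, h0 (refl q) = h0 q) (odd1 : forall q, h1 (refl q) = - h1 q).

Lemma proj_is_stem : is_stem (proj0 a h0 h1, proj1 a h0 h1).
Proof. by move=> x y; split; 
  [exact: (proj0_even a mh0 mh1 even0 odd1 (x, y))|
   exact: (proj1_odd a0 mh0 mh1 eh0 eh1 even0 odd1 (x, y))]. Qed.

Lemma fock_proj_induced : induced_by (proj0 a h0 h1, proj1 a h0 h1) (fock_proj a (from_stem (h0, h1))).
Proof. by move=> I hI p; exact: fock_projE. Qed.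

End projection_regular.

(** * Point evaluation and Fock norms *)

Section point_evaluation.
Context {R : realType}.
Local Notation H := (quat R).
Local Notation mR := (measurableTypeR R).
Local Notation P2 := (mR * mR)%type.
Implicit Types (z p w : P2).

(** Cauchy-Schwarz for the measure with density [m], of mass at most [A]. The lower bound [X] keeps
    everything meaningful when the integrals are infinite. *)
Lemma integral_CS (m F : P2 -> R) (A X : R) : measurable_fun setT m -> measurable_fun setT F ->
  (forall w, 0 <= m w) -> (forall w, 0 <= F w) -> 0 < A ->
  (\int[leb2]_w (m w)%:E <= A%:E)%E -> (X%:E <= \int[leb2]_w (m w * F w)%:E)%E -> 0 <= X ->
  ((X ^+ 2)%:E <= A%:E * \int[leb2]_w (m w * F w ^+ 2)%:E)%E.
Proof.
move=> mm mF m0 F0 A0 mA XF X0.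
have mF2 : measurable_fun setT (fun w => m w * F w ^+ 2) by mfun.
have mF1 : measurable_fun setT (fun w => m w * F w) by mfun.
have B0 : (0 <= \int[leb2]_w (m w * F w ^+ 2)%:E)%E.
  by apply: integral_ge0 => w _; rewrite lee_fin mulr_ge0 ?sqr_ge0.
case BE : (\int[leb2]_w (m w * F w ^+ 2)%:E)%E B0 => [B||] B0; last 2 first.
  - by rewrite gt0_muley ?lte_fin ?leey.
  - by [].
move: B0.
rewrite lee_fin -EFinM lee_fin => B0.
have ti (t : R) : 0 < t -> 0 <= 2^-1 * t^-1 by move=> t0; rewrite mulr_ge0 ?invr_ge0 ?ltW.
have [->|Xn0] := eqVneq X 0; first by rewrite expr0n /= mulr_ge0// ltW.
have Xp : 0 < X by rewrite lt_def Xn0.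
(* In F <= t / 2 + F^2 / (2 t) this value gives X <= X / 2 + A B / (2 X), which is the claim. *)
pose t := X / A; have t0 : 0 < t by rewrite divr_gt0.
have : (X%:E <= (2^-1 * t * A + 2^-1 * t^-1 * B)%:E)%E.
  apply: (le_trans XF).
  apply: (@le_trans _ _ (\int[leb2]_w (2^-1 * t * m w + 2^-1 * t^-1 * (m w * F w ^+ 2))%:E)%E).
    apply: ge0_le_integralR => //; first by mfun.
    - by move=> w; rewrite mulr_ge0.
    - move=> w _; rewrite -subr_ge0.
      have -> : 2^-1 * t * m w + 2^-1 * t^-1 * (m w * F w ^+ 2) - m w * F w =
         m w * (2^-1 * t^-1) * (t - F w) ^+ 2.
        by field; rewrite gt_eqF.
      by apply: mulr_ge0; [apply: mulr_ge0 => //; exact: ti|exact: sqr_ge0].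
  rewrite ge0_integralDR//; [|by mfun|by mfun| |]; last 2 first.
  - by move=> w; apply: mulr_ge0 => //; rewrite mulr_ge0// ltW.
  - by move=> w; apply: mulr_ge0; [exact: ti|apply: mulr_ge0 => //; exact: sqr_ge0].
  have t2 : 0 <= 2^-1 * t by rewrite mulr_ge0 ?(ltW t0).
  rewrite (ge0_integralZR _ measurableT mm t2)// (ge0_integralZR _ measurableT mF2 (ti _ t0))//; last first.
    by move=> w; apply: mulr_ge0 => //; exact: sqr_ge0.
  rewrite BE EFinD (EFinM (2^-1 * t) A) (EFinM (2^-1 * t^-1) B); apply: leeD => //.
  by apply: lee_wpmul2l; rewrite // lee_fin.
rewrite lee_fin /t => h.
have e1 : 2^-1 * (X / A) * A + 2^-1 * (X / A)^-1 * B = 2^-1 * X + 2^-1 * (A * B / X).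
  by field; rewrite !gt_eqF.
move: h; rewrite e1 => h.
have : X <= A * B / X by lra.
by rewrite ler_pdivlMr// -expr2.
Qed.

Lemma has_C1M (u ux uy v vx vy : R * R -> R) : has_C1 u ux uy -> has_C1 v vx vy ->
  has_C1 (fun p => u p * v p) (fun p => ux p * v p + u p * vx p)
    (fun p => uy p * v p + u p * vy p).
Proof.
move=> hu hv; have cu := C1_continuous hu; have cv := C1_continuous hv.
have [h1 h2 h3 h4] := hu; have [k1 k2 k3 k4] := hv; split.
- move=> x y; have H1 := h1 x y; have H2 := k1 x y.
  by apply: is_derive_eq; rewrite /GRing.scale /=; ring.
- move=> x y; have H1 := h2 x y; have H2 := k2 x y.
  by apply: is_derive_eq; rewrite /GRing.scale /=; ring.
- by apply: contD; apply: contM.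
- by apply: contD; apply: contM.
Qed.

Variable a : R.
Hypothesis a0 : 0 < a.

(** The mean value bound is applied to u + i v times the holomorphic function p -> exp (- a p
    z^bar). The modulus of this factor times exp (a |z|^2 / 2) is exp (- a |p|^2 / 2) exp (a |p -
    z|^2 / 2), and |p - z|^2 <= 2 on the box. The weight is reproduced up to exp a, uniformly in
    [z]. *)
Let half_wt (u v ux uy vx vy : R * R -> R) (z : R * R) :
  has_C1 u ux uy -> has_C1 v vx vy -> (forall p, ux p = vy p) -> (forall p, uy p = - vx p) ->
  ((`|u z| * wt (a / 2) z)%:E <=
   (4 * expR a)%:E * \int[leb2]_p (bx 1 z p * ((`|u p| + `|v p|) * wt (a / 2) p))%:E)%E.
Proof.
move=> hu hv cr1 cr2.
have hc := has_C1_ce_linear (- a * z.1) (- a * z.2) (a * z.2) (- a * z.1).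
have hs := has_C1_se_linear (- a * z.1) (- a * z.2) (a * z.2) (- a * z.1).
have hA := has_C1B (has_C1M hu hc) (has_C1M hv hs).
have hB := has_C1D (has_C1M hu hs) (has_C1M hv hc).
pose L := fun p : R * R => (- a * z.1 * p.1 + - a * z.2 * p.2, a * z.2 * p.1 + - a * z.1 * p.2).
have h : (`|u z * ce (L z) - v z * se (L z)|%:E <=
    4%:E * \int[leb2]_p (bx 1 z p * `|u p * ce (L p) - v p * se (L p)|)%:E)%E.
  by apply: (CR_point_bound z hA hB) => p; rewrite cr1 cr2; ring.
have Lz : L z = (- a * (z.1 ^+ 2 + z.2 ^+ 2), 0) by rewrite /L; congr (_, _); ring.
move: h; rewrite Lz {1}/ce {1}/se /= cos0 sin0 !mulr0 subr0 mulr1 => h.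
have mu := continuous2_measurable (C1_continuous hu).
have mv := continuous2_measurable (C1_continuous hv).
have ww : wt (a / 2) z = expR (a / 2 * (z.1 ^+ 2 + z.2 ^+ 2)) * expR (- a * (z.1 ^+ 2 + z.2 ^+ 2)).
  by rewrite /wt -expRD; congr expR; field.
set E := expR (a / 2 * (z.1 ^+ 2 + z.2 ^+ 2)) in ww.
have E0 : 0 <= E by exact: expR_ge0.
have -> : `|u z| * wt (a / 2) z = E * `|u z * expR (- a * (z.1 ^+ 2 + z.2 ^+ 2))|.
  by rewrite ww normrM (ger0_norm (expR_ge0 _)); ring.
rewrite EFinM; apply: (le_trans (lee_wpmul2l _ h)); first by rewrite lee_fin.
rewrite muleA [(E%:E * _)%E]muleC -muleA EFinM -muleA; apply: lee_wpmul2l; first by rewrite lee_fin.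
have mA := continuous2_measurable (C1_continuous hA).
rewrite -!ge0_integralZR ?expR_ge0//; last 4 first.
- by apply: measurable_funM; [exact: measurable_bx|apply: measurable_funM; [mfun|exact: measurable_wt]].
- by move=> p; rewrite mulr_ge0 ?bx_ge0// mulr_ge0 ?wt_ge0// addr_ge0.
- by apply: measurable_funM; [exact: measurable_bx|apply: measurableT_comp mA].
- by move=> p; rewrite mulr_ge0 ?bx_ge0.
have mw := @measurable_wt R (a / 2); have mb := @measurable_bx R 1 z.
apply: ge0_le_integralR => //.
- apply: measurable_funM => //; apply: measurable_funM => //.
  by apply: measurableT_comp mA.
- by apply: measurable_funM => //; apply: measurable_funM => //; apply: measurable_funM => //; mfun.
- by move=> p; rewrite mulr_ge0// mulr_ge0 ?bx_ge0.
move=> p _; rewrite /bx indicE; case: (boolP (p \in _)) => [|_]; last by rewrite !mul0r !mulr0.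
rewrite inE => /in_boxE[d1 d2]; rewrite /= !mul1r.
have Lp : E * expR (L p).1 <= expR a * wt (a / 2) p.
  rewrite /E /wt -!expRD ler_expR /L /=.
  have sq (t : R) : `|t| < 1 -> t ^+ 2 <= 1.
    by move=> t1; rewrite -real_normK ?num_real// expr_le1// ltW.
  have := ler_wpM2l (ltW a0) (lerD (sq _ d1) (sq _ d2)).
  have -> : a / 2 * (z.1 ^+ 2 + z.2 ^+ 2) + (- a * z.1 * p.1 + - a * z.2 * p.2) =
    - (a / 2) * (p.1 ^+ 2 + p.2 ^+ 2) + (a * ((p.1 - z.1) ^+ 2 + (p.2 - z.2) ^+ 2)) / 2 by field.
  lra.
have uv0 : 0 <= `|u p| + `|v p| by rewrite addr_ge0.
apply: (@le_trans _ _ ((`|u p| + `|v p|) * (E * expR (L p).1))).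
  rewrite [leRHS]mulrCA ler_wpM2l// (mulrDl `|u p|); apply: le_trans (ler_normB _ _) _.
  by rewrite (normrM (u p)) (normrM (v p)) lerD// ler_wpM2l// ?ce_le ?se_le.
by rewrite [leRHS]mulrCA ler_wpM2l.
Qed.

(** The function G of the overview. Its square carries the full weight [wt a], and [fock_sqnorm_le]
    and [wsqn_le] compare its integral with the Fock norm. *)
Definition wsum (F : (R * R -> H) * (R * R -> H)) (z : P2) : R :=
  (`|F.1 z| + `|F.2 z|) * wt (a / 2) z.

Lemma wsum_ge0 F z : 0 <= wsum F z.
Proof. by rewrite mulr_ge0 ?wt_ge0// addr_ge0. Qed.

Variable F : (R * R -> H) * (R * R -> H).
Hypothesis hF : CR_coords F.

Lemma coords_measurable : measurable_fun setT (F.1 : P2 -> H) /\ measurable_fun setT (F.2 : P2 -> H).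
Proof.
split; apply/measurable_qcP => c; have [ux [uy [vx [vy [h1 h2 _ _]]]]] := hF c.
  exact: continuous2_measurable (C1_continuous h1).
exact: continuous2_measurable (C1_continuous h2).
Qed.

Lemma measurable_wsum : measurable_fun setT (wsum F).
Proof.
have [m1 m2] := coords_measurable.
apply: measurable_funM; last exact: measurable_wt.
by apply: measurable_funD; exact: measurable_qnorm.
Qed.

(** Each of the eight real coordinates of the stem costs 4 exp a, whence 32. *)
Lemma wsum_point_bound z :
  ((wsum F z)%:E <= (32 * expR a)%:E * \int[leb2]_p (bx 1 z p * wsum F p)%:E)%E.
Proof.
have mG := measurable_wsum; have mb := @measurable_bx R 1 z.
set X := (\int[leb2]_p (bx 1 z p * wsum F p)%:E)%E.
have key (u v : P2 -> R) : measurable_fun setT u -> measurable_fun setT v ->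
    (forall p, `|u p| + `|v p| <= `|F.1 p| + `|F.2 p|) ->
    (\int[leb2]_p (bx 1 z p * ((`|u p| + `|v p|) * wt (a / 2) p))%:E <= X)%E.
  move=> mu mv le; have mw := @measurable_wt R (a / 2).
  apply: ge0_le_integralR => //.
  - by apply: measurable_funM => //; apply: measurable_funM => //; mfun.
  - exact: measurable_funM.
  - by move=> p; rewrite mulr_ge0 ?bx_ge0// mulr_ge0 ?wt_ge0// addr_ge0.
  - by move=> p _; rewrite ler_wpM2l ?bx_ge0// ler_wpM2r ?wt_ge0.
have [m1 m2] := coords_measurable.
have b1 c : ((`|qc c (F.1 z)| * wt (a / 2) z)%:E <= (4 * expR a)%:E * X)%E.
  have [ux [uy [vx [vy [h1 h2 cr1 cr2]]]]] := hF c.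
  apply: (le_trans (half_wt z h1 h2 cr1 cr2)).
  apply: lee_wpmul2l; first by rewrite lee_fin mulr_ge0 ?expR_ge0.
  apply: key; [exact: continuous2_measurable (C1_continuous h1)|
    exact: continuous2_measurable (C1_continuous h2)|].
  by move=> p; apply: lerD; exact: qc_le_norm.
have b2 c : ((`|qc c (F.2 z)| * wt (a / 2) z)%:E <= (4 * expR a)%:E * X)%E.
  have [ux [uy [vx [vy [h1 h2 cr1 cr2]]]]] := hF c.
  (* Multiplying by - iota gives the pair (F_1, - F_0), again holomorphic, with F_1 now in the first
     place. *)
  have h1' : has_C1 (fun p => - qc c (F.1 p)) (fun p => - ux p) (fun p => - uy p).
    by apply: has_C1_eq (has_C1Z (-1) h1) _ _ _ => p; rewrite mulN1r.
  have c1 p : vx p = - uy p by rewrite cr2 opprK.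
  have c2 p : vy p = - - ux p by rewrite cr1 opprK.
  apply: (le_trans (half_wt z h2 h1' c1 c2)).
  apply: lee_wpmul2l; first by rewrite lee_fin mulr_ge0 ?expR_ge0.
  apply: key; [exact: continuous2_measurable (C1_continuous h2)|
    exact: continuous2_measurable (C1_continuous h1')|].
  by move=> p; rewrite normrN addrC; apply: lerD; exact: qc_le_norm.
have w0 := wt_ge0 (a / 2) z.
have le : wsum F z <= `|qc Cre (F.1 z)| * wt (a / 2) z + `|qc Ci (F.1 z)| * wt (a / 2) z +
    `|qc Cj (F.1 z)| * wt (a / 2) z + `|qc Ck (F.1 z)| * wt (a / 2) z +
   (`|qc Cre (F.2 z)| * wt (a / 2) z + `|qc Ci (F.2 z)| * wt (a / 2) z +
    `|qc Cj (F.2 z)| * wt (a / 2) z + `|qc Ck (F.2 z)| * wt (a / 2) z).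
  rewrite /wsum -!mulrDl ler_wpM2r//; apply: lerD; exact: qnorm_le_sum.
apply: (@le_trans _ _ (_%:E)); first by rewrite lee_fin; exact: le.
rewrite !EFinD.
have X0 : (0 <= X)%E.
  by apply: integral_ge0 => p _; rewrite lee_fin mulr_ge0 ?bx_ge0 ?wsum_ge0.
have -> : ((32 * expR a)%:E * X = (4 * expR a)%:E * X + (4 * expR a)%:E * X + (4 * expR a)%:E * X + (4 * expR a)%:E * X +
  ((4 * expR a)%:E * X + (4 * expR a)%:E * X + (4 * expR a)%:E * X + (4 * expR a)%:E * X))%E.
  by rewrite -!ge0_muleDl ?adde_ge0// ?lee_fin ?mulr_ge0 ?addr_ge0 ?expR_ge0// -!EFinD; congr (_%:E * _)%E; ring.
by do !apply: leeD.
Qed.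

(** Cauchy-Schwarz on the box of radius 1; the leading 4 is its area. *)
Lemma wsum_sq_bound z :
  ((wsum F z ^+ 2)%:E <= (4 * (32 * expR a) ^+ 2)%:E * \int[leb2]_p (bx 1 z p * wsum F p ^+ 2)%:E)%E.
Proof.
have mG := measurable_wsum; have mb := @measurable_bx R 1 z.
have C0 : 0 < 32 * expR a :> R by rewrite mulr_gt0 ?expR_gt0.
have h : ((wsum F z / (32 * expR a))%:E <= \int[leb2]_p (bx 1 z p * wsum F p)%:E)%E.
  by rewrite mulrC EFinM lee_pdivrMl// wsum_point_bound.
have A : (\int[leb2]_p (bx 1 z p)%:E <= 4%:E :> \bar R)%E.
  have := integral_boxE 1 z (cst (1 : R)); under [in X in _ = X -> _]eq_integral do rewrite /cst mul1r.
  by move=> <-; rewrite integral_box_cst// lee_fin; lra.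
have := integral_CS mb mG (bx_ge0 1 z) (wsum_ge0 F) (ltr0n _ 4) A h.
rewrite divr_ge0 ?wsum_ge0 ?(ltW C0)// => /(_ isT) k.
have -> : wsum F z ^+ 2 = (32 * expR a) ^+ 2 * (wsum F z / (32 * expR a)) ^+ 2.
  by field; rewrite gt_eqF ?expR_gt0.
rewrite EFinM (mulrC 4) (EFinM (_ ^+ 2) 4) -muleA.
by apply: lee_wpmul2l k; rewrite lee_fin sqr_ge0.
Qed.

End point_evaluation.

(** * Fock norms as planar integrals, and a Carleson estimate *)

Section fock_norms.
Context {R : realType}.
Local Notation H := (quat R).
Local Notation mR := (measurableTypeR R).
Local Notation P2 := (mR * mR)%type.
Implicit Types (z p w : P2).
Variable a : R.
Hypothesis a0 : 0 < a.

Lemma leb2_tonelli_mul (k : P2 * P2 -> R) (phi : P2 -> R) : measurable_fun setT k ->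
  measurable_fun setT phi -> (forall t, 0 <= k t) -> (forall w, 0 <= phi w) ->
  (\int[leb2]_z \int[leb2]_w (k (z, w) * phi w)%:E =
   \int[leb2]_w ((phi w)%:E * \int[leb2]_z (k (z, w))%:E))%E.
Proof.
move=> mk mphi k0 phi0.
rewrite (@leb2_tonelli R (fun t => (k t * phi t.2)%:E)); last 2 first.
- by apply/measurable_EFinP; apply: measurable_funM => //; exact: measurableT_comp mphi measurable_snd.
- by move=> t; rewrite lee_fin mulr_ge0.
apply: eq_integral => w _.
under eq_integral do rewrite mulrC.
rewrite /= ge0_integralZR//.
exact: measurableT_comp mk (measurable_pair2 _).
Qed.

Lemma wt_half p : wt (a / 2) p ^+ 2 = wt a p.
Proof. by rewrite /wt expr2 -expRD; congr expR; field. Qed.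

Lemma fock_weight_coord (q : H) : fock_weight a q = 2 * a / pi * wt a (slice_coord q).
Proof. by rewrite -{1}(slice_coordK q) fock_weight_pt//; exact: slice_unit_imag. Qed.

Lemma stem_refl (F : (R * R -> H) * (R * R -> H)) p : is_stem F ->
  F.1 (refl p) = F.1 p /\ F.2 (refl p) = - F.2 p.
Proof. by move=> sF; case: p => x y; exact: sF. Qed.

(** Parity makes the integrand symmetric in the real axis, so 2 a / pi over the upper half plane
    becomes a / pi over the plane. *)
Lemma fock_sqnormE (F : (R * R -> H) * (R * R -> H)) : is_stem F ->
  measurable_fun setT (F.1 : P2 -> H) -> measurable_fun setT (F.2 : P2 -> H) ->
  fock_sqnorm a (from_stem F) =
   ((a / pi)%:E * \int[leb2]_p ((`|F.1 p| ^+ 2 + `|F.2 p| ^+ 2) * wt a p)%:E)%E.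
Proof.
move=> sF m1 m2.
have ap : 0 <= a / pi by rewrite divr_ge0 ?pi_ge0 ?ltW.
have ap2 : 0 <= 2 * a / pi by rewrite -mulrA mulr_ge0.
have mN : measurable_fun setT (fun p : P2 => (`|F.1 p| ^+ 2 + `|F.2 p| ^+ 2) * wt a p).
  apply: measurable_funM; last exact: measurable_wt.
  by apply: measurable_funD; apply: measurable_funX; exact: measurable_qnorm.
have N0 p : 0 <= (`|F.1 p| ^+ 2 + `|F.2 p| ^+ 2) * wt a p.
  by rewrite mulr_ge0 ?wt_ge0// addr_ge0 ?sqr_ge0.
rewrite /fock_sqnorm; under eq_integral do rewrite fock_weight_coord.
rewrite (@dV_sqnorm _ F (fun p => 2 * a / pi * wt a p))//; last 2 first.
- by apply: measurable_funM => //; exact: measurable_wt.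
- by move=> p; rewrite mulr_ge0 ?wt_ge0.
pose f p := ((`|F.1 p| ^+ 2 + `|F.2 p| ^+ 2) * wt a p)%:E.
have E : (\int[leb2]_(p in upper) f (refl p) = \int[leb2]_(p in upper) f p)%E.
  apply: eq_integral => p _; rewrite /f; have [-> ->] := stem_refl p sF.
  by rewrite normrN /wt /refl /= sqrrN.
rewrite -[integral leb2 setT _]/(\int[leb2]_p f p)%E ge0_integral_upper; last 2 first.
- exact/measurable_EFinP.
- by move=> p; rewrite lee_fin.
rewrite E.
have -> : (\int[leb2]_(p in upper) ((`|F.1 p| ^+ 2 + `|F.2 p| ^+ 2) * (2 * a / pi * wt a p))%:E =
   (2 * a / pi)%:E * \int[leb2]_(p in upper) f p)%E.
  apply: etrans; last exact: (ge0_integralZR leb2 (@measurable_upper R) mN ap2 N0).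
  by apply: eq_integral => p _; congr EFin; ring.
have : (0 <= \int[leb2]_(p in upper) f p)%E by apply: integral_ge0 => p _; rewrite lee_fin.
move: (\int[leb2]_(p in upper) f p)%E => X X0.
have -> : 2 * a / pi = a / pi + a / pi by ring.
by rewrite EFinD ge0_muleDl ?lee_fin// ge0_muleDr.
Qed.

Definition wsqn (F : (R * R -> H) * (R * R -> H)) : \bar R :=
  (\int[leb2]_p (wsum a F p ^+ 2)%:E)%E.

Let wsum_sq F p : wsum a F p ^+ 2 = (`|F.1 p| + `|F.2 p|) ^+ 2 * wt a p.
Proof. by rewrite /wsum exprMn wt_half. Qed.

Let ap0 : 0 < a / pi. Proof. by rewrite divr_gt0 ?pi_gt0. Qed.

Lemma wsqn_ge0 F : (0 <= wsqn F)%E.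
Proof. by apply: integral_ge0 => p _; rewrite lee_fin sqr_ge0. Qed.

Lemma fock_sqnorm_le F : is_stem F -> measurable_fun setT (F.1 : P2 -> H) ->
  measurable_fun setT (F.2 : P2 -> H) ->
  (fock_sqnorm a (from_stem F) <= (a / pi)%:E * wsqn F)%E.
Proof.
move=> sF m1 m2; rewrite fock_sqnormE//; apply: lee_wpmul2l; first by rewrite lee_fin ltW.
have [n1 n2] := (measurable_qnorm m1, measurable_qnorm m2); have mw := @measurable_wt R a.
rewrite /wsqn; under [leRHS]eq_integral do rewrite wsum_sq.
apply: ge0_le_integralR => //.
- by apply: measurable_funM => //; apply: measurable_funD; exact: measurable_funX.
- by apply: measurable_funM => //; apply: measurable_funX; exact: measurable_funD.
- by move=> p; rewrite mulr_ge0 ?wt_ge0// addr_ge0 ?sqr_ge0.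
move=> p _; rewrite ler_wpM2r ?wt_ge0//.
have : 0 <= `|F.1 p| * `|F.2 p| by rewrite mulr_ge0.
by rewrite sqrrD; lra.
Qed.

Lemma wsqn_le F : is_stem F -> measurable_fun setT (F.1 : P2 -> H) ->
  measurable_fun setT (F.2 : P2 -> H) ->
  (wsqn F <= (2 * pi / a)%:E * fock_sqnorm a (from_stem F))%E.
Proof.
move=> sF m1 m2; rewrite fock_sqnormE// muleA -EFinM.
have -> : 2 * pi / a * (a / pi) = 2 :> R.
  by rewrite mulrA divfK ?mulfK // lt0r_neq0 ?pi_gt0.
have [n1 n2] := (measurable_qnorm m1, measurable_qnorm m2); have mw := @measurable_wt R a.
have ms : measurable_fun setT (fun p => (`|F.1 p| ^+ 2 + `|F.2 p| ^+ 2) * wt a p).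
  by apply: measurable_funM => //; apply: measurable_funD; exact: measurable_funX.
have s0 p : 0 <= (`|F.1 p| ^+ 2 + `|F.2 p| ^+ 2) * wt a p.
  by rewrite mulr_ge0 ?wt_ge0// addr_ge0 ?sqr_ge0.
rewrite -(ge0_integralZR leb2 measurableT ms (ler0n R 2) s0) /wsqn; under [leLHS]eq_integral do rewrite wsum_sq.
apply: ge0_le_integralR => //.
- by apply: measurable_funM => //; apply: measurable_funX; exact: measurable_funD.
- by apply: measurable_funM => //; apply: measurable_funD; exact: measurable_funX.
- by move=> p; rewrite mulr_ge0 ?wt_ge0// sqr_ge0.
move=> p _; rewrite mulrA ler_wpM2r ?wt_ge0//.
by have := sqr_ge0 (`|F.1 p| - `|F.2 p|); rewrite sqrrB sqrrD; lra.
Qed.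

Lemma fock_stem g : fock a g -> exists F : (R * R -> H) * (R * R -> H),
  [/\ is_stem F, CR_coords F, g = from_stem F &
   (wsqn F <= (2 * pi / a)%:E * fock_sqnorm a g < +oo)%E].
Proof.
move=> [/slice_regular_coords[F [sF iF CF]] gy]; exists F.
have gE : g = from_stem F by apply/funext => q; exact: (induced_byP g sF).1 iF q.
have [m1 m2] := coords_measurable CF.
split => //; rewrite {1}gE wsqn_le//= lte_mul_pinfty ?lee_fin//.
by rewrite divr_ge0 ?mulr_ge0 ?pi_ge0 ?(ltW a0).
Qed.

(* The Schur test for the kernel [gk (a / 2) z w * V w], which dominates the operator after the
   weight [exp (- a |z|^2 / 2)] has been absorbed. *)
Section schur.
Variable V : P2 -> R.
Hypotheses (mV : measurable_fun setT V) (V0 : forall p, 0 <= V p) (uV : uloc V).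

Let a20 : 0 < a / 2. Proof. by rewrite divr_gt0. Qed.

Lemma gkV_bound (g : R) : 0 < g -> exists2 C : R, 0 < C &
  forall z, (\int[leb2]_w (gk g z w * V w)%:E <= C%:E)%E.
Proof.
move=> g0; have [C hC] := uloc_gk mV uV g0.
exists (Num.max 1 C); first by rewrite lt_max ltr01.
move=> z; apply: (@le_trans _ _ C%:E); last by rewrite lee_fin le_max lexx orbT.
apply: le_trans (hC z); rewrite le_eqVlt; apply/orP; left; apply/eqP.
by apply: eq_integral => w _; rewrite (ger0_norm (V0 w)).
Qed.

(** The density [V] defines a Carleson measure: bound the square at [w] by its integral over the box
    at [w], exchange the integrals, and use that [V] has uniformly bounded mass on boxes. The factor
    exp 2 compares the indicator of the unit box with a Gaussian. *)
Lemma V_sq_bound : exists2 C : R, 0 < C & forall F, CR_coords F ->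
  (\int[leb2]_w (V w * wsum a F w ^+ 2)%:E <= C%:E * wsqn F)%E.
Proof.
have [C C0 hC] := gkV_bound ltr01.
pose D := 4 * (32 * expR a) ^+ 2; have D0 : 0 < D by rewrite mulr_gt0// exprn_gt0// mulr_gt0 ?expR_gt0.
exists (D * (expR 2 * C)) => [|F hF]; first by rewrite !mulr_gt0 ?expR_gt0.
have mG := measurable_wsum a hF.
have mG2 : measurable_fun setT (fun w => wsum a F w ^+ 2) by exact: measurable_funX.
have mbx2 := @measurable_bx2 R 1.
have bxV (p : P2) : (\int[leb2]_w (V w * bx 1 w p)%:E <= (expR 2 * C)%:E)%E.
  rewrite EFinM; apply: le_trans (lee_wpmul2l _ (hC p)); last by rewrite lee_fin expR_ge0.
  have mg := @measurable_gk R 1 p.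
  rewrite -ge0_integralZR ?expR_ge0//; last 2 first.
  - exact: measurable_funM.
  - by move=> w; rewrite mulr_ge0 ?gk_ge0.
  apply: ge0_le_integralR => //.
  - by apply: measurable_funM => //; exact: measurable_bxl.
  - by apply: measurable_funM => //; exact: measurable_funM.
  - by move=> w; rewrite mulr_ge0 ?bx_ge0.
  move=> w _; rewrite mulrA [leRHS]mulrC ler_wpM2l//.
  rewrite bx_sym /bx indicE; case: (boolP (w \in _)) => [|_]; last by rewrite mulr_ge0 ?expR_ge0.
  rewrite inE /gk -expRD => /in_boxE[d1 d2] /=.
  have sq (t : R) : `|t| < 1 -> t ^+ 2 <= 1.
    by move=> t1; rewrite -real_normK ?num_real// expr_le1// ltW.
  by rewrite -[leLHS]expR0 ler_expR; have := sq _ d1; have := sq _ d2; lra.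
have Gb w : ((V w * wsum a F w ^+ 2)%:E <=
    D%:E * \int[leb2]_p (V w * bx 1 w p * wsum a F p ^+ 2)%:E)%E.
  under eq_integral do rewrite -mulrA.
  rewrite ge0_integralZR//; last 2 first.
  - by apply: measurable_funM => //; exact: measurable_bx.
  - by move=> p; rewrite mulr_ge0 ?bx_ge0 ?sqr_ge0.
  rewrite muleCA EFinM; apply: lee_wpmul2l; first by rewrite lee_fin.
  exact: wsum_sq_bound.
have mk : measurable_fun setT (fun t : P2 * P2 => V t.1 * bx 1 t.1 t.2).
  by apply: measurable_funM => //; exact: measurableT_comp mV measurable_fst.
pose f (t : P2 * P2) := (V t.1 * bx 1 t.1 t.2 * wsum a F t.2 ^+ 2)%:E.
have mf : measurable_fun setT f.
  apply/measurable_EFinP; apply: measurable_funM => //.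
  exact: measurableT_comp mG2 measurable_snd.
have f0 t : (0 <= f t)%E by rewrite /f lee_fin mulr_ge0 ?sqr_ge0 // mulr_ge0 ?bx_ge0.
apply: (@le_trans _ _ (\int[leb2]_w (D%:E * \int[leb2]_p f (w, p))))%E.
  apply: ge0_le_integral => //.
  - by move=> w _; rewrite lee_fin mulr_ge0 ?sqr_ge0.
  - by apply/measurable_EFinP; exact: measurable_funM.
  - by apply: measurable_funeM; exact: measurable_leb2_F.
rewrite ge0_integralZl//; last 3 first.
- exact: measurable_leb2_F.
- by move=> w _; apply: integral_ge0 => p _.
- by rewrite lee_fin ltW.
rewrite (EFinM D) -muleA; apply: lee_wpmul2l; first by rewrite lee_fin ltW.
rewrite (@leb2_tonelli_mul (fun t => V t.1 * bx 1 t.1 t.2) (fun p => wsum a F p ^+ 2))//; last 2 first.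
- by move=> t; rewrite mulr_ge0 ?bx_ge0.
- by move=> p; rewrite sqr_ge0.
rewrite -ge0_integralZl//; last 3 first.
- exact/measurable_EFinP.
- by move=> p _; rewrite lee_fin sqr_ge0.
- by rewrite lee_fin mulr_ge0 ?expR_ge0 ?(ltW C0).
apply: ge0_le_integral => //.
- move=> p _; apply: mule_ge0; first by rewrite lee_fin sqr_ge0.
  by apply: integral_ge0 => w _; rewrite lee_fin mulr_ge0 ?bx_ge0.
- apply: emeasurable_funM; first exact/measurable_EFinP.
  apply: (@measurable_leb2_F R (fun t => (V t.2 * bx 1 t.2 t.1)%:E)).
    apply/measurable_EFinP; apply: (measurableT_comp (f := fun t : P2 * P2 => V t.1 * bx 1 t.1 t.2) (g := fun t => (t.2, t.1))) => //.
    exact: measurable_swap.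
  by move=> t; rewrite lee_fin mulr_ge0 ?bx_ge0.
- by apply: measurable_funeM; exact/measurable_EFinP.
- by move=> p _; rewrite muleC; apply: lee_wpmul2r; [rewrite lee_fin sqr_ge0|exact: bxV].
Qed.

End schur.
End fock_norms.

(** * The norm estimate for the projection of a product *)

Section toeplitz_bound.
Context {R : realType}.
Local Notation H := (quat R).
Local Notation mR := (measurableTypeR R).
Local Notation P2 := (mR * mR)%type.
Implicit Types (z p w : P2).

Lemma expint_wt (b : R) (V : P2 -> R) : 0 < b -> measurable_fun setT V ->
  (forall g : R, 0 < g -> (\int[leb2]_w (gk g (0%R, 0%R) w * `|V w|)%:E < +oo)%E) ->
  expint (fun q => wt b q * V q).
Proof.
move=> b0 mV hV; split; first by apply: measurable_funM => //; exact: measurable_wt.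
move=> C; have mw := @measurable_wt R b.
(* Chosen so that e C^2 <= b / 2: the exponential costs at most half of the Gaussian, and the 1
   covers C = 0. *)
pose e := b / (2 * (C ^+ 2 + 1)).
have C1 : 0 < C ^+ 2 + 1 by rewrite ltr_wpDl// sqr_ge0.
have e0 : 0 < e by rewrite divr_gt0// mulr_gt0.
have eC : e * C ^+ 2 <= b / 2.
  have -> : e * C ^+ 2 = b / 2 * (C ^+ 2 / (C ^+ 2 + 1)) by rewrite /e; field; rewrite gt_eqF.
  by rewrite ler_piMr ?divr_ge0 ?(ltW b0)// ler_pdivrMr// mul1r lerDl.
have b2 : 0 < b / 2 by rewrite divr_gt0.
have mg := @measurable_gk R (b / 2) (0, 0).
apply: (@le_lt_trans _ _ (\int[leb2]_q (expR (2 * e^-1) * (gk (b / 2) (0, 0) q * `|V q|))%:E)%E).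
  apply: ge0_le_integralR => //.
  - apply: measurable_funM; first by mfun; exact: measurable_l1.
    by apply: measurableT_comp => //; exact: measurable_funM.
  - by mfun.
  move=> q _; rewrite normrM (ger0_norm (wt_ge0 _ _)) !mulrA ler_wpM2r//.
  rewrite /wt /gk -!expRD ler_expR /= !subr0 /l1.
  have h1 := linear_le_exp (C * q.1) e0; have h2 := linear_le_exp (C * q.2) e0.
  have k (t : R) : e * (C * t) ^+ 2 <= b / 2 * t ^+ 2.
    by rewrite exprMn mulrA ler_wpM2r ?sqr_ge0.
  have k1 := k q.1; have k2 := k q.2.
  have n1 : C * `|q.1| <= `|C * q.1| by rewrite normrM ler_wpM2r// ler_norm.
  have n2 : C * `|q.2| <= `|C * q.2| by rewrite normrM ler_wpM2r// ler_norm.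
  lra.
rewrite ge0_integralZR ?expR_ge0//; last 2 first.
- by mfun.
- by move=> q; rewrite mulr_ge0 ?gk_ge0.
by rewrite lte_mul_pinfty ?lee_fin ?expR_ge0// hV.
Qed.

Variable a : R.
Hypothesis a0 : 0 < a.
Let a20 : 0 < a / 2. Proof. by rewrite divr_gt0. Qed.

Lemma wsum_bounded (F : (R * R -> H) * (R * R -> H)) : CR_coords F -> (wsqn a F < +oo)%E ->
  exists2 M : R, 0 <= M & forall w, wsum a F w <= M.
Proof.
move=> CF Fy; pose D := 4 * (32 * expR a) ^+ 2.
have D0 : 0 <= D by rewrite mulr_ge0// sqr_ge0.
have fin : (wsqn a F \is a fin_num)%E by rewrite ge0_fin_numE// wsqn_ge0.
exists (Num.sqrt (D * fine (wsqn a F))) => [|w]; first exact: sqrtr_ge0.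
rewrite -[leLHS]ger0_norm ?wsum_ge0// -sqrtr_sqr; apply: ler_wsqrtr.
rewrite -lee_fin (EFinM D) fineK//.
apply: (le_trans (wsum_sq_bound a0 CF w)); apply: lee_wpmul2l; first by rewrite lee_fin.
have mG := measurable_wsum a CF.
apply: ge0_le_integralR => //.
- by apply: measurable_funM; [exact: measurable_bx|exact: measurable_funX].
- exact: measurable_funX.
- by move=> p; rewrite mulr_ge0 ?bx_ge0// sqr_ge0.
move=> p _; rewrite ler_piMl ?sqr_ge0// /bx indicE.
by case: (_ \in _) => /=.
Qed.

(** The weight is the square of [wt (a / 2)]: one factor makes [F] bounded, by [wsum_bounded], and
    the other makes [V] integrable against every exponential. *)
Lemma expint_prod (F : (R * R -> H) * (R * R -> H)) (V : P2 -> R) (h : P2 -> H) :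
  CR_coords F -> (wsqn a F < +oo)%E -> measurable_fun setT V ->
  (forall g : R, 0 < g -> (\int[leb2]_w (gk g (0%R, 0%R) w * `|V w|)%:E < +oo)%E) ->
  measurable_fun setT h -> (forall q, `|h q| <= V q * (`|F.1 q| + `|F.2 q|)) ->
  expint (fun q => wt a q * `|h q|).
Proof.
move=> CF Fy mV hV mh hb; have [M M0 hM] := wsum_bounded CF Fy.
apply: (expint_le M0 _ _ (expint_wt a20 mV hV)).
  by apply: measurable_funM; [exact: measurable_wt|exact: measurable_qnorm].
move=> q; rewrite !normrM normr_id !(ger0_norm (wt_ge0 _ _)) -wt_half expr2 -mulrA.
rewrite [leRHS]mulrCA ler_wpM2l ?wt_ge0//.
apply: (@le_trans _ _ (`|V q| * wsum a F q)).
  rewrite mulrC /wsum mulrA ler_wpM2r ?wt_ge0//; apply: (le_trans (hb q)).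
  by rewrite ler_wpM2r ?ler_norm// addr_ge0.
by rewrite mulrC ler_wpM2r.
Qed.

Section schur.
Variable V : P2 -> R.
Hypotheses (mV : measurable_fun setT V) (V0 : forall p, 0 <= V p) (uV : uloc V).

Lemma uloc_gk_lty g : 0 < g -> (\int[leb2]_w (gk g (0%R, 0%R) w * `|V w|)%:E < +oo)%E.
Proof. by move=> g0; have [C hC] := uloc_gk mV uV g0; exact: le_lt_trans (hC _) (ltry _). Qed.

(** Completing the square: this is how the growing kernel becomes a Gaussian once the weights are
    shared between input and output. *)
Let zm_gk z q : expR (zm a z q).1 * wt a q * wt (a / 2) z = gk (a / 2) z q * wt (a / 2) q.
Proof. by rewrite /gk /wt /zm -!expRD; congr expR; rewrite /=; field. Qed.

(** The 16 counts eight real coordinates with two kernel terms in each. *)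
Lemma wsum_proj_le (F : (R * R -> H) * (R * R -> H)) (h0 h1 : P2 -> H) z :
  CR_coords F -> (wsqn a F < +oo)%E ->
  measurable_fun setT h0 -> measurable_fun setT h1 ->
  (forall q, `|h0 q| <= V q * (`|F.1 q| + `|F.2 q|)) ->
  (forall q, `|h1 q| <= V q * (`|F.1 q| + `|F.2 q|)) ->
  ((wsum a (proj0 a h0 h1, proj1 a h0 h1) z)%:E <=
   (16 * (a / pi))%:E * \int[leb2]_w (gk (a / 2) z w * V w * wsum a F w)%:E)%E.
Proof.
move=> CF Fy mh0 mh1 hb0 hb1.
have eh0 := expint_prod CF Fy mV uloc_gk_lty mh0 hb0.
have eh1 := expint_prod CF Fy mV uloc_gk_lty mh1 hb1.
have ap0 : 0 <= a / pi by rewrite divr_ge0 ?pi_ge0 ?ltW.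
have mG := measurable_wsum a CF; have mg := @measurable_gk R (a / 2) z.
have mw := @measurable_wt R a.
set X := (\int[leb2]_w _)%E.
have [me ms _ _] := measurable_kE a z.
have mX : measurable_fun setT (fun w => gk (a / 2) z w * V w * wsum a F w).
  by apply: measurable_funM => //; exact: measurable_funM.
have X0w w : 0 <= gk (a / 2) z w * V w * wsum a F w.
  by rewrite mulr_ge0 ?wsum_ge0// mulr_ge0 ?gk_ge0.
have key (k k' : P2 -> R) c : measurable_fun setT k -> measurable_fun setT k' ->
   (forall q, `|k q| <= expR (zm a z q).1) -> (forall q, `|k' q| <= expR (zm a z q).1) ->
   ((`|\int[leb2]_q (a / pi * wt a q * (k q * qc c (h0 q) + k' q * qc c (h1 q)))| * wt (a / 2) z)%:E <=
     (2 * (a / pi))%:E * X)%E.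
  move=> mk mk' bk bk'.
  have m0 := (measurable_qcP h0).1 mh0 c; have m1 := (measurable_qcP h1).1 mh1 c.
  have mI : measurable_fun setT (fun q => a / pi * wt a q * (k q * qc c (h0 q) + k' q * qc c (h1 q))).
    by apply: measurable_funM; [exact: measurable_funM|apply: measurable_funD; exact: measurable_funM].
  rewrite mulrC EFinM.
  apply: (le_trans (lee_wpmul2l _ (le_normr_RintegralE leb2 measurableT mI))); first by rewrite lee_fin wt_ge0.
  rewrite -!ge0_integralZR ?wt_ge0 ?(mulr_ge0 (ler0n R 2) ap0)//; last by apply: measurableT_comp.
  apply: ge0_le_integralR => //.
  - by apply: measurable_funM => //; exact: measurableT_comp.
  - by apply: measurable_funM.
  - by move=> w; rewrite mulr_ge0 ?wt_ge0.
  move=> w _; rewrite -[gk _ _ _ * _ * _]mulrA.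
  have -> : 2 * (a / pi) * (gk (a / 2) z w * (V w * wsum a F w)) =
     a / pi * (expR (zm a z w).1 * wt a w * wt (a / 2) z) * (2 * (V w * (`|F.1 w| + `|F.2 w|))).
    by rewrite zm_gk /wsum; ring.
  rewrite (normrM (a / pi * _)) (ger0_norm (mulr_ge0 ap0 (wt_ge0 _ _))).
  have -> : a / pi * (expR (zm a z w).1 * wt a w * wt (a / 2) z) * (2 * (V w * (`|F.1 w| + `|F.2 w|))) =
    wt (a / 2) z * (a / pi * wt a w * (expR (zm a z w).1 * (2 * (V w * (`|F.1 w| + `|F.2 w|))))) by ring.
  rewrite ler_wpM2l ?wt_ge0// ler_wpM2l ?(mulr_ge0 ap0 (wt_ge0 _ _))//.
  apply: le_trans (ler_normD _ _) _; rewrite (normrM (k w)) (normrM (k' w)).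
  have le0 : `|qc c (h0 w)| <= V w * (`|F.1 w| + `|F.2 w|) := le_trans (qc_le_norm _ _) (hb0 w).
  have le1 : `|qc c (h1 w)| <= V w * (`|F.1 w| + `|F.2 w|) := le_trans (qc_le_norm _ _) (hb1 w).
  have l0 := ler_pM (normr_ge0 _) (normr_ge0 _) (bk w) le0.
  have l1 := ler_pM (normr_ge0 _) (normr_ge0 _) (bk' w) le1.
  by apply: (le_trans (lerD l0 l1)); rewrite le_eqVlt; apply/orP; left; apply/eqP; ring.
have X0 : (0 <= X)%E by apply: integral_ge0 => w _; rewrite lee_fin.
have b0 c : ((`|qc c (proj0 a h0 h1 z)| * wt (a / 2) z)%:E <= (2 * (a / pi))%:E * X)%E.
  have := key (fun q => ce (zm a z q)) (fun q => - se (zm a z q)) c me.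
  rewrite /proj0 qc_qintegral.
  have -> : \int[leb2]_q qc c ((a / pi * wt a q) *: (ce (zm a z q) *: h0 q - se (zm a z q) *: h1 q)) =
    \int[leb2]_q (a / pi * wt a q * (ce (zm a z q) * qc c (h0 q) + - se (zm a z q) * qc c (h1 q))).
    by apply: eq_Rintegral => q _; rewrite qcZ qcB !qcZ mulNr.
  apply; first exact: measurableT_comp ms.
  - by move=> q; exact: ce_le.
  - by move=> q; rewrite normrN; exact: se_le.
have b1 c : ((`|qc c (proj1 a h0 h1 z)| * wt (a / 2) z)%:E <= (2 * (a / pi))%:E * X)%E.
  have := key (fun q => se (zm a z q)) (fun q => ce (zm a z q)) c ms me.
  rewrite /proj1 qc_qintegral.
  have -> : \int[leb2]_q qc c ((a / pi * wt a q) *: (se (zm a z q) *: h0 q + ce (zm a z q) *: h1 q)) =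
    \int[leb2]_q (a / pi * wt a q * (se (zm a z q) * qc c (h0 q) + ce (zm a z q) * qc c (h1 q))).
    by apply: eq_Rintegral => q _; rewrite qcZ qcD !qcZ.
  by apply => q; [exact: se_le|exact: ce_le].
have w0 := wt_ge0 (a / 2) z.
set F' := (_, _).
have le : wsum a F' z <= `|qc Cre (F'.1 z)| * wt (a / 2) z + `|qc Ci (F'.1 z)| * wt (a / 2) z +
    `|qc Cj (F'.1 z)| * wt (a / 2) z + `|qc Ck (F'.1 z)| * wt (a / 2) z +
   (`|qc Cre (F'.2 z)| * wt (a / 2) z + `|qc Ci (F'.2 z)| * wt (a / 2) z +
    `|qc Cj (F'.2 z)| * wt (a / 2) z + `|qc Ck (F'.2 z)| * wt (a / 2) z).
  rewrite /wsum -!mulrDl ler_wpM2r//; apply: lerD; exact: qnorm_le_sum.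
apply: (@le_trans _ _ (_%:E)); first by rewrite lee_fin; exact: le.
rewrite !EFinD; move: b0 b1; set B := (_ * X)%E => b0 b1.
have -> : ((16 * (a / pi))%:E * X = B + B + B + B + (B + B + B + B))%E.
  have b20 : 0 <= 2 * (a / pi) by rewrite (mulr_ge0 (ler0n R 2) ap0).
  have -> : 16 * (a / pi) = 2 * (a / pi) + 2 * (a / pi) + 2 * (a / pi) + 2 * (a / pi) +
    (2 * (a / pi) + 2 * (a / pi) + 2 * (a / pi) + 2 * (a / pi)) by ring.
  by rewrite !EFinD !ge0_muleDl ?adde_ge0 ?lee_fin.
by do !apply: leeD => //.
Qed.

(** Cauchy-Schwarz in [w] uses the density gk V, of mass at most [C1]. After Tonelli the Gaussian
    integrates in [z] to [C3], and [V_sq_bound] handles what is left. *)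
Lemma wsqn_proj_le : exists2 C : R, 0 <= C &
  forall (F : (R * R -> H) * (R * R -> H)) (h0 h1 : P2 -> H),
  CR_coords F -> (wsqn a F < +oo)%E ->
  measurable_fun setT h0 -> measurable_fun setT h1 ->
  (forall q, `|h0 q| <= V q * (`|F.1 q| + `|F.2 q|)) ->
  (forall q, `|h1 q| <= V q * (`|F.1 q| + `|F.2 q|)) ->
  (wsqn a (proj0 a h0 h1, proj1 a h0 h1) <= C%:E * wsqn a F)%E.
Proof.
have [C1 C10 hC1] := gkV_bound mV V0 uV a20.
have [C2 C20 hC2] := V_sq_bound a0 mV V0 uV.
have [C3 C30 hC3] := integral_gk a20.
have ap0 : 0 < a / pi by rewrite divr_gt0 ?pi_gt0.
pose D := 16 * (a / pi); have D0 : 0 < D by rewrite mulr_gt0.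
exists (D ^+ 2 * C1 * (C3 * C2)).
  by apply: mulr_ge0; [apply: mulr_ge0; [exact: sqr_ge0|exact: ltW]|rewrite ltW // mulr_gt0].
move=> F h0 h1 CF Fy mh0 mh1 hb0 hb1.
have eh0 := expint_prod CF Fy mV uloc_gk_lty mh0 hb0.
have eh1 := expint_prod CF Fy mV uloc_gk_lty mh1 hb1.
have mG := measurable_wsum a CF.
have mP := measurable_wsum a (proj_CR a0 mh0 mh1 eh0 eh1).
have mVG : measurable_fun setT (fun w => V w * wsum a F w ^+ 2).
  by apply: measurable_funM => //; exact: measurable_funX.
have VG0 w : 0 <= V w * wsum a F w ^+ 2 by rewrite mulr_ge0 ?sqr_ge0.
pose f (t : P2 * P2) := (gk (a / 2) t.1 t.2 * (V t.2 * wsum a F t.2 ^+ 2))%:E.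
have mf : measurable_fun setT f.
  apply/measurable_EFinP; apply: measurable_funM; first exact: measurable_gk2.
  exact: measurableT_comp mVG measurable_snd.
have f0 t : (0 <= f t)%E by rewrite /f lee_fin mulr_ge0 ?gk_ge0.
have key z : ((wsum a (proj0 a h0 h1, proj1 a h0 h1) z ^+ 2)%:E <=
   (D ^+ 2 * C1)%:E * \int[leb2]_w f (z, w))%E.
  have := wsum_proj_le z CF Fy mh0 mh1 hb0 hb1; rewrite -/D; set S := wsum a (_, _) z => h.
  have h' : ((S / D)%:E <= \int[leb2]_w (gk (a / 2) z w * V w * wsum a F w)%:E)%E.
    by rewrite mulrC EFinM lee_pdivrMl.
  have mk : measurable_fun setT (fun w => gk (a / 2) z w * V w).
    by apply: measurable_funM => //; exact: measurable_gk.
  have k0 w : 0 <= gk (a / 2) z w * V w by rewrite mulr_ge0 ?gk_ge0.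
  have := integral_CS mk mG k0 (wsum_ge0 a F) C10 (hC1 z) h'.
  rewrite divr_ge0 ?wsum_ge0 ?(ltW D0)// => /(_ isT) k.
  have -> : S ^+ 2 = D ^+ 2 * (S / D) ^+ 2 by field; rewrite gt_eqF.
  rewrite EFinM (EFinM (D ^+ 2) C1) -muleA; apply: lee_wpmul2l; first by rewrite lee_fin sqr_ge0.
  apply: (le_trans k); rewrite le_eqVlt; apply/orP; left; apply/eqP; congr (_ * _)%E.
  by apply: eq_integral => w _; rewrite /f /= mulrA.
have mfF := measurable_leb2_F mf f0.
apply: (@le_trans _ _ (\int[leb2]_z ((D ^+ 2 * C1)%:E * \int[leb2]_w f (z, w))))%E.
  apply: ge0_le_integral => //.
  - by move=> z _; rewrite lee_fin sqr_ge0.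
  - by apply/measurable_EFinP; exact: measurable_funX.
  - exact: measurable_funeM.
rewrite ge0_integralZl//; last 2 first.
- by move=> z _; apply: integral_ge0.
- by rewrite lee_fin mulr_ge0 ?sqr_ge0 ?(ltW C10).
rewrite (EFinM (D ^+ 2 * C1)) -muleA; apply: lee_wpmul2l.
  by rewrite lee_fin mulr_ge0 ?sqr_ge0 ?(ltW C10).
rewrite (@leb2_tonelli_mul _ (fun t => gk (a / 2) t.1 t.2) (fun w => V w * wsum a F w ^+ 2))//; last 2 first.
- exact: measurable_gk2.
- by move=> t; exact: gk_ge0.
rewrite EFinM -muleA.
apply: (@le_trans _ _ (C3%:E * \int[leb2]_w (V w * wsum a F w ^+ 2)%:E)%E); last first.
  by apply: lee_wpmul2l; [rewrite lee_fin ltW|exact: hC2].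
rewrite -ge0_integralZR ?(ltW C30)// le_eqVlt; apply/orP; left; apply/eqP.
apply: eq_integral => w _; rewrite [RHS]EFinM [RHS]muleC; congr (_ * _)%E.
by rewrite -(hC3 w); apply: eq_integral => z _; rewrite gkC.
Qed.

End schur.
End toeplitz_bound.

(** * Toeplitz operators *)

Section toeplitz.
Context {R : realType}.
Local Notation H := (quat R).
Local Notation mR := (measurableTypeR R).
Local Notation P2 := (mR * mR)%type.
Local Notation pair_fun := ((R * R -> H) * (R * R -> H))%type.
Implicit Types (z p w : P2) (F G : pair_fun).
Variable a : R.
Hypothesis a0 : 0 < a.

Section linearity.
Variables (h0 h1 : P2 -> H).
Hypotheses (mh0 : measurable_fun setT h0) (mh1 : measurable_fun setT h1).
Hypotheses (eh0 : expint (fun q => wt a q * `|h0 q|)).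
Hypotheses (eh1 : expint (fun q => wt a q * `|h1 q|)).

Let comb (k k' : P2 -> R) z : measurable_fun setT k -> measurable_fun setT k' ->
  (forall q, `|k q| <= expR (a * l1 z * l1 q)) -> (forall q, `|k' q| <= expR (a * l1 z * l1 q)) ->
  qintegrable leb2 setT (fun q => (a / pi * wt a q) *: (k q *: h0 q + k' q *: h1 q)).
Proof.
move=> mk mk' bk bk' c.
have i0 : leb2.-integrable setT (EFin \o (fun q => k q * (wt a q * qc c (h0 q)))).
  apply: (expint_integrable ler01 (expint_qc0 mh0 eh0 c) mk (C := a * l1 z)) => q.
  by rewrite mul1r.
have i1 : leb2.-integrable setT (EFin \o (fun q => k' q * (wt a q * qc c (h1 q)))).
  apply: (expint_integrable ler01 (expint_qc0 mh1 eh1 c) mk' (C := a * l1 z)) => q.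
  by rewrite mul1r.
have := integrableZl measurableT (a / pi) (integrableD measurableT i0 i1).
apply: eq_integrable => // q _ /=.
by rewrite -EFinD -EFinM qcZ qcD !qcZ; congr EFin; ring.
Qed.

Lemma proj0_qintegrable z : qintegrable leb2 setT
  (fun q => (a / pi * wt a q) *: (ce (zm a z q) *: h0 q - se (zm a z q) *: h1 q)).
Proof.
have [me ms _ _] := measurable_kE a z.
have -> : (fun q => (a / pi * wt a q) *: (ce (zm a z q) *: h0 q - se (zm a z q) *: h1 q)) =
  fun q => (a / pi * wt a q) *: (ce (zm a z q) *: h0 q + (- se (zm a z q)) *: h1 q).
  by apply/funext => q; rewrite scaleNr.
apply: (@comb _ (fun q => - se (zm a z q)) z) => //.
- exact: measurableT_comp ms.
- by move=> q; exact: cem_le.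
- by move=> q; rewrite normrN; exact: sem_le.
Qed.

Lemma proj1_qintegrable z : qintegrable leb2 setT
  (fun q => (a / pi * wt a q) *: (se (zm a z q) *: h0 q + ce (zm a z q) *: h1 q)).
Proof.
have [me ms _ _] := measurable_kE a z.
by apply: (@comb _ _ z) => // q; [exact: sem_le|exact: cem_le].
Qed.

Lemma projMr c z : proj0 a (fun q => h0 q * c) (fun q => h1 q * c) z = proj0 a h0 h1 z * c /\
  proj1 a (fun q => h0 q * c) (fun q => h1 q * c) z = proj1 a h0 h1 z * c.
Proof.
split; rewrite /proj0 /proj1.
  rewrite -(qintegralMr measurableT c (proj0_qintegrable z)); apply: eq_qintegral => q _.
  by rewrite -!scalerAl mulrBl -!scalerAl.
rewrite -(qintegralMr measurableT c (proj1_qintegrable z)); apply: eq_qintegral => q _.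
by rewrite -!scalerAl mulrDl -!scalerAl.
Qed.

End linearity.

Lemma projD (h0 h1 k0 k1 : P2 -> H) z :
  measurable_fun setT h0 -> measurable_fun setT h1 ->
  measurable_fun setT k0 -> measurable_fun setT k1 ->
  expint (fun q => wt a q * `|h0 q|) -> expint (fun q => wt a q * `|h1 q|) ->
  expint (fun q => wt a q * `|k0 q|) -> expint (fun q => wt a q * `|k1 q|) ->
  proj0 a (fun q => h0 q + k0 q) (fun q => h1 q + k1 q) z = proj0 a h0 h1 z + proj0 a k0 k1 z /\
  proj1 a (fun q => h0 q + k0 q) (fun q => h1 q + k1 q) z = proj1 a h0 h1 z + proj1 a k0 k1 z.
Proof.
move=> mh0 mh1 mk0 mk1 eh0 eh1 ek0 ek1; split; rewrite /proj0 /proj1.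
  rewrite -(qintegralD measurableT (proj0_qintegrable mh0 mh1 eh0 eh1 z) (proj0_qintegrable mk0 mk1 ek0 ek1 z)).
  by apply: eq_qintegral => q _; rewrite (scalerDr (ce _)) (scalerDr (se _)) opprD addrACA scalerDr.
rewrite -(qintegralD measurableT (proj1_qintegrable mh0 mh1 eh0 eh1 z) (proj1_qintegrable mk0 mk1 ek0 ek1 z)).
by apply: eq_qintegral => q _; rewrite (scalerDr (ce _)) (scalerDr (se _)) addrACA scalerDr.
Qed.

Definition stem_mul F G : pair_fun := (fun p => F.1 p * G.1 p - F.2 p * G.2 p,
  fun p => F.1 p * G.2 p + F.2 p * G.1 p).

Lemma stem_mul_stem F G : is_stem F -> is_stem G -> is_stem (stem_mul F G).
Proof.
move=> sF sG x y; have [f0 f1] := sF x y; have [g0 g1] := sG x y.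
by rewrite /= f0 f1 g0 g1 !mulrN !mulNr opprK opprD.
Qed.

Lemma slice_prodE (f g : H -> H) F G : is_stem F -> induced_by F f -> is_stem G -> induced_by G g ->
  slice_prod f g = from_stem (stem_mul F G).
Proof. by move=> sF iF sG iG; rewrite /slice_prod (stem_eq sF iF) (stem_eq sG iG). Qed.

Lemma stem_mul_norm F G p : `|(stem_mul F G).1 p| <= (`|F.1 p| + `|F.2 p|) * (`|G.1 p| + `|G.2 p|) /\
  `|(stem_mul F G).2 p| <= (`|F.1 p| + `|F.2 p|) * (`|G.1 p| + `|G.2 p|).
Proof.
have h : 0 <= `|F.1 p| * `|G.1 p| /\ 0 <= `|F.1 p| * `|G.2 p| /\
  0 <= `|F.2 p| * `|G.1 p| /\ 0 <= `|F.2 p| * `|G.2 p| by rewrite !mulr_ge0.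
split.
  apply: le_trans (ler_normB _ _) _; rewrite !qnormM mulrDl !mulrDr; lra.
apply: le_trans (ler_normD _ _) _; rewrite !qnormM mulrDl !mulrDr; lra.
Qed.

Lemma from_stem_induced F : is_stem F -> induced_by F (from_stem F).
Proof. by move=> sF; apply/induced_byP. Qed.

Lemma induced_from_stem F f : is_stem F -> induced_by F f -> f = from_stem F.
Proof. by move=> sF iF; apply/funext => q; exact: (induced_byP f sF).1 iF q. Qed.

Lemma measurable_stem_mul F G : measurable_fun setT (F.1 : P2 -> H) -> measurable_fun setT (F.2 : P2 -> H) ->
  measurable_fun setT (G.1 : P2 -> H) -> measurable_fun setT (G.2 : P2 -> H) ->
  measurable_fun setT ((stem_mul F G).1 : P2 -> H) /\ measurable_fun setT ((stem_mul F G).2 : P2 -> H).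
Proof.
move=> mF1 mF2 mG1 mG2; split.
- by apply: measurable_qB; exact: measurable_qM.
- by apply: measurable_qD; exact: measurable_qM.
Qed.

Variables (f : H -> H) (F : pair_fun).
Hypotheses (sF : is_stem F) (iF : induced_by F f).
Hypotheses (mF1 : measurable_fun setT (F.1 : P2 -> H)) (mF2 : measurable_fun setT (F.2 : P2 -> H)).
Let V p := `|F.1 p| + `|F.2 p|.

Let mV : measurable_fun setT V. Proof. by apply: measurable_funD; exact: measurable_qnorm. Qed.
Let V0 p : 0 <= V p. Proof. exact: addr_ge0. Qed.

(* The integrability of the symbol needed for [toeplitz] to be given by convergent integrals. *)
Hypothesis Vgk : forall g : R, 0 < g -> (\int[leb2]_w (gk g (0%R, 0%R) w * `|V w|)%:E < +oo)%E.

Lemma stem_mul_expint G : CR_coords G -> (wsqn a G < +oo)%E ->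
  expint (fun q => wt a q * `|(stem_mul F G).1 q|) /\ expint (fun q => wt a q * `|(stem_mul F G).2 q|).
Proof.
move=> CG Gy; have [mG1 mG2] := coords_measurable CG.
have [m1 m2] := measurable_stem_mul mF1 mF2 mG1 mG2.
split; apply: (expint_prod a0 CG Gy mV Vgk) => // q; by have [] := stem_mul_norm F G q.
Qed.

Definition proj_pair (h : pair_fun) : pair_fun := (proj0 a h.1 h.2, proj1 a h.1 h.2).

Lemma toeplitz_stem g G : is_stem G -> CR_coords G -> g = from_stem G -> (wsqn a G < +oo)%E ->
  [/\ is_stem (proj_pair (stem_mul F G)), induced_by (proj_pair (stem_mul F G)) (toeplitz a f g),
    CR_coords (proj_pair (stem_mul F G)) &
    toeplitz a f g = from_stem (proj_pair (stem_mul F G))].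
Proof.
move=> sG CG gE Gy; have [mG1 mG2] := coords_measurable CG.
have [m1 m2] := measurable_stem_mul mF1 mF2 mG1 mG2.
have [e1 e2] := stem_mul_expint CG Gy.
have sM := stem_mul_stem sF sG.
have ev (q : P2) := (stem_refl q sM).1; have od (q : P2) := (stem_refl q sM).2.
have TE : toeplitz a f g = fock_proj a (from_stem (stem_mul F G)).
  by rewrite /toeplitz gE (slice_prodE sF iF sG (from_stem_induced sG)).
have s := proj_is_stem a0 m1 m2 e1 e2 ev od.
have i := fock_proj_induced a0 m1 m2 e1 e2 ev od.
have c := proj_CR a0 m1 m2 e1 e2.
rewrite TE; split => //; exact: induced_from_stem s i.
Qed.

(** Integrals that diverge need not add up; membership in the Fock space enters through
    [stem_mul_expint], which makes them converge. *)
Lemma toeplitzD g h : fock a g -> fock a h ->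
  toeplitz a f (g \+ h) = toeplitz a f g + toeplitz a f h.
Proof.
move=> /(fock_stem a0)[G [sG CG gE /andP[G1 G2]]] /(fock_stem a0)[K [sK CK hE /andP[K1 K2]]].
have Gy := le_lt_trans G1 G2; have Ky := le_lt_trans K1 K2.
have [mG1 mG2] := coords_measurable CG; have [mK1 mK2] := coords_measurable CK.
have [_ _ _ TG] := toeplitz_stem sG CG gE Gy.
have [_ _ _ TK] := toeplitz_stem sK CK hE Ky.
have [eG1 eG2] := stem_mul_expint CG Gy; have [eK1 eK2] := stem_mul_expint CK Ky.
have [m1 m2] := measurable_stem_mul mF1 mF2 mG1 mG2.
have [n1 n2] := measurable_stem_mul mF1 mF2 mK1 mK2.
pose S : pair_fun := (fun p => G.1 p + K.1 p, fun p => G.2 p + K.2 p).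
have sS : is_stem S.
  move=> x y; have [e1 e2] := sG x y; have [e3 e4] := sK x y.
  by rewrite /= e1 e2 e3 e4 opprD.
have SE : g \+ h = from_stem S.
  by apply/funext => q; rewrite gE hE /= /from_stem /= mulrDr addrACA.
have ME1 : (stem_mul F S).1 = fun q => (stem_mul F G).1 q + (stem_mul F K).1 q.
  by apply/funext => q; rewrite /= !mulrDr opprD addrACA.
have ME2 : (stem_mul F S).2 = fun q => (stem_mul F G).2 q + (stem_mul F K).2 q.
  by apply/funext => q; rewrite /= !mulrDr addrACA.
have expD (u v : P2 -> H) : measurable_fun setT u -> measurable_fun setT v ->
   expint (fun q => wt a q * `|u q|) -> expint (fun q => wt a q * `|v q|) ->
   expint (fun q => wt a q * `|u q + v q|).
  move=> mu mv eu ev; apply: expint_le ler01 _ _ (expintD eu ev).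
    by apply: measurable_funM; [exact: measurable_wt|apply: measurable_qnorm; exact: measurable_qD].
  move=> q; rewrite mul1r -mulrDr !normrM ler_wpM2l// normr_id [leRHS]ger0_norm ?addr_ge0//.
  exact: ler_normD.
have sM := stem_mul_stem sF sS.
have ev (q : P2) := (stem_refl q sM).1; have od (q : P2) := (stem_refl q sM).2.
have i : induced_by (proj_pair (stem_mul F S)) (toeplitz a f (g \+ h)).
  rewrite /toeplitz SE (slice_prodE sF iF sS (from_stem_induced sS)).
  have M1 : measurable_fun setT ((stem_mul F S).1 : P2 -> H) by rewrite ME1; exact: measurable_qD.
  have M2 : measurable_fun setT ((stem_mul F S).2 : P2 -> H) by rewrite ME2; exact: measurable_qD.
  have E1 : expint (fun q => wt a q * `|(stem_mul F S).1 q|) by rewrite ME1; exact: expD.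
  have E2 : expint (fun q => wt a q * `|(stem_mul F S).2 q|) by rewrite ME2; exact: expD.
  exact: (fock_proj_induced a0 M1 M2 E1 E2 ev od).
apply/funext => q; rewrite -{1}(slice_coordK q) (i _ (slice_unit_imag q)) TG TK.
rewrite [RHS]/(from_stem _ q + from_stem _ q) /from_stem /proj_pair /= -/(stem_mul F S) ?ME1 ?ME2.
have [p0 p1] := projD (slice_coord q) m1 m2 n1 n2 eG1 eG2 eK1 eK2.
rewrite -[proj0 _ _ _ _]/(proj0 a (stem_mul F S).1 (stem_mul F S).2 (slice_coord q)).
rewrite -[proj1 _ _ _ _]/(proj1 a (stem_mul F S).1 (stem_mul F S).2 (slice_coord q)).
by rewrite ME1 ME2 p0 p1 mulrDr addrACA.
Qed.

Lemma toeplitzMr g c : fock a g ->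
  toeplitz a f (fun q => g q * c) = (fun q => toeplitz a f g q * c).
Proof.
move=> /(fock_stem a0)[G [sG CG gE /andP[G1 G2]]].
have Gy := le_lt_trans G1 G2.
have [mG1 mG2] := coords_measurable CG.
have [_ _ _ TG] := toeplitz_stem sG CG gE Gy.
have [eG1 eG2] := stem_mul_expint CG Gy.
have [m1 m2] := measurable_stem_mul mF1 mF2 mG1 mG2.
pose S : pair_fun := (fun p => G.1 p * c, fun p => G.2 p * c).
have sS : is_stem S by move=> x y; have [e1 e2] := sG x y; rewrite /= e1 e2 mulNr.
have SE : (fun q => g q * c) = from_stem S.
  by apply/funext => q; rewrite gE /from_stem /= mulrDl mulrA.
have ME1 : (stem_mul F S).1 = fun q => (stem_mul F G).1 q * c.
  by apply/funext => q; rewrite /= mulrBl !mulrA.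
have ME2 : (stem_mul F S).2 = fun q => (stem_mul F G).2 q * c.
  by apply/funext => q; rewrite /= mulrDl !mulrA.
have mc (u : P2 -> H) : measurable_fun setT u -> measurable_fun setT (fun q => u q * c).
  by move=> mu; apply: measurable_qM => //; exact: measurable_cst.
have expM (u : P2 -> H) : measurable_fun setT u ->
   expint (fun q => wt a q * `|u q|) -> expint (fun q => wt a q * `|u q * c|).
  move=> mu eu; apply: expint_le (normr_ge0 c) _ _ eu.
    apply: measurable_funM; [exact: measurable_wt|apply: measurable_qnorm; exact: mc].
  by move=> q; rewrite qnormM !normrM !normr_id le_eqVlt; apply/orP; left; apply/eqP; ring.
have sM := stem_mul_stem sF sS.
have ev (q : P2) := (stem_refl q sM).1; have od (q : P2) := (stem_refl q sM).2.
have i : induced_by (proj_pair (stem_mul F S)) (toeplitz a f (fun q => g q * c)).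
  rewrite /toeplitz SE (slice_prodE sF iF sS (from_stem_induced sS)).
  have M1 : measurable_fun setT ((stem_mul F S).1 : P2 -> H) by rewrite ME1; exact: mc.
  have M2 : measurable_fun setT ((stem_mul F S).2 : P2 -> H) by rewrite ME2; exact: mc.
  have E1 : expint (fun q => wt a q * `|(stem_mul F S).1 q|) by rewrite ME1; exact: expM.
  have E2 : expint (fun q => wt a q * `|(stem_mul F S).2 q|) by rewrite ME2; exact: expM.
  exact: (fock_proj_induced a0 M1 M2 E1 E2 ev od).
apply/funext => q; rewrite -{1}(slice_coordK q) (i _ (slice_unit_imag q)) TG.
have [p0 p1] := projMr m1 m2 eG1 eG2 c (slice_coord q).
rewrite /from_stem; rewrite -[(proj_pair _).1 _]/(proj0 a (stem_mul F S).1 (stem_mul F S).2 (slice_coord q)).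
rewrite -[(proj_pair (stem_mul F S)).2 _]/(proj1 a (stem_mul F S).1 (stem_mul F S).2 (slice_coord q)).
by rewrite ME1 ME2 p0 p1 mulrDl mulrA.
Qed.

(** The extension is the same integral formula on the whole Fock space, so agreement on the span of
    kernels is immediate. The 2 in the bound is the loss (a / pi)(2 pi / a) between [wsqn] and the
    Fock norm. *)
Lemma toeplitz_bounded_of_uloc : uloc V -> toeplitz_bounded a f.
Proof.
move=> uV; exists (toeplitz a f) => //.
have [C C0 hC] := wsqn_proj_le a0 mV V0 uV.
have C20 : 0 <= 2 * C by rewrite mulr_ge0.
have key g : fock a g -> fock a (toeplitz a f g) /\
    (fock_sqnorm a (toeplitz a f g) <= (2 * C)%:E * fock_sqnorm a g)%E.
  move=> fg; have [_ gy] := fg; have [G [sG CG gE /andP[G1 G2]]] := fock_stem a0 fg.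
  have Gy := le_lt_trans G1 G2.
  have [mG1 mG2] := coords_measurable CG.
  have [m1 m2] := measurable_stem_mul mF1 mF2 mG1 mG2.
  have [s i c TE] := toeplitz_stem sG CG gE Gy.
  have [n1 n2] := coords_measurable c.
  have le : (fock_sqnorm a (toeplitz a f g) <= (2 * C)%:E * fock_sqnorm a g)%E.
    rewrite TE; apply: (le_trans (fock_sqnorm_le a0 s n1 n2)).
    have := hC G _ _ CG Gy m1 m2 (fun q => (stem_mul_norm F G q).1) (fun q => (stem_mul_norm F G q).2).
    move=> h; have ap : 0 < a / pi by rewrite divr_gt0 ?pi_gt0.
    have h2 := le_trans h (lee_wpmul2l (x := C%:E) _ G1).
    have h3 := lee_wpmul2l (x := (a / pi)%:E) _ (h2 _).
    apply: (le_trans (h3 _ _)); rewrite ?lee_fin ?(ltW ap)//.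
    rewrite !muleA -!EFinM le_eqVlt; apply/orP; left; apply/eqP; congr (_%:E * _)%E.
    have -> : a / pi * C * (2 * pi / a) = 2 * C * ((a / a) * (pi / pi)) by ring.
    by rewrite !divff ?mulr1// lt0r_neq0 ?pi_gt0.
  split => //; split; first exact: slice_regular_of_CR s i c.
  by apply: le_lt_trans le _; rewrite lte_mul_pinfty ?lee_fin.
split.
- by move=> g /key[].
- exact: toeplitzD.
- by move=> g c; exact: toeplitzMr.
exists (Num.sqrt (2 * C)) => g fg; have [[_ Ty] le] := key g fg; have [_ gy] := fg.
have pos h : (0 <= fock_sqnorm a h)%E.
  apply: integral_ge0 => q _; rewrite lee_fin mulr_ge0 ?sqr_ge0// mulr_ge0 ?expR_ge0//.
  by rewrite divr_ge0 ?pi_ge0// mulr_ge0// ltW.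
rewrite /fock_norm -sqrtrM//; apply: ler_wsqrtr.
rewrite -lee_fin (EFinM (2 * C)) !fineK//; by rewrite ge0_fin_numE.
Qed.

End toeplitz.

(** * Test functions and the necessity of a bounded Berezin transform *)

Section test_functions.
Context {R : realType}.
Local Notation H := (quat R).
Local Notation mR := (measurableTypeR R).
Local Notation P2 := (mR * mR)%type.
Local Notation pair_fun := ((R * R -> H) * (R * R -> H))%type.
Implicit Types (z p w : P2) (F G : pair_fun).
Variable a : R.
Hypothesis a0 : 0 < a.

(* The stem of [K(., A) c + K(., A^bar) c^bar] for [A = slice_pt i z] and [c = r + s i]; it is
   real valued. *)
Definition tu (r s : R) z p := r * (ce (zm a p z) + ce (zp a p z)) - s * (se (zm a p z) - se (zp a p z)).
Definition tv (r s : R) z p := r * (se (zm a p z) + se (zp a p z)) + s * (ce (zm a p z) - ce (zp a p z)).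
Definition test_stem r s z : pair_fun := (fun p => tu r s z p *: 1, fun p => tv r s z p *: 1).

Local Arguments ce : simpl never.
Local Arguments se : simpl never.

Let qi : H := Quat 0 1 0 0.

Lemma test_is_stem r s z : is_stem (test_stem r s z).
Proof.
move=> x y.
have e1 : zm a (x, - y) z = ((zp a (x, y) z).1, - (zp a (x, y) z).2).
  by rewrite /zm /zp /=; congr (_, _); ring.
have e2 : zp a (x, - y) z = ((zm a (x, y) z).1, - (zm a (x, y) z).2).
  by rewrite /zm /zp /=; congr (_, _); ring.
rewrite /test_stem /= /tu /tv e1 e2 /ce /se /= !cosN !sinN; split.
  by congr (_ *: _); ring.
by rewrite -[RHS]scaleNr; congr (_ *: _); ring.
Qed.

Lemma test_kernel_span r s z : kernel_span a (from_stem (test_stem r s z)).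
Proof.
exists 2%N, (fun k : 'I_2 => if k == ord0 then slice_pt qi z else slice_pt qi (refl z)),
  (fun k : 'I_2 => if k == ord0 then slice_pt qi (r, s) else slice_pt qi (r, - s)).
apply/funext => q; rewrite big_ord_recl big_ord1 /= -{1 2 3}(slice_coordK q).
set p := slice_coord q; set I := slice_unit q.
have hI : imag_unit I := slice_unit_imag q.
rewrite (from_stem_induced (test_is_stem r s z) hI).
rewrite !fock_kernelE//; try exact: imag_unit_qi.
have e1 : zm a p (refl z) = zp a p z by rewrite /zm /zp /refl /=; congr (_, _); ring.
have e2 : zp a p (refl z) = zm a p z by rewrite /zm /zp /refl /=; congr (_, _); ring.
rewrite /kcc /ksc /kcs /kss !e1 !e2 /test_stem /= /tu /tv /slice_pt /qi.
move: (ce (zm a p z)) (ce (zp a p z)) (se (zm a p z)) (se (zp a p z)) => A B C D.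
case: I hI => I0 I1 I2 I3 _.
by apply: quat_ext => /=; field.
Qed.

Lemma has_C1_zm z : has_C1 (fun p => ce (zm a p z)) (fun p => a * z.1 * ce (zm a p z) + a * z.2 * se (zm a p z))
    (fun p => a * z.2 * ce (zm a p z) - a * z.1 * se (zm a p z)) /\
  has_C1 (fun p => se (zm a p z)) (fun p => a * z.1 * se (zm a p z) - a * z.2 * ce (zm a p z))
    (fun p => a * z.2 * se (zm a p z) + a * z.1 * ce (zm a p z)).
Proof.
have E p : zm a p z = (a * z.1 * p.1 + a * z.2 * p.2, - (a * z.2) * p.1 + a * z.1 * p.2).
  by rewrite /zm; congr (_, _); ring.
split.
  apply: has_C1_eq (has_C1_ce_linear (a * z.1) (a * z.2) (- (a * z.2)) (a * z.1)) _ _ _ => p;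
  by rewrite E //; ring.
apply: has_C1_eq (has_C1_se_linear (a * z.1) (a * z.2) (- (a * z.2)) (a * z.1)) _ _ _ => p;
by rewrite E //; ring.
Qed.

Lemma test_CR r s z : CR_coords (test_stem r s z).
Proof.
move=> c.
have [c1 s1] := has_C1_zm z; have [c2 s2] := has_C1_zm (refl z).
have E p : zm a p (refl z) = zp a p z by rewrite /zm /zp /refl /=; congr (_, _); ring.
have hu := has_C1Z (qc c 1) (has_C1B (has_C1Z r (has_C1D c1 c2)) (has_C1Z s (has_C1B s1 s2))).
have hv := has_C1Z (qc c 1) (has_C1D (has_C1Z r (has_C1D s1 s2)) (has_C1Z s (has_C1B c1 c2))).
do 4 eexists; split.
- by apply: has_C1_eq hu _ _ _ => // p; rewrite qcZ /tu E mulrC.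
- by apply: has_C1_eq hv _ _ _ => // p; rewrite qcZ /tv E mulrC.
- by move=> p /=; ring.
- by move=> p /=; ring.
Qed.

(** Completing the square, |exp (a p z^bar)|^2 times the weight is exp (a |z|^2) times a Gaussian
    centred at [z]. The other exponential gives the Gaussian at the reflected point. *)
Lemma test_wsqn : exists2 C : R, 0 <= C & forall r s z, `|r| + `|s| <= 1 ->
  (wsqn a (test_stem r s z) <= (C * expR (a * (z.1 ^+ 2 + z.2 ^+ 2)))%:E)%E.
Proof.
have [C C0 hC] := integral_gk a0.
exists (16 * C) => [|r s z rs]; first by rewrite mulr_ge0// ltW.
set E := expR (a * _); have E0 : 0 <= E by exact: expR_ge0.
have [mg1 mg2] := (@measurable_gk R a z, @measurable_gk R a (refl z)).
have mG := measurable_wsum a (test_CR r s z).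
apply: (@le_trans _ _ (\int[leb2]_p (8 * E * (gk a z p + gk a (refl z) p))%:E)%E).
  apply: ge0_le_integralR => //.
  - exact: measurable_funX.
  - by apply: measurable_funM => //; exact: measurable_funD.
  - by move=> p; exact: sqr_ge0.
  move=> p _; rewrite /wsum exprMn wt_half.
  have n1 : `|1 : H| = 1 by exact: qnorm1.
  rewrite /test_stem /= !normrZ n1 !mulr1.
  set X := expR (zm a p z).1; set Y := expR (zp a p z).1.
  have [X0 Y0] : 0 <= X /\ 0 <= Y by rewrite !expR_ge0.
  have bu : `|tu r s z p| <= (`|r| + `|s|) * (X + Y).
    rewrite mulrDl; apply: le_trans (ler_normB _ _) _; rewrite (normrM r) (normrM s).
    apply: lerD; rewrite ler_wpM2l//.
      by apply: le_trans (ler_normD _ _) _; apply: lerD; exact: ce_le.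
    by apply: le_trans (ler_normB _ _) _; apply: lerD; exact: se_le.
  have bv : `|tv r s z p| <= (`|r| + `|s|) * (X + Y).
    rewrite mulrDl; apply: le_trans (ler_normD _ _) _; rewrite (normrM r) (normrM s).
    apply: lerD; rewrite ler_wpM2l//.
      by apply: le_trans (ler_normD _ _) _; apply: lerD; exact: se_le.
    by apply: le_trans (ler_normB _ _) _; apply: lerD; exact: ce_le.
  have XY : (`|r| + `|s|) * (X + Y) <= X + Y by rewrite ler_piMl// addr_ge0.
  have U := le_trans bu XY; have W := le_trans bv XY.
  have sq : (`|tu r s z p| + `|tv r s z p|) ^+ 2 <= 8 * (X ^+ 2 + Y ^+ 2).
    have u0 : 0 <= `|tu r s z p| by []; have v0 : 0 <= `|tv r s z p| by [].
    apply: (@le_trans _ _ ((2 * (X + Y)) ^+ 2)).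
      by rewrite ler_sqr ?nnegrE ?addr_ge0 ?mulr_ge0 ?addr_ge0//; lra.
    by have := sqr_ge0 (X - Y); nra.
  apply: (le_trans (ler_wpM2r (wt_ge0 a p) sq)).
  have e1 : E * gk a z p = X ^+ 2 * wt a p.
    by rewrite /E /X /gk /wt /zm (expr2 (expR _)) -!expRD; congr expR; rewrite /=; ring.
  have e2 : E * gk a (refl z) p = Y ^+ 2 * wt a p.
    by rewrite /E /Y /gk /wt /zp /refl (expr2 (expR _)) -!expRD; congr expR; rewrite /=; ring.
  have -> : 8 * E * (gk a z p + gk a (refl z) p) = 8 * (E * gk a z p + E * gk a (refl z) p) by ring.
  by rewrite e1 e2 -mulrDl mulrA.
rewrite ge0_integralZR//; last 3 first.
- exact: measurable_funD.
- by rewrite mulr_ge0.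
- by move=> p; rewrite addr_ge0 ?gk_ge0.
rewrite ge0_integralDR//; try by move=> p; exact: gk_ge0.
by rewrite !hC -EFinD -EFinM lee_fin le_eqVlt; apply/orP; left; apply/eqP; ring.
Qed.

Variables (f : H -> H) (F : pair_fun).
Hypotheses (sF : is_stem F) (iF : induced_by F f).
Hypotheses (mF1 : measurable_fun setT (F.1 : P2 -> H)) (mF2 : measurable_fun setT (F.2 : P2 -> H)).
Let V p := `|F.1 p| + `|F.2 p|.
Hypothesis Vgk : forall g : R, 0 < g -> (\int[leb2]_w (gk g (0%R, 0%R) w * `|V w|)%:E < +oo)%E.

Let tP r s z := proj_pair a (stem_mul F (test_stem r s z)).

Let test_wsqn_lty r s z : `|r| + `|s| <= 1 -> (wsqn a (test_stem r s z) < +oo)%E.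
Proof. by have [C _ hC] := test_wsqn => rs; exact: le_lt_trans (hC r s z rs) (ltry _). Qed.

Let test_exp r s z : `|r| + `|s| <= 1 ->
  [/\ measurable_fun setT ((stem_mul F (test_stem r s z)).1 : P2 -> H),
   measurable_fun setT ((stem_mul F (test_stem r s z)).2 : P2 -> H),
   expint (fun q => wt a q * `|(stem_mul F (test_stem r s z)).1 q|) &
   expint (fun q => wt a q * `|(stem_mul F (test_stem r s z)).2 q|)].
Proof.
move=> rs; have CR := test_CR r s z.
have [mG1 mG2] := coords_measurable CR.
have [m1 m2] := measurable_stem_mul mF1 mF2 mG1 mG2.
by have [e1 e2] := stem_mul_expint a0 mF1 mF2 Vgk CR (test_wsqn_lty z rs).
Qed.

Let h2 : `|2^-1 : R| + `|0 : R| <= 1.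
Proof. by rewrite normr0 addr0 ger0_norm ?invr_ge0//; lra. Qed.
Let h2' : `|0 : R| + `|2^-1 : R| <= 1.
Proof. by rewrite normr0 add0r ger0_norm ?invr_ge0//; lra. Qed.

Let E z : R := expR (a * (z.1 ^+ 2 + z.2 ^+ 2)).

Let Eg z q : wt a q * (ce (zm a z q) ^+ 2 + se (zm a z q) ^+ 2) = E z * gk a z q.
Proof.
have -> : ce (zm a z q) ^+ 2 + se (zm a z q) ^+ 2 = expR (zm a z q).1 ^+ 2.
  by rewrite /ce /se !exprMn -mulrDr cos2Dsin2 mulr1.
by rewrite /E /wt /gk /zm (expr2 (expR _)) -!expRD; congr expR; rewrite /=; ring.
Qed.

Let zmC z q : ce (zm a q z) = ce (zm a z q) /\ se (zm a q z) = - se (zm a z q).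
Proof.
have -> : zm a q z = ((zm a z q).1, - (zm a z q).2) by rewrite /zm /=; congr (_, _); ring.
by rewrite /ce /se /= cosN sinN mulrN.
Qed.

Let Egk z q : a / pi * gk a z q = (E z)^-1 * (a / pi * wt a q * (ce (zm a z q) ^+ 2 + se (zm a z q) ^+ 2)).
Proof. by rewrite -(mulrA (a / pi)) Eg (mulrCA (a / pi)) mulKf // lt0r_neq0 // expR_gt0. Qed.

(* Combining the two test functions turns the reproducing kernel into the Gaussian centred at [z]. *)
Lemma berezin_test0 z : qintegral leb2 setT (fun q => (a / pi * gk a z q) *: F.1 q) =
  (E z)^-1 *: ((tP 2^-1 0 z).1 z + (tP 0 2^-1 z).2 z).
Proof.
have [m1 m2 e1 e2] := test_exp z h2; have [m1' m2' e1' e2'] := test_exp z h2'.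
rewrite /tP /proj_pair /= /proj0 /proj1.
have i0 := proj0_qintegrable a0 m1 m2 e1 e2 z; have i1 := proj1_qintegrable a0 m1' m2' e1' e2' z.
rewrite -(qintegralD measurableT i0 i1) -(@qintegral_linear _ _ _ _ _ measurableT (fun q => (E z)^-1 *: q)); last first.
- exact: qintegrableD.
- by move=> b x; rewrite !scalerA mulrC.
- by move=> x y; rewrite scalerDr.
apply: eq_qintegral => q _; rewrite -scalerDr Egk -(scalerA (E z)^-1) -(scalerA (a / pi * wt a q)); congr (_ *: (_ *: _)).
rewrite /stem_mul /test_stem /= /tu /tv; have [-> ->] := zmC z q.
move: (ce (zm a z q)) (se (zm a z q)) (ce (zp a q z)) (se (zp a q z)) => A B C D.
move: (F.1 q) (F.2 q) => [x0 x1 x2 x3] [y0 y1 y2 y3].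
by apply: quat_ext => /=; field.
Qed.

(** Subtracting iota times the second image from the first leaves the projection of exp (a q z^bar)
    times the symbol, taken at [z]. Its two components are the sum in [berezin_test0] and the
    difference here. *)
Lemma berezin_test1 z : qintegral leb2 setT (fun q => (a / pi * gk a z q) *: F.2 q) =
  (E z)^-1 *: ((tP 2^-1 0 z).2 z - (tP 0 2^-1 z).1 z).
Proof.
have [m1 m2 e1 e2] := test_exp z h2; have [m1' m2' e1' e2'] := test_exp z h2'.
rewrite /tP /proj_pair /= /proj0 /proj1.
have q0 := proj0_qintegrable a0 m1' m2' e1' e2' z.
have i0 := qintegrableMl measurableT (-1) q0; have i1 := proj1_qintegrable a0 m1 m2 e1 e2 z.
rewrite -mulN1r -(qintegralMl measurableT (-1) q0) -(qintegralD measurableT i1 i0).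
rewrite -(@qintegral_linear _ _ _ _ _ measurableT (fun q => (E z)^-1 *: q)); last first.
- exact: qintegrableD.
- by move=> b x; rewrite !scalerA mulrC.
- by move=> x y; rewrite scalerDr.
apply: eq_qintegral => q _; rewrite mulN1r -scalerBr Egk -(scalerA (E z)^-1) -(scalerA (a / pi * wt a q)); congr (_ *: (_ *: _)).
rewrite /stem_mul /test_stem /= /tu /tv; have [-> ->] := zmC z q.
move: (ce (zm a z q)) (se (zm a z q)) (ce (zp a q z)) (se (zp a q z)) => A B C D.
move: (F.1 q) (F.2 q) => [x0 x1 x2 x3] [y0 y1 y2 y3].
by apply: quat_ext => /=; field.
Qed.

(** Each image is evaluated at the very point [z] of its test function: the point bound contributes
    exp (a |z|^2 / 2), the norm of the test function contributes the same, and [E z] is their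
    product. *)
Lemma toeplitz_bounded_berezin : toeplitz_bounded a f -> exists M : R, forall z,
  `|qintegral leb2 setT (fun q => (a / pi * gk a z q) *: F.1 q)| <= M /\
  `|qintegral leb2 setT (fun q => (a / pi * gk a z q) *: F.2 q)| <= M.
Proof.
move=> [T [Tfock _ _ [CT hCT]] TE].
have [C C0 hC] := test_wsqn.
pose D := 4 * (32 * expR a) ^+ 2; have D0 : 0 <= D by rewrite mulr_ge0// sqr_ge0.
(* [D] comes from point evaluation, [C] from the test functions, [CT] from the operator; 2 is (2 pi
   / a)(a / pi), left by the two changes of norm. *)
pose K := D * (2 * C * CT ^+ 2); have K0 : 0 <= K.
  by rewrite mulr_ge0// mulr_ge0 ?sqr_ge0// mulr_ge0.
have ap : 0 < a / pi by rewrite divr_gt0 ?pi_gt0.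
have pos h : (0 <= fock_sqnorm a h)%E.
  apply: integral_ge0 => q _; rewrite lee_fin mulr_ge0 ?sqr_ge0// mulr_ge0 ?expR_ge0//.
  by rewrite divr_ge0 ?pi_ge0// mulr_ge0// ltW.
have key r s z : `|r| + `|s| <= 1 -> wsum a (tP r s z) z <= Num.sqrt K * expR (a / 2 * (z.1 ^+ 2 + z.2 ^+ 2)).
  move=> rs; have sG := test_is_stem r s z; have CG := test_CR r s z.
  have [s' i' c' tE] := toeplitz_stem a0 sF iF mF1 mF2 Vgk sG CG erefl (test_wsqn_lty z rs).
  have [mG1 mG2] := coords_measurable CG; have [n1 n2] := coords_measurable c'.
  set g := from_stem (test_stem r s z) in tE.
  have gle : (fock_sqnorm a g <= (a / pi * C * E z)%:E)%E.
    apply: (le_trans (fock_sqnorm_le a0 sG mG1 mG2)).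
    by rewrite -mulrA (EFinM (a / pi)); apply: lee_wpmul2l; [rewrite lee_fin ltW|exact: hC].
  have fg : fock a g.
    by split; [exact: slice_regular_of_CR sG (from_stem_induced sG) CG|exact: le_lt_trans gle (ltry _)].
  have := hCT g fg; have := Tfock g fg; rewrite TE; last exact: test_kernel_span.
  rewrite tE => -[_ Ty] bT.
  have fin1 : (fock_sqnorm a (from_stem (tP r s z)) \is a fin_num)%E by rewrite ge0_fin_numE.
  have fin2 : (fock_sqnorm a g \is a fin_num)%E by rewrite ge0_fin_numE//; case: fg.
  have sqb : fine (fock_sqnorm a (from_stem (tP r s z))) <= CT ^+ 2 * fine (fock_sqnorm a g).
    have l0 : 0 <= fock_norm a (from_stem (tP r s z)) by exact: sqrtr_ge0.
    have := ler_pM l0 l0 bT bT; rewrite -!expr2 exprMn /fock_norm !sqr_sqrtr// ?fine_ge0//.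
  have W : ((wsum a (tP r s z) z ^+ 2)%:E <= (K * E z)%:E)%E.
    apply: (le_trans (wsum_sq_bound a0 c' z)); rewrite -/D /K -mulrA (EFinM D).
    apply: lee_wpmul2l; first by rewrite lee_fin.
    apply: (@le_trans _ _ (wsqn a (tP r s z))).
      have mG := measurable_wsum a c'.
      apply: ge0_le_integralR => //.
      - by apply: measurable_funM; [exact: measurable_bx|exact: measurable_funX].
      - exact: measurable_funX.
      - by move=> p; rewrite mulr_ge0 ?bx_ge0// sqr_ge0.
      by move=> p _; rewrite ler_piMl ?sqr_ge0// /bx indicE; case: (_ \in _).
    apply: (le_trans (wsqn_le a0 s' n1 n2)).
    rewrite -(fineK fin1) -EFinM lee_fin.
    have g2 : fine (fock_sqnorm a g) <= a / pi * C * E z by rewrite -lee_fin fineK.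
    have pa : 0 <= 2 * pi / a by rewrite divr_ge0 ?mulr_ge0 ?pi_ge0 ?(ltW a0).
    apply: (le_trans (ler_wpM2l pa (le_trans sqb (ler_wpM2l (sqr_ge0 CT) g2)))).
    have -> : 2 * pi / a * (CT ^+ 2 * (a / pi * C * E z)) = 2 * C * CT ^+ 2 * E z * ((a / a) * (pi / pi)) by ring.
    by rewrite !divff ?mulr1// lt0r_neq0 ?pi_gt0.
  have -> : expR (a / 2 * (z.1 ^+ 2 + z.2 ^+ 2)) = Num.sqrt (E z).
    have -> : E z = expR (a / 2 * (z.1 ^+ 2 + z.2 ^+ 2)) ^+ 2.
      by rewrite /E (expr2 (expR _)) -expRD; congr expR; field.
    by rewrite sqrtr_sqr ger0_norm ?expR_ge0.
  rewrite -sqrtrM// -[leLHS]ger0_norm ?wsum_ge0// -sqrtr_sqr; apply: ler_wsqrtr.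
  by rewrite -lee_fin.
exists (2 * Num.sqrt K) => z.
have k1 := key _ _ z h2; have k2 := key _ _ z h2'.
pose W := wt (a / 2) z; pose Y := expR (a / 2 * (z.1 ^+ 2 + z.2 ^+ 2)).
have W0 : 0 <= W := wt_ge0 _ _.
have YW : Y * W = 1 by rewrite /Y /W /wt -expRD -[RHS]expR0; congr expR; ring.
have EYY : E z = Y ^+ 2 by rewrite /E /Y (expr2 (expR _)) -expRD; congr expR; field.
have Y0 : 0 < Y by exact: expR_gt0.
(* [W] is the weight inside [wsum] and [Y] the growth of its bound, so dividing by [E z] cancels
   both exactly. *)
have EWY : (E z)^-1 = W / Y.
  by rewrite EYY expr2 invfM; congr (_ / _); apply: (mulfI (lt0r_neq0 Y0)); rewrite YW divff ?lt0r_neq0.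
have fin (u v : H) : `|u| * W <= Num.sqrt K * Y -> `|v| * W <= Num.sqrt K * Y ->
    `|(E z)^-1 *: (u + v)| <= 2 * Num.sqrt K.
  move=> hu hv; rewrite normrZ EWY ger0_norm ?divr_ge0 ?(ltW Y0)//.
  have uv : `|u + v| * W <= 2 * Num.sqrt K * Y.
    by apply: (le_trans (ler_wpM2r W0 (ler_normD u v))); rewrite mulrDl; lra.
  by rewrite -mulrA mulrCA mulrC -ler_pdivlMr ?invr_gt0// invrK mulrC.
rewrite berezin_test0 berezin_test1.
have b1 r s : wsum a (tP r s z) z <= Num.sqrt K * Y ->
   `|(tP r s z).1 z| * W <= Num.sqrt K * Y /\ `|(tP r s z).2 z| * W <= Num.sqrt K * Y.
  rewrite /wsum -/W mulrDl => h.
  by split; apply: le_trans h; [rewrite lerDl mulr_ge0|rewrite lerDr mulr_ge0].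
have [u1 u2] := b1 _ _ k1; have [v1 v2] := b1 _ _ k2.
by split; apply: fin => //; rewrite normrN.
Qed.

End test_functions.

(** * Averages and Berezin transforms *)

Section stem_transform.
Context {R : realType}.
Local Notation H := (quat R).
Local Notation mR := (measurableTypeR R).
Local Notation P2 := (mR * mR)%type.
Local Notation pair_fun := ((R * R -> H) * (R * R -> H))%type.
Implicit Types (z p w u : P2) (F G : pair_fun).

Definition stem_transform (k : P2 -> P2 -> R) F : pair_fun :=
  (fun z => qintegral leb2 setT (fun w => k z w *: F.1 w),
   fun z => qintegral leb2 setT (fun w => k z w *: F.2 w)).

Definition stem_uloc F := forall c : qcoord, uloc (fun p => qc c (F.1 p)) /\ uloc (fun p => qc c (F.2 p)).
Definition stem_bmo F := forall c : qcoord, bmo (fun p => qc c (F.1 p)) /\ bmo (fun p => qc c (F.2 p)).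

Variables (F : pair_fun) (k : P2 -> P2 -> R) (g A m : R).
Hypotheses (sF : is_stem F) (bF : stem_bmo F).
Hypotheses (mF1 : measurable_fun setT (F.1 : P2 -> H)) (mF2 : measurable_fun setT (F.2 : P2 -> H)).
Hypotheses (g0 : 0 < g) (m0 : 0 < m).
Hypothesis mk : measurable_fun setT (fun t : P2 * P2 => k t.1 t.2).
Hypothesis kA : forall z w, 0 <= k z w <= A * gk g z w.
Hypothesis mK : forall z, (m%:E <= \int[leb2]_w (k z w)%:E)%E.

Let mkz z : measurable_fun setT (k z).
Proof. exact: measurableT_comp mk (measurable_pair1 z). Qed.

Let A0 : 0 <= A.
Proof.
have /andP[h1 h2] := kA (0, 0) (0, 0); have := le_trans h1 h2.
by rewrite pmulr_lge0// expR_gt0.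
Qed.

Let kn z w : `|k z w| <= A * gk g z w.
Proof. by have /andP[h1 h2] := kA z w; rewrite ger0_norm. Qed.

Let mc1 c : measurable_fun setT (fun p : P2 => qc c (F.1 p)).
Proof. exact: (measurable_qcP _).1 mF1 c. Qed.
Let mc2 c : measurable_fun setT (fun p : P2 => qc c (F.2 p)).
Proof. exact: (measurable_qcP _).1 mF2 c. Qed.

Lemma transform_qintegrable z : qintegrable leb2 setT (fun w => k z w *: F.1 w) /\
  qintegrable leb2 setT (fun w => k z w *: F.2 w).
Proof.
split=> c.
  have [b _] := bF c.
  have := gk_integrable A0 (mc1 c) (mkz z) (kn z) (bmo_gk_lty z (mc1 c) b g0).
  by apply: eq_integrable => // w _; rewrite /= qcZ.
have [_ b] := bF c.
have := gk_integrable A0 (mc2 c) (mkz z) (kn z) (bmo_gk_lty z (mc2 c) b g0).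
by apply: eq_integrable => // w _; rewrite /= qcZ.
Qed.

Lemma qc_transform c z :
  qc c ((stem_transform k F).1 z) = \int[leb2]_w (k z w * qc c (F.1 w)) /\
  qc c ((stem_transform k F).2 z) = \int[leb2]_w (k z w * qc c (F.2 w)).
Proof. by split; rewrite qc_qintegral; apply: eq_Rintegral => w _; rewrite qcZ. Qed.

Lemma transform_induced (f : H -> H) I z : induced_by F f -> imag_unit I ->
  qintegral leb2 setT (fun w => k z w *: f (slice_pt I w)) =
  (stem_transform k F).1 z + I * (stem_transform k F).2 z.
Proof.
move=> iF hI; have [i1 i2] := transform_qintegrable z.
rewrite -(qintegralMl measurableT I i2) -(qintegralD measurableT i1); last exact: qintegrableMl.
by apply: eq_qintegral => w _; rewrite (iF I hI) scalerDr scalerAr.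
Qed.

Lemma measurable_transform : measurable_fun setT ((stem_transform k F).1 : P2 -> H) /\
  measurable_fun setT ((stem_transform k F).2 : P2 -> H).
Proof.
split; apply/measurable_qcP => c.
  under eq_fun do rewrite (qc_transform c _).1.
  apply: (@measurable_Rintegral_leb2 R (fun t => k t.1 t.2 * qc c (F.1 t.2))).
  by apply: measurable_funM => //; exact: measurableT_comp (mc1 c) measurable_snd.
under eq_fun do rewrite (qc_transform c _).2.
apply: (@measurable_Rintegral_leb2 R (fun t => k t.1 t.2 * qc c (F.2 t.2))).
by apply: measurable_funM => //; exact: measurableT_comp (mc2 c) measurable_snd.
Qed.

Lemma stem_bounded_uloc (M : R) (D : set P2) :
  (forall u (e : R), 0 < e -> exists2 z, D z & box e u z) ->
  (forall z, D z -> `|(stem_transform k F).1 z| <= M /\ `|(stem_transform k F).2 z| <= M) ->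
  stem_uloc F.
Proof.
move=> dD DM c; have [b1 b2] := bF c; split.
  apply: (bmo_kernel_uloc (mc1 c) b1 g0 m0 mkz kA mK dD (B := M)) => z /DM[h _].
  by rewrite -(qc_transform c z).1; exact: le_trans (qc_le_norm _ _) h.
apply: (bmo_kernel_uloc (mc2 c) b2 g0 m0 mkz kA mK dD (B := M)) => z /DM[_ h].
by rewrite -(qc_transform c z).2; exact: le_trans (qc_le_norm _ _) h.
Qed.

Lemma uloc_stem_bounded : stem_uloc F -> exists M : R, forall z,
  `|(stem_transform k F).1 z| <= M /\ `|(stem_transform k F).2 z| <= M.
Proof.
move=> uF.
have h1 c := uloc_kernel A0 (mc1 c) (uF c).1 g0 mkz kn.
have h2 c := uloc_kernel A0 (mc2 c) (uF c).2 g0 mkz kn.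
have [B0 H0] := h1 Cre; have [B1 H1] := h1 Ci; have [B2 H2] := h1 Cj; have [B3 H3] := h1 Ck.
have [C0 K0] := h2 Cre; have [C1 K1] := h2 Ci; have [C2 K2] := h2 Cj; have [C3 K3] := h2 Ck.
exists (Num.max (B0 + B1 + B2 + B3) (C0 + C1 + C2 + C3)) => z.
rewrite !le_max; split.
  apply/orP; left; apply: le_trans (qnorm_le_sum _) _.
  by rewrite !(qc_transform _ z).1 !lerD.
apply/orP; right; apply: le_trans (qnorm_le_sum _) _.
by rewrite !(qc_transform _ z).2 !lerD.
Qed.

Hypothesis krefl : forall z w, k (refl z) (refl w) = k z w.

Let Rrefl (phi : P2 -> R) : measurable_fun setT phi -> \int[leb2]_w phi (refl w) = \int[leb2]_w phi w.
Proof.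
move=> mphi; rewrite /Rintegral; congr fine.
by apply: (leb2_refl (f := fun w => (phi w)%:E)); exact/measurable_EFinP.
Qed.

Lemma transform_stem : is_stem (stem_transform k F).
Proof.
move=> x y; rewrite -![(x, - y)]/(refl (x, y)); split; apply: qcP => c.
  rewrite !(qc_transform c _).1 -(@Rrefl (fun w => k (refl (x, y)) w * qc c (F.1 w))); last first.
    by apply: measurable_funM.
  by apply: eq_Rintegral => w _; rewrite krefl (stem_refl w sF).1.
rewrite qcN !(qc_transform c _).2 -(@Rrefl (fun w => k (refl (x, y)) w * qc c (F.2 w))); last first.
  by apply: measurable_funM.
rewrite -mulN1r -RintegralZl//; last first.
  have := (transform_qintegrable (x, y)).2 c.
  by apply: eq_integrable => // w _; rewrite /= qcZ.
by apply: eq_Rintegral => w _; rewrite krefl (stem_refl w sF).2 qcN; ring.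
Qed.

(** From left to right, [ae_bounded_box] finds points of controlled size in every box of the upper
    half plane and parity reflects them to the lower one; [stem_bounded_uloc] asks for no more. *)
Lemma transform_Linfty : Linfty_slice (from_stem (stem_transform k F)) <-> stem_uloc F.
Proof.
have [m1 m2] := measurable_transform; have sT := transform_stem.
split=> [[_ _ [M aeM]]|uF].
  pose D : set P2 := [set p | `|(stem_transform k F).1 p| ^+ 2 + `|(stem_transform k F).2 p| ^+ 2 <= M ^+ 2 + 1].
  have Dup u (e : R) : 0 < e -> 0 <= u.2 -> exists2 z, D z & box e u z.
    move=> e0 u0; have e20 : 0 < e / 2 by rewrite divr_gt0.
    (* Raised by e / 2 so that the box of radius e / 2 lies in the open upper half plane, the only
       part that dV sees. *)
    pose u' : P2 := (u.1, u.2 + e / 2).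
    have [|p /in_boxE[/= h1 h2] Dp] := ae_bounded_box m1 m2 aeM e20 (u := u').
      move=> p /in_boxE[/= _]; rewrite ltr_norml /upper /= => /andP[h _].
      by move: h; rewrite ltrBrDl; lra.
    exists p => //; apply/in_boxE; split.
      by apply: lt_le_trans h1 _; lra.
    by move: h2; rewrite !ltr_norml => /andP[h2 h3]; apply/andP; split; lra.
  apply: (@stem_bounded_uloc (Num.sqrt (M ^+ 2 + 1)) D).
    move=> u e e0; have [u0|u0] := leP 0 u.2; first exact: Dup.
    have u0' : 0 <= (refl u).2 by rewrite /refl /= oppr_ge0 ltW.
    have [z Dz /in_boxE[h1 h2]] := Dup (refl u) e e0 u0'.
    exists (refl z).
      by rewrite /D /mkset (stem_refl z sT).1 (stem_refl z sT).2 normrN; exact: Dz.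
    apply/in_boxE; split; first exact: h1.
    have -> : (refl z).2 - u.2 = - (z.2 - (refl u).2) by rewrite /refl /=; ring.
    by rewrite normrN.
  move=> z Dz; have MM : 0 <= M ^+ 2 + 1 by rewrite addr_ge0 ?sqr_ge0.
  have sq (t : R) : 0 <= t -> t ^+ 2 <= M ^+ 2 + 1 -> t <= Num.sqrt (M ^+ 2 + 1).
    by move=> t0 tM; rewrite -[t]ger0_norm// -sqrtr_sqr; exact: ler_wsqrtr.
  by split; apply: sq => //; apply: le_trans Dz; rewrite ?lerDl ?lerDr sqr_ge0.
have [M hM] := uloc_stem_bounded uF.
split.
- exact: measurable_from_stem.
- by exists (stem_transform k F); split => //; exact: from_stem_induced.
exists (M + M); apply: nearW => q.
rewrite /from_stem; apply: le_trans (ler_normD _ _) _.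
have [h1 h2] := hM (slice_coord q).
by rewrite qnormM (imag_unit_norm (slice_unit_imag q)) mul1r lerD.
Qed.

End stem_transform.

(** * Averages, Berezin transforms and Toeplitz operators of one symbol *)

Section symbols.
Context {R : realType}.
Local Notation H := (quat R).
Local Notation mR := (measurableTypeR R).
Local Notation P2 := (mR * mR)%type.
Local Notation pair_fun := ((R * R -> H) * (R * R -> H))%type.
Implicit Types (z p w u : P2) (F G : pair_fun) (r : R).

Let qi : H := Quat 0 1 0 0.

Definition disk r p : set P2 := [set w | (w.1 - p.1) ^+ 2 + (w.2 - p.2) ^+ 2 < r ^+ 2].

Lemma slice_disk_pt I p r : imag_unit I -> 0 < r -> slice_disk I (slice_pt I p) r = disk r p.
Proof.
move=> hI r0; apply/seteqP; split=> w; rewrite /slice_disk /disk /= slice_ptB => h.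
  by rewrite -(sqr_norm_slice_pt (w.1 - p.1, w.2 - p.2) hI) ltr_sqr ?nnegrE ?(ltW r0).
by move: h; rewrite -(sqr_norm_slice_pt (w.1 - p.1, w.2 - p.2) hI) ltr_sqr ?nnegrE ?(ltW r0).
Qed.

Let disk2 r : set (P2 * P2) := [set t | (t.2.1 - t.1.1) ^+ 2 + (t.2.2 - t.1.2) ^+ 2 < r ^+ 2].

Let measurable_disk2 r : measurable (disk2 r).
Proof.
have mf : measurable_fun setT (fun t : P2 * P2 => (t.2.1 - t.1.1) ^+ 2 + (t.2.2 - t.1.2) ^+ 2).
  by mfun.
have := mf measurableT `]-oo, r ^+ 2[%classic (measurable_itv _); rewrite setTI.
by congr measurable; apply/seteqP; split => t; rewrite /= in_itv.
Qed.

Lemma measurable_disk_indic2 r : measurable_fun setT (fun t : P2 * P2 => \1_(disk r t.1) t.2 : R).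
Proof.
have -> : (fun t : P2 * P2 => \1_(disk r t.1) t.2 : R) = \1_(disk2 r).
  by apply/funext => t; rewrite !indicE; congr (nat_of_bool _)%:R; apply/idP/idP; rewrite !inE.
exact: measurable_indic.
Qed.

Lemma measurable_disk r p : measurable (disk r p).
Proof.
have mf : measurable_fun setT (fun w : P2 => (w.1 - p.1) ^+ 2 + (w.2 - p.2) ^+ 2) by mfun.
have := mf measurableT `]-oo, r ^+ 2[%classic (measurable_itv _); rewrite setTI.
by congr measurable; apply/seteqP; split => t; rewrite /= in_itv.
Qed.

Lemma box_sub_disk r u : 0 < r -> box (r / 2) u `<=` disk r u.
Proof.
move=> r0 w /in_boxE[h1 h2]; rewrite /disk /=.
have sq (t : R) : `|t| < r / 2 -> t ^+ 2 <= (r / 2) ^+ 2.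
  by move=> h; rewrite -real_normK ?num_real// ler_sqr ?nnegrE ?divr_ge0 ?(ltW r0)// ltW.
have := sq _ h1; have := sq _ h2; have : 0 < (r / 2) ^+ 2 by rewrite exprn_gt0// divr_gt0.
have -> : r ^+ 2 = 4 * (r / 2) ^+ 2 by field.
lra.
Qed.

Variables (f : H -> H) (F : pair_fun).
Hypotheses (sF : is_stem F) (iF : induced_by F f) (mf : measurable_fun setT f).

Let mfI I : measurable_fun setT (fun p : P2 => f (slice_pt I p)).
Proof. exact: measurableT_comp mf (measurable_slice_pt I). Qed.

Lemma measurable_stem : measurable_fun setT (F.1 : P2 -> H) /\ measurable_fun setT (F.2 : P2 -> H).
Proof.
have avg p := induced_by_avg p iF imag_unit_qi; split.
  rewrite (_ : F.1 = fun p => 2^-1 *: (f (slice_pt qi p) + f (slice_pt (- qi) p))); last first.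
    by apply/funext => p; exact: (avg p).1.
  apply: measurable_qZ; first exact: measurable_cst.
  by apply: measurable_qD; exact: mfI.
rewrite (_ : F.2 = fun p => 2^-1 *: (- qi * (f (slice_pt qi p) - f (slice_pt (- qi) p)))); last first.
  by apply/funext => p; exact: (avg p).2.
apply: measurable_qZ; first exact: measurable_cst.
by apply: measurable_qM; [exact: measurable_cst|apply: measurable_qB; exact: mfI].
Qed.

(** The representation formula at the units i and - i expresses the stem by two slice restrictions.
    The same combinations of their disk averages serve as the constants of [bmo], and the box of
    radius r / 2 lies in the disk of radius [r]. *)
Lemma stem_bmo_of_BMO1 : BMO1 f -> stem_bmo F.
Proof.
move=> [_ [r r0]]; set S := ereal_sup _ => Sy.
have osc_le I u : imag_unit I -> (slice_osc r f I (slice_pt I u) <= S)%E.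
  by move=> hI; apply: ereal_sup_ubound; exists (I, slice_pt I u) => //; split => //; exists u.
have pr0 : 0 < pi * r ^+ 2 by rewrite mulr_gt0 ?pi_gt0 ?exprn_gt0.
have S0 : (0 <= S)%E.
  apply: le_trans (osc_le qi (0, 0) imag_unit_qi); rewrite /slice_osc mule_ge0//.
    by rewrite lee_fin invr_ge0 ltW.
  by apply: integral_ge0.
pose N := pi * r ^+ 2 * fine S.
have key I u : imag_unit I ->
    (\int[leb2]_(p in box (r / 2) u) `|f (slice_pt I p) - slice_avg r f I (slice_pt I u)|%:E <= N%:E)%E.
  move=> hI; apply: (@le_trans _ _ (\int[leb2]_(p in disk r u)
      `|f (slice_pt I p) - slice_avg r f I (slice_pt I u)|%:E)%E).
    apply: ge0_subset_integral => //.
    - exact: measurable_box.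
    - exact: measurable_disk.
    - apply/measurable_EFinP; apply: measurable_funS measurableT _ _ => //.
      apply: measurable_qnorm; apply: measurable_qB; [exact: mfI|exact: measurable_cst].
    - exact: box_sub_disk.
  have := osc_le I u hI; rewrite /slice_osc slice_disk_pt//.
  rewrite /N EFinM -lee_pdivrMl// fineK// ge0_fin_numE//.
have r20 : 0 < r / 2 by rewrite divr_gt0.
have hN : imag_unit (- qi) := imag_unitN (@imag_unit_qi R).
pose c1 u := slice_avg r f qi (slice_pt qi u); pose c2 u := slice_avg r f (- qi) (slice_pt (- qi) u).
have mn I (q : H) : measurable_fun setT (fun p : P2 => `|f (slice_pt I p) - q|).
  by apply: measurable_qnorm; apply: measurable_qB; [exact: mfI|exact: measurable_cst].
have sum u : (\int[leb2]_(p in box (r / 2) u)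
    (`|f (slice_pt qi p) - c1 u| + `|f (slice_pt (- qi) p) - c2 u|)%:E <= (N + N)%:E)%E.
  rewrite ge0_integralDR//; first by rewrite EFinD; apply: leeD; apply: key; [exact: imag_unit_qi|exact: hN].
  exact: measurable_box.
have [mF1 mF2] := measurable_stem.
have avg p := induced_by_avg p iF imag_unit_qi.
move=> c; split.
- exists (r / 2), (N + N), (fun u => qc c (2^-1 *: (c1 u + c2 u))); split => // u.
  apply: le_trans (sum u); apply: ge0_le_integralR => //.
  + exact: measurable_box.
  + apply: measurableT_comp => //; apply: measurable_funB => //.
    exact: (measurable_qcP _).1 mF1 c.
  + exact: measurable_funD.
  move=> p _; rewrite -qcB (avg p).1 -scalerBr opprD addrACA.
  apply: le_trans (qc_le_norm _ _) _; rewrite normrZ ger0_norm ?invr_ge0//.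
  apply: le_trans (ler_wpM2l _ (ler_normD _ _)) _; rewrite ?invr_ge0//.
  by rewrite ler_piMl ?addr_ge0// invf_le1//; lra.
- exists (r / 2), (N + N), (fun u => qc c (2^-1 *: (- qi * (c1 u - c2 u)))); split => // u.
  apply: le_trans (sum u); apply: ge0_le_integralR => //.
  + exact: measurable_box.
  + apply: measurableT_comp => //; apply: measurable_funB => //.
    exact: (measurable_qcP _).1 mF2 c.
  + exact: measurable_funD.
  move=> p _; rewrite -qcB (avg p).2 -scalerBr -mulrBr.
  have -> (x y x' y' : H) : x - y - (x' - y') = (x - x') - (y - y').
    by rewrite !opprB addrACA [RHS]addrACA [- y + _]addrC.
  apply: le_trans (qc_le_norm _ _) _; rewrite normrZ ger0_norm ?invr_ge0//.
  rewrite qnormM (imag_unit_norm hN) mul1r.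
  apply: le_trans (ler_wpM2l _ (ler_normB _ _)) _; rewrite ?invr_ge0//.
  by rewrite ler_piMl ?addr_ge0// invf_le1//; lra.
Qed.

Hypothesis bF : stem_bmo F.

Let mF1 := measurable_stem.1.
Let mF2 := measurable_stem.2.

Let gk_qnorm_le (g : R) z (h : P2 -> H) : measurable_fun setT h ->
  (\int[leb2]_w (gk g z w * `|h w|)%:E <=
   \int[leb2]_w (gk g z w * `|qc Cre (h w)|)%:E + \int[leb2]_w (gk g z w * `|qc Ci (h w)|)%:E +
   \int[leb2]_w (gk g z w * `|qc Cj (h w)|)%:E + \int[leb2]_w (gk g z w * `|qc Ck (h w)|)%:E)%E.
Proof.
move=> mh; have mg := @measurable_gk R g z.
have mq c : measurable_fun setT (fun w => gk g z w * `|qc c (h w)|).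
  by apply: measurable_funM => //; apply: measurableT_comp => //; exact: (measurable_qcP _).1 mh c.
have q0 c w : 0 <= gk g z w * `|qc c (h w)| by rewrite mulr_ge0 ?gk_ge0.
rewrite -!ge0_integralDR//; try (by move=> w; rewrite !addr_ge0);
  try (by do ?[apply: measurable_funD => //]).
apply: ge0_le_integralR => //.
- by apply: measurable_funM => //; exact: measurable_qnorm.
- by do ?[apply: measurable_funD => //].
- by move=> w; rewrite mulr_ge0 ?gk_ge0.
- by move=> w _; rewrite -!mulrDr ler_wpM2l ?gk_ge0// qnorm_le_sum.
Qed.

Let V p := `|F.1 p| + `|F.2 p|.

Let mV : measurable_fun setT V. Proof. by apply: measurable_funD; exact: measurable_qnorm. Qed.

Let gkV (g : R) z : (\int[leb2]_w (gk g z w * `|V w|)%:E =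
  \int[leb2]_w (gk g z w * `|F.1 w|)%:E + \int[leb2]_w (gk g z w * `|F.2 w|)%:E)%E.
Proof.
have mg := @measurable_gk R g z.
rewrite -ge0_integralDR//; last 4 first.
- by apply: measurable_funM => //; exact: measurable_qnorm.
- by apply: measurable_funM => //; exact: measurable_qnorm.
- by move=> w; rewrite mulr_ge0 ?gk_ge0.
- by move=> w; rewrite mulr_ge0 ?gk_ge0.
by apply: eq_integral => w _; rewrite ger0_norm ?addr_ge0// mulrDr.
Qed.

Let Vgk (g : R) : 0 < g -> (\int[leb2]_w (gk g (0%R, 0%R) w * `|V w|)%:E < +oo)%E.
Proof.
move=> g0; rewrite gkV.
have l1 c := bmo_gk_lty (0, 0) ((measurable_qcP _).1 mF1 c) (bF c).1 g0.
have l2 c := bmo_gk_lty (0, 0) ((measurable_qcP _).1 mF2 c) (bF c).2 g0.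
apply: lte_add_pinfty.
  by apply: (le_lt_trans (gk_qnorm_le _ _ mF1)); apply: lte_add_pinfty; [apply: lte_add_pinfty; [apply: lte_add_pinfty|]|]; exact: l1.
by apply: (le_lt_trans (gk_qnorm_le _ _ mF2)); apply: lte_add_pinfty; [apply: lte_add_pinfty; [apply: lte_add_pinfty|]|]; exact: l2.
Qed.

(** The coordinates may come with different box sizes; passing through Gaussian integrals brings
    them all to radius 1. *)
Let uV : stem_uloc F -> uloc V.
Proof.
move=> uF; have h1 c := uloc_gk ((measurable_qcP _).1 mF1 c) (uF c).1 ltr01.
have h2 c := uloc_gk ((measurable_qcP _).1 mF2 c) (uF c).2 ltr01.
have [B0 H0] := h1 Cre; have [B1 H1] := h1 Ci; have [B2 H2] := h1 Cj; have [B3 H3] := h1 Ck.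
have [C0 K0] := h2 Cre; have [C1 K1] := h2 Ci; have [C2 K2] := h2 Cj; have [C3 K3] := h2 Ck.
pose C := (B0 + B1 + B2 + B3) + (C0 + C1 + C2 + C3).
exists 1, (expR 2 * C); split => // u.
have mg := @measurable_gk R 1 u.
rewrite integral_boxE; apply: (@le_trans _ _ (\int[leb2]_w (expR 2 * (gk 1 u w * `|V w|))%:E)%E).
  apply: ge0_le_integralR => //.
  - by apply: measurable_funM; [exact: measurableT_comp|exact: measurable_bx].
  - by apply: measurable_funM => //; apply: measurable_funM => //; exact: measurableT_comp.
  - by move=> w; rewrite mulr_ge0 ?bx_ge0.
  move=> w _; rewrite mulrA [leRHS]mulrC ler_wpM2l//.
  rewrite /bx indicE; case: (boolP (w \in _)) => [|_]; last by rewrite mulr_ge0 ?expR_ge0.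
  rewrite inE /gk -expRD => /in_boxE[d1 d2] /=.
  have sq (t : R) : `|t| < 1 -> t ^+ 2 <= 1.
    by move=> t1; rewrite -real_normK ?num_real// expr_le1// ltW.
  by rewrite -[leLHS]expR0 ler_expR; have := sq _ d1; have := sq _ d2; lra.
rewrite ge0_integralZR ?expR_ge0//; last 2 first.
- by apply: measurable_funM => //; exact: measurableT_comp.
- by move=> w; rewrite mulr_ge0 ?gk_ge0.
rewrite EFinM; apply: lee_wpmul2l; first by rewrite lee_fin expR_ge0.
rewrite gkV /C EFinD; apply: leeD.
  by apply: (le_trans (gk_qnorm_le _ _ mF1)); rewrite !EFinD; do !apply: leeD.
by apply: (le_trans (gk_qnorm_le _ _ mF2)); rewrite !EFinD; do !apply: leeD.
Qed.

Let scaled (k : P2 -> P2 -> R) (b : R) z :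
  qintegrable leb2 setT (fun w => k z w *: F.1 w) -> qintegrable leb2 setT (fun w => k z w *: F.2 w) ->
  (stem_transform (fun z w => b * k z w) F).1 z = b *: (stem_transform k F).1 z /\
  (stem_transform (fun z w => b * k z w) F).2 z = b *: (stem_transform k F).2 z.
Proof.
move=> i1 i2; split; rewrite /stem_transform /=.
  rewrite -(@qintegral_linear _ _ _ _ _ measurableT (fun q => b *: q))//.
  - by apply: eq_qintegral => w _; rewrite scalerA.
  - by move=> x y; rewrite scalerDr.
  - by move=> d x; rewrite !scalerA mulrC.
rewrite -(@qintegral_linear _ _ _ _ _ measurableT (fun q => b *: q))//.
- by apply: eq_qintegral => w _; rewrite scalerA.
- by move=> x y; rewrite scalerDr.
- by move=> d x; rewrite !scalerA mulrC.
Qed.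

Let gk1 (b : R) z w : 0 <= gk b z w <= 1 * gk b z w.
Proof. by rewrite mul1r lexx gk_ge0. Qed.

Let berezinE (b : R) : 0 < b -> berezin b f = from_stem (stem_transform (fun z w => b / pi * gk b z w) F).
Proof.
move=> b0; apply/funext => q; rewrite /berezin.
set I := slice_unit q; have hI : imag_unit I := slice_unit_imag q.
set p := slice_coord q.
have [i1 i2] := transform_qintegrable bF mF1 mF2 b0 (measurable_gk2 b) (gk1 b) p.
have [e1 e2] := scaled (b / pi) i1 i2.
rewrite /from_stem -/I -/p e1 e2 -scalerAr -scalerDr; congr (_ *: _).
rewrite -(transform_induced bF mF1 mF2 b0 (measurable_gk2 b) (gk1 b) p iF hI).
apply: eq_qintegral => w _; congr (_ *: _).
by rewrite -{1}(slice_coordK q) slice_ptB sqr_norm_slice_pt.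
Qed.

Let berezin_Linfty (b : R) : 0 < b -> Linfty_slice (berezin b f) <-> stem_uloc F.
Proof.
move=> b0; rewrite berezinE//; have [C C0 hC] := integral_gk b0.
have bp : 0 < b / pi by rewrite divr_gt0 ?pi_gt0.
apply: (transform_Linfty (g := b) (A := b / pi) (m := b / pi * C)) => //.
- by rewrite mulr_gt0.
- by apply: measurable_funM => //; exact: measurable_gk2.
- by move=> z w; rewrite lexx mulr_ge0 ?gk_ge0// ltW.
- move=> z; rewrite ge0_integralZR ?(ltW bp)//.
  + by rewrite hC -EFinM.
  + exact: measurable_gk.
  + by move=> w; exact: gk_ge0.
- by move=> z w; rewrite /gk /refl /=; congr (_ * expR (_ * _)); ring.
Qed.

Let dk r z w : R := \1_(disk r z) w.

Let dk_le r z w : 0 <= dk r z w <= expR (r ^+ 2) * gk 1 z w.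
Proof.
rewrite /dk indicE; case: (boolP (w \in _)) => [|_]; last by rewrite /= lexx mulr_ge0 ?expR_ge0.
rewrite inE /disk /= => h; rewrite ler01 /gk -expRD -[leLHS]expR0 ler_expR.
by lra.
Qed.

Let averageE r : 0 < r -> average r f = from_stem (stem_transform (fun z w => (pi * r ^+ 2)^-1 * dk r z w) F).
Proof.
move=> r0; apply/funext => q; rewrite /average /slice_avg.
set I := slice_unit q; have hI : imag_unit I := slice_unit_imag q.
set p := slice_coord q.
have [i1 i2] := transform_qintegrable bF mF1 mF2 ltr01 (measurable_disk_indic2 r) (dk_le r) p.
have [e1 e2] := scaled ((pi * r ^+ 2)^-1) i1 i2.
rewrite /from_stem -/I -/p e1 e2 -(scalerAr _ I) -(scalerDr (pi * r ^+ 2)^-1); congr (_ *: _).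
rewrite -(transform_induced bF mF1 mF2 ltr01 (measurable_disk_indic2 r) (dk_le r) p iF hI).
rewrite -{1}(slice_coordK q) slice_disk_pt//.
apply: qcP => c; rewrite !qc_qintegral Rintegral_mkcond; apply: eq_Rintegral => w _.
by rewrite patchE /dk indicE qcZ; case: (w \in _) => /=; rewrite ?mul1r ?mul0r.
Qed.

Let average_Linfty r : 0 < r -> Linfty_slice (average r f) <-> stem_uloc F.
Proof.
move=> r0; rewrite averageE//.
have pr0 : 0 < pi * r ^+ 2 by rewrite mulr_gt0 ?pi_gt0 ?exprn_gt0.
have pr1 : 0 < (pi * r ^+ 2)^-1 by rewrite invr_gt0.
(* The indicator of the disk is at most exp (r^2) times the Gaussian of rate 1, and the disk
   contains the box of radius r / 2, of area r^2. *)
apply: (transform_Linfty (g := 1) (A := (pi * r ^+ 2)^-1 * expR (r ^+ 2)) (m := (pi * r ^+ 2)^-1 * r ^+ 2)) => //.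
- by rewrite mulr_gt0// exprn_gt0.
- by apply: measurable_funM => //; exact: measurable_disk_indic2.
- move=> z w; have /andP[d0 d1] := dk_le r z w.
  by rewrite mulr_ge0 ?(ltW pr1)//= -mulrA ler_wpM2l ?(ltW pr1).
- move=> z; have md : measurable_fun setT (dk r z) by apply: measurable_indic; exact: measurable_disk.
  rewrite ge0_integralZR ?(ltW pr1)//.
  rewrite EFinM; apply: lee_wpmul2l; first by rewrite lee_fin ltW.
  apply: (@le_trans _ _ (\int[leb2]_w (bx (r / 2) z w)%:E)%E).
    have := integral_boxE (r / 2) z (cst (1 : R)); under [in X in _ = X -> _]eq_integral do rewrite /cst mul1r.
    move=> <-; rewrite integral_box_cst ?divr_ge0 ?(ltW r0)// lee_fin.
    by rewrite mul1r mulrC divfK.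
  apply: ge0_le_integralR => //.
  - exact: measurable_bx.
  move=> w _; rewrite /bx /dk !indicE; case: (boolP (w \in box _ _)) => [|_]; last by rewrite ler0n.
  by rewrite inE => /(box_sub_disk r0) h; rewrite mem_set.
- move=> z w; rewrite /dk !indicE; congr (_ * (nat_of_bool _)%:R).
  have e : (- w.2 - - z.2) ^+ 2 = (w.2 - z.2) ^+ 2 by ring.
  by apply/idP/idP; rewrite !inE /disk /refl /= e.
Qed.

Let toeplitz_uloc (a : R) : 0 < a -> toeplitz_bounded a f <-> stem_uloc F.
Proof.
move=> a0; split=> [tb|uF]; last exact: (toeplitz_bounded_of_uloc a0 sF iF mF1 mF2 Vgk (uV uF)).
have [M hM] := toeplitz_bounded_berezin a0 sF iF mF1 mF2 Vgk tb.
have [C C0 hC] := integral_gk a0.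
have bp : 0 < a / pi by rewrite divr_gt0 ?pi_gt0.
apply: (@stem_bounded_uloc _ _ (fun z w => a / pi * gk a z w) a (a / pi) (a / pi * C) bF mF1 mF2 a0 _ _ _ _ M setT).
- by rewrite mulr_gt0.
- by apply: measurable_funM => //; exact: measurable_gk2.
- by move=> z w; rewrite lexx mulr_ge0 ?gk_ge0// ltW.
- move=> z; rewrite ge0_integralZR ?(ltW bp)//.
  + by rewrite hC -EFinM.
  + exact: measurable_gk.
  + by move=> w; exact: gk_ge0.
- by move=> u e e0; exists u => //; apply/in_boxE; rewrite !subrr normr0.
- by move=> z _; exact: hM.
Qed.

Lemma symbol_equivalences (a : R) : 0 < a ->
  [<-> toeplitz_bounded a f;
       Linfty_slice (berezin a f);
       exists2 beta : R, 0 < beta & Linfty_slice (berezin beta f);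
       forall beta : R, 0 < beta -> Linfty_slice (berezin beta f);
       exists2 r : R, 0 < r & Linfty_slice (average r f);
       forall r : R, 0 < r -> Linfty_slice (average r f)].
Proof.
move=> a0; tfae.
- by move=> /(toeplitz_uloc a0)/(berezin_Linfty a0).
- by exists a.
- by move=> [b b0 /(berezin_Linfty b0) uF] c c0; apply/(berezin_Linfty c0).
- by move=> h; exists 1 => //; apply/(average_Linfty ltr01)/(berezin_Linfty ltr01); exact: h.
- by move=> [r r0 /(average_Linfty r0) uF] s s0; apply/(average_Linfty s0).
- by move=> h; apply/(toeplitz_uloc a0)/(average_Linfty ltr01); exact: h.
Qed.

End symbols.

Theorem theorem1p3 (R : realType) (alpha : R) (f : quat R -> quat R)
    (halpha : 0 < alpha) (fmeas : measurable_fun [set: quat R]%classic f)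
    (fslice : slice_fun f) (fBMO : BMO1 f) :
  [<-> toeplitz_bounded alpha f;
       Linfty_slice (berezin alpha f);
       exists2 beta : R, 0 < beta & Linfty_slice (berezin beta f);
       forall beta : R, 0 < beta -> Linfty_slice (berezin beta f);
       exists2 r : R, 0 < r & Linfty_slice (average r f);
       forall r : R, 0 < r -> Linfty_slice (average r f)].
Proof.
have [F [sF iF]] := fslice.
exact (symbol_equivalences sF iF fmeas (stem_bmo_of_BMO1 iF fmeas fBMO) halpha).
Qed.
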